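(* Let $\mu>0$ and $0<\epsilon<\frac{\mu^2}4$. Then $$\int_0^\infty|Tf|^2d\mu\ \ge\ 2\int_0^\infty fLf\,d\mu$$ for all $f\in\mathcal D_\mu$ satisfying $\int_0^\infty fLf_0\,d\mu=0$. Moreover, the constant $2$ is optimal and is achieved at $$f_1(x):=(\mu-b)\,{}_1F_1(\mu-b+1,\mu,-x)-\frac{\mu-2b+1}{2}\,{}_1F_1(\mu-b,\mu,-x)=-\frac12\Big[(1-\mu)f_0(x)-2xf_0'(x)\Big],$$ up to a constant factor. Consequently, for all $f\in\mathcal D_\mu$, $$Q[f]+P_1[f]-\Big(1+\sqrt{\mu^2-4\epsilon}\Big)P_0[f]=\int_0^\infty|Tf|^2d\mu\ \ge\ 2\inf_{C\in\mathbb R}\int_0^\infty|f'-Cf_0'|^2x\,d\mu=2\Big[\int_0^\infty|f'|^2x\,d\mu-\frac{\big(\int_0^\infty f'f_0'x\,d\mu\big)^2}{\int_0^\infty|f_0'|^2x\,d\mu}\Big],$$ with equality in the inequality exactly for $f$ in the linear span of $f_0$ and $f_1$.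
   Context: Functions are real-valued. ${}_1F_1$ is Kummer's confluent hypergeometric function. For $\mu>0$, $0<\epsilon<\mu^2/4$: $$Q[f]:=\int_0^\infty|f''|^2x^{\mu+1}dx,\quad P_1[f]:=\int_0^\infty\big(x^2|f'|^2-\epsilon|f|^2\big)x^{\mu-1}dx,\quad P_0[f]:=\int_0^\infty|f'|^2x^{\mu}dx,$$ $$b:=\frac{\mu-\sqrt{\mu^2-4\epsilon}}{2},\qquad f_0(x):=e^{-x}{}_1F_1(b,\mu,x)={}_1F_1(\mu-b,\mu,-x),$$ $$Tf:=xf''+(x+\mu)f'+(\mu-b)f,\qquad Lf:=-xf''-\mu f',\qquad d\mu:=x^{\mu-1}dx ,$$ so that $\int_0^\infty fLf\,d\mu=\int_0^\infty|f'|^2x\,d\mu=P_0[f]$ and $\int_0^\infty fLf_0\,d\mu=\int_0^\infty f'f_0'\,x\,d\mu$. The space $\mathcal D_\mu$ is the completion of $C_c^\infty([0,\infty))$ (smooth functions with compact support in $[0,\infty)$, not required to vanish at $0$) with respect to the norm $$\|f\|_{\mathcal D_\mu}^2:=\int_0^\infty|f''|^2x^{\mu+1}dx+\int_0^\infty|f'|^2x^{\mu+1}dx+\int_0^\infty|f'|^2x^{\mu-1}dx+\int_0^\infty|f|^2x^{\mu-1}dx .$$ *)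

(* Defs.v *)
From HB Require Import structures.
From mathcomp Require Import all_boot all_order all_algebra.
From mathcomp Require Import all_classical all_reals all_analysis.
Import Order.TTheory GRing.Theory Num.Theory.
Import numFieldNormedType.Exports.

Set Implicit Arguments.
Unset Strict Implicit.
Unset Printing Implicit Defensive.

Local Open Scope classical_set_scope.
Local Open Scope ring_scope.

Definition rising {R : realType} (a : R) (n : nat) : R :=
  \prod_(i < n) (a + i%:R).

Definition kummer {R : realType} (a c x : R) : R :=
  limn (pseries (fun n => rising a n / (rising c n * n`!%:R)) x).

Definition half_line {R : realType} : set R := `]0, +oo[.

(* Real-valued integral: on [D_space] below every integrand this is applied to
   is absolutely integrable, by Cauchy-Schwarz with the norm of the space. *)
Definition int_half {R : realType} (g : R -> R) : R :=
  \int[lebesgue_measure]_(x in half_line) g x.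

Definition int_dmu {R : realType} (mu : R) (g : R -> R) : R :=
  int_half (fun x => g x * x `^ (mu - 1)).

(* A function together with its first two derivatives. For a general element
   of the completion [D_space] below, these are the limits of (f, f', f'')
   along the approximating sequence in the respective weighted L^2 spaces;
   the second and third components are then the weak derivatives of the first
   on ]0, +oo[, and are determined by it up to null sets. *)
Record jet (R : realType) := Jet { j0 : R -> R ; j1 : R -> R ; j2 : R -> R }.

Definition jet_of {R : realType} (f : R -> R) : jet R :=
  Jet f f^`()%classic f^`(2)%classic.

Definition jadd {R : realType} (F G : jet R) : jet R :=
  Jet (j0 F \+ j0 G) (j1 F \+ j1 G) (j2 F \+ j2 G).

Definition jsub {R : realType} (F G : jet R) : jet R :=
  Jet (j0 F \- j0 G) (j1 F \- j1 G) (j2 F \- j2 G).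

Definition jscale {R : realType} (c : R) (F : jet R) : jet R :=
  Jet (fun x => c * j0 F x) (fun x => c * j1 F x) (fun x => c * j2 F x).

(* Valued in \bar R, so that a divergent integral counts as +oo. *)
Definition D_normsq {R : realType} (mu : R) (F : jet R) : \bar R :=
  (\int[lebesgue_measure]_(x in half_line) (j2 F x ^+ 2 * x `^ (mu + 1))%:E
   + \int[lebesgue_measure]_(x in half_line) (j1 F x ^+ 2 * x `^ (mu + 1))%:E
   + \int[lebesgue_measure]_(x in half_line) (j1 F x ^+ 2 * x `^ (mu - 1))%:E
   + \int[lebesgue_measure]_(x in half_line) (j0 F x ^+ 2 * x `^ (mu - 1))%:E)%E.

(* C_c^oo([0, +oo[), as restrictions to [0, +oo[ of smooth functions on the
   line: nothing is required at 0, and the values on ]-oo, 0[ are irrelevant. *)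
Definition test_fun {R : realType} (phi : R -> R) : Prop :=
  (forall (n : nat) (x : R), derivable (phi^`(n))%classic x 1) /\
  (exists M : R, forall x, M < x -> phi x = 0).

(* The completion of C_c^oo([0, +oo[) for the norm above. As phi |->
   (phi, phi', phi'') is an isometry into the complete space
   L^2(x^(mu-1) dx) * L^2((x^(mu+1) + x^(mu-1)) dx) * L^2(x^(mu+1) dx),
   the completion is the closure of the image in that product. Equality of
   two elements F, G of the completion is [D_eq mu F G]. *)
Definition D_space {R : realType} (mu : R) (F : jet R) : Prop :=
  [/\ measurable_fun half_line (j0 F),
      measurable_fun half_line (j1 F),
      measurable_fun half_line (j2 F) &
      forall e : R, 0 < e ->
        exists2 phi, test_fun phi &
          (D_normsq mu (jsub F (jet_of phi)) < e%:E)%E].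

Definition D_eq {R : realType} (mu : R) (F G : jet R) : Prop :=
  D_normsq mu (jsub F G) = 0%E.

Definition Qf {R : realType} (mu : R) (F : jet R) : R :=
  int_half (fun x => j2 F x ^+ 2 * x `^ (mu + 1)).

Definition P1f {R : realType} (mu eps : R) (F : jet R) : R :=
  int_half (fun x =>
    (x ^+ 2 * j1 F x ^+ 2 - eps * j0 F x ^+ 2) * x `^ (mu - 1)).

Definition P0f {R : realType} (mu : R) (F : jet R) : R :=
  int_half (fun x => j1 F x ^+ 2 * x `^ mu).

Definition bpar {R : realType} (mu eps : R) : R :=
  (mu - Num.sqrt (mu ^+ 2 - 4 * eps)) / 2.

Definition Top {R : realType} (mu eps : R) (F : jet R) (x : R) : R :=
  x * j2 F x + (x + mu) * j1 F x + (mu - bpar mu eps) * j0 F x.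

Definition Lop {R : realType} (mu : R) (F : jet R) (x : R) : R :=
  - x * j2 F x - mu * j1 F x.

Definition f0 {R : realType} (mu eps : R) (x : R) : R :=
  expR (- x) * kummer (bpar mu eps) mu x.

Definition f1 {R : realType} (mu eps : R) (x : R) : R :=
  (mu - bpar mu eps) * kummer (mu - bpar mu eps + 1) mu (- x)
  - (mu - 2 * bpar mu eps + 1) / 2 * kummer (mu - bpar mu eps) mu (- x).

(* Main.v *)
Require Import Defs.
From HB Require Import structures.
From mathcomp Require Import all_boot all_order all_algebra.
From mathcomp Require Import all_classical all_reals all_analysis.
From mathcomp Require Import measurable_realfun ring lra.
Import Order.TTheory GRing.Theory Num.Theory.
Import numFieldNormedType.Exports.
Local Open Scope classical_set_scope.
Local Open Scope ring_scope.
Set Implicit Arguments.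
Unset Strict Implicit.

(* Put a = mu - b, so that eps = a (mu - a), let |.| be the norm of L^2(dmu) and
   let k = f0', which has no zero on [0, +oo[ and solves W k = 0, where
   W g = x g'' + (x + mu + 1) g' + (a + 1) g. If f is a test function orthogonal
   to f0, variation of parameters on e^x k yields q, vanishing near +oo, with
     x q'' + (mu + 1 - x) q' - (mu - a) q = f'.
   For Y = x q' + mu q, integrations by parts give
     P0[f] = - <T f, Y>,   |Y|^2 = int q'^2 x^(mu+1),
     P0[f] = 2 |Y|^2 + int (W q)^2 x^mu,
   whence |T f|^2 - 2 P0[f] = |T f + 2 Y|^2 + 2 int (W q)^2 x^mu >= 0. If f is
   also orthogonal to f1, then q is orthogonal to k' in the problem with
   parameters (mu + 1, a + 1), where T is W; the inequality just proved, applied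
   to q there, gives int (W q)^2 x^mu >= 2 |Y|^2, and then Cauchy-Schwarz on
   P0[f] = - <T f, Y> improves the constant 2 to 4. Both bounds extend to the
   completion by density. As <T f, T f1> = 2 P0(f, f1), removing the component
   of an extremal f along f1 leaves an extremal orthogonal to f1, hence null. *)

(** The equation for q is the adjoint one. In L^2(x^mu dx) the operator S q = x q'' + (mu + 1 - x)
    q' - (mu - a) q is the adjoint of W, and (T f)' = W f'. Since Y dmu = d(x^mu q), moving the
    derivative off x^mu q turns <T f, Y> into - int f' (S q) x^mu, which is - P0[f] once S q = f'.
    The solvability condition of this equation is that f' be orthogonal to the kernel element f0' of
    W, and that is the constraint. The constant 2 comes from the commutator of W and S. The
    symmetric part of W is a constant minus L (with mu + 1 for mu), its skew part generates
    dilations, and L is homogeneous of degree -1; hence int (S q)^2 x^mu - int (W q)^2 x^mu = 2 int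
    q'^2 x^(mu+1). The obstacle is the equality case. Since q is built only for f vanishing near
    +oo, and a limit keeps the inequality but not the sum of squares behind it, extremals in the
    completion cannot be read off from that sum. A larger constant on the subspace orthogonal to f1
    does survive the limit, and any constant above 2 would serve. *)

(** * Derivatives of real functions and limits at 0 from the right *)

Section calculus.
Context {R : realType}.
Implicit Types (f g B : R -> R) (x : R).

Lemma isd_eq f x (a b : R) : is_derive x 1 f a -> a = b -> is_derive x 1 f b.
Proof. by move=> ? <-. Qed.

Lemma isd_cst (c x : R) : is_derive x 1 (fun=> c) 0.
Proof. exact: is_derive_cst. Qed.

Lemma isd_id (x : R) : is_derive x 1 (fun t : R => t) 1.
Proof. exact: is_derive_id. Qed.

Lemma isdD f g x (a b : R) : is_derive x 1 f a -> is_derive x 1 g b ->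
  is_derive x 1 (fun t => f t + g t) (a + b).
Proof. by move=> ? ?; exact: is_deriveD. Qed.

Lemma isdN f x (a : R) : is_derive x 1 f a -> is_derive x 1 (fun t => - f t) (- a).
Proof. by move=> ?; exact: is_deriveN. Qed.

Lemma isdM f g x (a b : R) : is_derive x 1 f a -> is_derive x 1 g b ->
  is_derive x 1 (fun t => f t * g t) (f x * b + g x * a).
Proof. by move=> ? ?; exact: is_deriveM. Qed.

Lemma isdV f x (a : R) : f x != 0 -> is_derive x 1 f a ->
  is_derive x 1 (fun t => (f t)^-1) (- (f x) ^- 2 * a).
Proof. by move=> fx0 df; exact: is_deriveV. Qed.

Lemma isd_comp f g x (a b : R) : is_derive (g x) 1 f a -> is_derive x 1 g b ->
  is_derive x 1 (fun t => f (g t)) (a * b).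
Proof. by move=> ? ?; exact: is_derive1_comp. Qed.

Lemma isd_expR (x : R) : is_derive x 1 expR (expR x).
Proof. exact: is_derive_expR. Qed.

Lemma isd_powR (p x : R) : 0 < x ->
  is_derive x 1 (fun t => t `^ p) (p * x `^ (p - 1)).
Proof. by move=> ?; exact: is_derive1_powR. Qed.

Lemma isd_val f x (a : R) : is_derive x 1 f a -> f^`()%classic x = a.
Proof. by move=> df; rewrite derive1E; exact: derive_val. Qed.

Lemma isd_near f g x (a : R) : (\forall t \near x, f t = g t) ->
  is_derive x 1 f a -> is_derive x 1 g a.
Proof.
move=> fg [df fa]; split.
  by apply: near_eq_derivable df; rewrite ?oner_eq0.
by rewrite -fa; apply/esym/near_eq_derive; rewrite ?oner_eq0.
Qed.

Lemma isd_pos f g x (a : R) : 0 < x -> (forall t, 0 < t -> f t = g t) ->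
  is_derive x 1 f a -> is_derive x 1 g a.
Proof.
move=> x0 fg; apply: isd_near.
by near=> t; apply: fg; near: t; exact: lt_nbhsr.
Unshelve. all: by end_near. Qed.

Lemma isd_cont f x (a : R) : is_derive x 1 f a -> {for x, continuous f}.
Proof. by case=> df _; exact/differentiable_continuous/derivable1_diffP. Qed.

Lemma isd_mono f (df : R -> R) (x y : R) : x <= y ->
  (forall t, x <= t <= y -> is_derive t 1 f (df t)) ->
  (forall t, x < t < y -> 0 <= df t) -> f x <= f y.
Proof.
rewrite le_eqVlt => /predU1P[->//|xy] fd df0.
have [z zxy||z] := @MVT R f df x y xy.
- by apply: fd; move: zxy; rewrite in_itv/= => /andP[/ltW-> /ltW].
- apply: derivable_within_continuous => z /[!in_itv]/= zxy.
  by case: (fd z zxy).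
- rewrite in_itv/= => zxy e; rewrite -subr_ge0 e mulr_ge0 ?df0 ?subr_ge0//.
  exact: ltW.
Qed.

Lemma isd_mono_lt f (df : R -> R) (x y : R) : x < y ->
  (forall t, x <= t <= y -> is_derive t 1 f (df t)) ->
  (forall t, x < t < y -> 0 < df t) -> f x < f y.
Proof.
move=> xy fd df0.
have [z zxy||z] := @MVT R f df x y xy.
- by apply: fd; move: zxy; rewrite in_itv/= => /andP[/ltW-> /ltW].
- apply: derivable_within_continuous => z /[!in_itv]/= zxy.
  by case: (fd z zxy).
- by rewrite in_itv/= => zxy e; rewrite -subr_gt0 e mulr_gt0 ?df0 ?subr_gt0.
Qed.

Lemma nondecreasing_at0_ge0 f (M : R) :
  (forall x y, 0 < x -> x <= y -> y <= M -> f x <= f y) ->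
  f x @[x --> 0^'+] --> 0 -> forall x, 0 < x -> x <= M -> 0 <= f x.
Proof.
move=> fm f0 x x0 xM; apply: (cvgr_to_le f0).
near=> y; apply: fm => //.
by near: y; exact: nbhs_right_le.
Unshelve. all: by end_near. Qed.

Lemma isd0_cst f (M : R) (l : R) :
  (forall x, 0 < x -> x < M -> is_derive x 1 f 0) ->
  f x @[x --> 0^'+] --> l -> forall x, 0 < x -> x < M -> f x = l.
Proof.
move=> fd f0 x x0 xM; apply/eqP; rewrite eq_le.
have h y : 0 < y -> y <= x -> f y = f x.
  move=> y0 yx; apply/eqP; rewrite eq_le; apply/andP; split.
    apply: (isd_mono (df := fun=> 0)) => // t /andP[yt tx].
    by apply: fd; [exact: lt_le_trans yt|exact: le_lt_trans xM].
  rewrite -lerN2; apply: (isd_mono (f := fun t => - f t) (df := fun=> 0)) => // t /andP[yt tx].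
  rewrite -oppr0; apply: isdN.
  by apply: fd; [exact: lt_le_trans yt|exact: le_lt_trans xM].
apply/andP; split.
  apply: (cvgr_to_ge f0); near=> y; rewrite -(h y)//.
  by near: y; exact: nbhs_right_le.
apply: (cvgr_to_le f0); near=> y; rewrite -(h y)//.
by near: y; exact: nbhs_right_le.
Unshelve. all: by end_near. Qed.

Lemma bounded_powR_cvg0 (p C : R) f : 0 < p ->
  (forall x, 0 < x -> x <= 1 -> `|f x| <= C * x `^ p) ->
  f x @[x --> 0^'+] --> 0.
Proof.
move=> p0 fC; apply/norm_cvg0P.
have h : C * x `^ p @[x --> 0^'+] --> 0.
  by rewrite -[X in _ --> X](mulr0 C); apply: cvgMr; exact: powR_cvg0.
apply: (@squeeze_cvgr _ _ _ _ (fun=> 0) _ _ _ _ (cvg_cst _) h).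
near=> x; rewrite normr_ge0/=; apply: fC => //.
by near: x; apply: nbhs_right_le; exact: ltr01.
Unshelve. all: by end_near. Qed.

End calculus.

(** * Integrability and primitives on the half-line *)

Section halfline_integrals.
Context {R : realType}.
Local Notation lam := (@lebesgue_measure R).
Implicit Types (f g E : R -> R) (x : R).

(** A record, so that [apply] does not unfold the predicate into a statement about points; the
    coercion still lets a proof of it be applied to a point. *)
Record cpos f : Prop := CPos
  { cpos_at : forall x, 0 < x -> {for x, continuous f} }.
Coercion cpos_at : cpos >-> Funclass.

Lemma measurable_half_line : measurable (@half_line R).
Proof. exact: measurable_itv. Qed.

Lemma half_lineP x : half_line x <-> 0 < x.
Proof. by rewrite /half_line /= in_itv/= andbT. Qed.

Lemma cpos_measurable f : cpos f -> measurable_fun half_line f.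
Proof.
move=> cf; apply: open_continuous_measurable_fun; first exact: interval_open.
by move=> x; rewrite inE => /half_lineP x0; exact: cf.
Qed.

Lemma cposS f (A : set R) : cpos f -> measurable A -> A `<=` half_line ->
  measurable_fun A f.
Proof.
move=> cf mA Ah; apply: (measurable_funS measurable_half_line Ah).
exact: cpos_measurable.
Qed.

Lemma segment_integral g E (a b : R) : 0 < a ->
  cpos g -> (forall x, 0 < x -> is_derive x 1 E (g x)) -> a < b ->
  (\int[lam]_(x in `[a, b]) (g x)%:E = (E b - E a)%:E)%E.
Proof.
move=> a0 cg dE ab; rewrite EFinB; apply: continuous_FTC2 => //.
- apply: continuous_in_subspaceT => x; rewrite inE/= in_itv/= => /andP[ax _].
  by apply: cg; exact: lt_le_trans ax.
- have cE : {within `[a, b], continuous E}.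
    apply: derivable_within_continuous => x; rewrite in_itv/= => /andP[ax _].
    by case: (dE x (lt_le_trans a0 ax)).
  have [_ Ea Eb] := (continuous_within_itvP _ ab).1 cE.
  split => // x; rewrite in_itv/= => /andP[ax _].
  by case: (dE x (lt_trans a0 ax)).
- move=> x; rewrite in_itv/= => /andP[ax _].
  exact: isd_val (dE x (lt_trans a0 ax)).
Qed.

(** Over each segment the integral of [g] is a difference of two values of [E], hence at most 2 K,
    and monotone convergence passes to the union. This serves both the singularity of the weight at
    0 and the behaviour at +oo. *)
Lemma ge0_integrable_exhaust g E (K : R) (a b : nat -> R) :
  0 <= K -> (forall n, 0 < a n) -> nonincreasing_seq a -> nondecreasing_seq b ->
  cpos g -> (forall x, 0 < x -> is_derive x 1 E (g x)) ->
  (forall n x, `[a n, b n]%classic x -> 0 <= g x) ->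
  (forall n x, `[a n, b n]%classic x -> `|E x| <= K) ->
  lam.-integrable (\bigcup_n `[a n, b n]%classic) (EFin \o g).
Proof.
move=> K0 a0 ad bi cg dE g0 EK.
have sub : \bigcup_n `[a n, b n]%classic `<=` half_line.
  move=> x [n _] /=; rewrite in_itv/= => /andP[ax _]; apply/half_lineP.
  exact: lt_le_trans ax.
have mg A : measurable A -> A `<=` half_line -> measurable_fun A (EFin \o g).
  by move=> mA /(cposS cg mA) ?; exact/measurable_EFinP.
have mU : measurable (\bigcup_n `[a n, b n]%classic) by exact: bigcupT_measurable.
apply/integrableP; split; first exact: mg.
have -> : (\int[lam]_(x in \bigcup_n `[a n, b n]%classic) `|(EFin \o g) x| =
    \int[lam]_(x in \bigcup_n `[a n, b n]%classic) (g x)%:E)%E.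
  by apply: eq_integral => x; rewrite inE => -[n _ /g0 gx] /=; rewrite ger0_norm.
apply: (@le_lt_trans _ _ (K + K)%:E); last exact: ltry.
have cvgU : (\int[lam]_(x in `[a n, b n]) (g x)%:E @[n --> \oo] -->
    \int[lam]_(x in \bigcup_n `[a n, b n]%classic) (g x)%:E)%E.
  apply: ge0_nondecreasing_set_cvg_integral => //.
  - move=> m n mn; apply/subsetPset; apply: subset_itvScc.
      by rewrite bnd_simp ad.
    by rewrite bnd_simp bi.
  - by move=> n; apply: mg => // x xn; apply: sub; exists n.
apply: (cvge_to_le cvgU).
(* Segments may be empty or reduced to a point, so each order of the end points has to be
   treated. *)
near=> n; have [ab|ab|ab] := ltgtP (a n) (b n).
- rewrite (segment_integral _ cg)//.
  have /EK : `[a n, b n]%classic (a n) by rewrite /= in_itv/= lexx ltW.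
  have /EK : `[a n, b n]%classic (b n) by rewrite /= in_itv/= lexx ltW.
  by rewrite !ler_norml lee_fin => /andP[? ?] /andP[? ?]; lra.
- rewrite set_itv_ge ?integral_set0; last by rewrite bnd_simp -ltNge.
  by rewrite lee_fin addr_ge0.
- by rewrite ab set_itv1 integral_set1 lee_fin addr_ge0.
Unshelve. all: by end_near. Qed.

Lemma integrable_powR_at0 (p M : R) : 0 < p ->
  lam.-integrable `]0, M] (EFin \o (fun x => x `^ (p - 1))).
Proof.
move=> p0.
have -> : `]0, M]%classic = \bigcup_n `[n.+1%:R^-1, M]%classic.
  apply/seteqP; split => x /=; last first.
    by move=> [n _] /=; rewrite !in_itv/= => /andP[nx ->]; rewrite andbT (lt_le_trans _ nx).
  rewrite in_itv/= => /andP[x0 xM]; exists (Num.truncn x^-1) => //=.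
  by rewrite in_itv/= xM andbT invf_ple ?posrE// ltW// truncnS_gt.
apply: (@ge0_integrable_exhaust _ (fun x => p^-1 * x `^ p) (p^-1 * `|M| `^ p)).
- by rewrite mulr_ge0 ?invr_ge0 ?powR_ge0// ltW.
- by move=> n; rewrite invr_gt0.
- by move=> m n mn; rewrite lef_pV2 ?posrE// ler_nat ltnS.
- by [].
- by split=> x x0; apply: isd_cont (isd_powR _ x0).
- move=> x x0; apply: isd_eq (isdM (isd_cst p^-1 x) (isd_powR p x0)) _.
  by field; rewrite gt_eqF.
- by move=> n x _; exact: powR_ge0.
- move=> n x; rewrite /= in_itv/= => /andP[nx xM].
  have x0 : 0 <= x by rewrite (le_trans _ nx).
  rewrite ger0_norm; last by rewrite mulr_ge0 ?invr_ge0 ?powR_ge0// ltW.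
  rewrite ler_wpM2l ?invr_ge0 ?(ltW p0)//.
  by apply: ge0_ler_powR; rewrite ?nnegrE ?normr_ge0// ?(le_trans xM) ?ler_norm// ltW.
Qed.

(** [E] decreases and stays nonnegative, so the integral of [g] over the tail is at most [E X]. This
    later yields the integrability of Kummer functions at +oo without asymptotic expansions. *)
Lemma integrable_tail g E (X : R) : 0 < X ->
  cpos g -> (forall x, 0 < x -> is_derive x 1 E (- g x)) ->
  (forall x, X <= x -> 0 <= g x) -> (forall x, X <= x -> 0 <= E x) ->
  lam.-integrable `[X, +oo[ (EFin \o g).
Proof.
move=> X0 cg dE g0 E0.
rewrite itv_bndy_bigcup_BRight.
apply: (@ge0_integrable_exhaust _ (fun x => - E x) (E X)).
- exact: E0.
- by [].
- by move=> m n mn.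
- by move=> m n mn; rewrite lerD2l ler_nat.
- by [].
- by move=> x x0; rewrite -(opprK (g x)); apply: isdN; exact: dE.
- by move=> n x; rewrite /= in_itv/= => /andP[Xx _]; exact: g0.
- move=> n x; rewrite /= in_itv/= => /andP[Xx _].
  rewrite normrN ger0_norm ?E0// -lerN2.
  apply: (isd_mono (f := fun t => - E t) (df := g)) => // t /andP[Xt _].
    by rewrite -(opprK (g t)); apply: isdN; apply: dE; exact: lt_le_trans Xt.
  by apply: g0; exact: ltW.
Qed.

Section primitive.
Variables (g : R -> R) (cg : cpos g).
Hypothesis ig : forall M, lam.-integrable `]0, M] (EFin \o g).

Definition prim (x : R) : R := \int[lam]_(t in `]0, x]) g t.

Lemma prim_isd x : 0 < x -> is_derive x 1 prim (g x).
Proof.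
move=> x0; have [] := @continuous_FTC1 R g (BRight 0) x (x + 1) _ (ig _) _ (cg x x0).
- by rewrite ltrDl.
- exact: x0.
by move=> dF Fx; split => //; rewrite -Fx derive1E.
Qed.

Lemma prim_cvg0 : prim x @[x --> 0^'+] --> 0.
Proof.
have i01 : lam.-integrable `[0, 1] (EFin \o g).
  have /integrableP[m1 i1] := ig 1; apply/integrableP; split.
    exact/emeasurable_fun_itv_obnd_cbndP.
  by rewrite -integral_itv_obnd_cbnd//; exact: measurableT_comp.
have := @parameterized_integral_cvg_left R 0 1 g ltr01 i01.
move=> /cvg_at_right_filter; apply: cvg_trans; apply: near_eq_cvg; near=> x.
rewrite /prim /parameterized_integral Rintegral_itv_obnd_cbnd//.
Unshelve. all: by end_near. Qed.

End primitive.

(** [B] and the primitive of [g] from 0 have the same derivative and the same limit at 0, so they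
    agree. At a point past [M] the first is 0 and the second is the whole integral. *)
Lemma FTC_half_line B g (M : R) :
  cpos g -> lam.-integrable half_line (EFin \o g) ->
  (forall x, 0 < x -> is_derive x 1 B (g x)) ->
  B x @[x --> 0^'+] --> 0 ->
  (forall x, M < x -> B x = 0) -> (forall x, M < x -> g x = 0) ->
  \int[lam]_(x in half_line) g x = 0.
Proof.
move=> cg ig dB B0 BM gM.
have ig' N : lam.-integrable `]0, N] (EFin \o g).
  by apply: integrableS ig => //; [exact: measurable_half_line|apply: subset_itvl].
have h x : 0 < x -> prim g x - B x = 0.
  move=> x0; apply: (@isd0_cst _ (fun x => prim g x - B x) (x + 1)) => //; last by rewrite ltrDl.
    move=> y y0 _; rewrite -(subrr (g y)).
    by apply: isdD (prim_isd cg ig' y0) (isdN (dB _ y0)).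
  by have := cvgB (prim_cvg0 ig') B0; rewrite subr0; apply.
pose N := `|M| + 1.
have N0 : 0 < N by rewrite ltr_wpDl.
have MN : M < N by rewrite (le_lt_trans (ler_norm _))// ltrDl.
have := h N N0; rewrite (BM _ MN) subr0 /prim => <-.
rewrite /Rintegral; congr fine.
rewrite [RHS]integral_mkcond [LHS]integral_mkcond; apply: eq_integral => x _.
rewrite !patchE; case: (boolP (x \in half_line)) => [/set_mem/half_lineP x0|].
  case: ifPn => // /negP xN; rewrite gM// (lt_trans MN)// ltNge; apply/negP => Nx.
  by apply: xN; rewrite inE/= in_itv/= x0.
move=> /negP x0; case: ifPn => // /set_mem/=; rewrite in_itv/= => /andP[xp _].
by case: x0; apply/mem_set/half_lineP.
Qed.

End halfline_integrals.

(** * The inner product of L^2(dmu) and convergence in norm *)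

Section weighted_L2.
Context {R : realType}.
Variable mu : R.
Local Notation lam := (@lebesgue_measure R).
Implicit Types (u v w : R -> R) (x c : R).

Definition L2 u := measurable_fun half_line u /\
  lam.-integrable half_line (EFin \o (fun x => u x ^+ 2 * x `^ (mu - 1))).

Definition ip u v := int_dmu mu (fun x => u x * v x).

Lemma measurable_weight (p : R) : measurable_fun half_line (fun x => x `^ p).
Proof. exact: measurable_funTS (measurable_powR _). Qed.

Lemma integrable_le (f g : R -> R) : measurable_fun half_line f ->
  (forall x, 0 < x -> `|f x| <= g x) ->
  lam.-integrable half_line (EFin \o g) -> lam.-integrable half_line (EFin \o f).
Proof.
move=> mf fg; apply: le_integrable; [exact: measurable_itv|exact/measurable_EFinP|].
by move=> x /half_lineP x0 /=; rewrite lee_fin (le_trans (fg _ x0))// ler_norm.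
Qed.

Lemma integrable_ext (f g : R -> R) : (forall x, 0 < x -> f x = g x) ->
  lam.-integrable half_line (EFin \o f) -> lam.-integrable half_line (EFin \o g).
Proof.
move=> fg; apply: eq_integrable; first exact: measurable_itv.
by move=> x; rewrite inE => /half_lineP x0 /=; rewrite fg.
Qed.

Lemma integrable_add (f g : R -> R) :
  lam.-integrable half_line (EFin \o f) -> lam.-integrable half_line (EFin \o g) ->
  lam.-integrable half_line (EFin \o (fun x => f x + g x)).
Proof. by move=> i j; apply: integrableD i j; exact: measurable_itv. Qed.

Lemma integrable_scale c (f : R -> R) :
  lam.-integrable half_line (EFin \o f) ->
  lam.-integrable half_line (EFin \o (fun x => c * f x)).
Proof. by move=> i; apply: (integrableZl _ c i); exact: measurable_itv. Qed.

Lemma L2M u v : L2 u -> L2 v ->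
  lam.-integrable half_line (EFin \o (fun x => u x * v x * x `^ (mu - 1))).
Proof.
move=> [mu_ iu] [mv iv].
apply: (@integrable_le _ (fun x => u x ^+ 2 * x `^ (mu - 1) + v x ^+ 2 * x `^ (mu - 1))).
- apply: measurable_funM; last exact: measurable_weight.
  exact: measurable_funM.
- move=> x x0; rewrite normrM (ger0_norm (powR_ge0 _ _)) -mulrDl ler_wpM2r ?powR_ge0//.
  have := sqr_ge0 (u x - v x); have := sqr_ge0 (u x + v x).
  rewrite !expr2 ler_norml => ? ?; apply/andP; split; nra.
- exact: integrable_add iu iv.
Qed.

Lemma L2D u v : L2 u -> L2 v -> L2 (fun x => u x + v x).
Proof.
move=> hu hv; split; first exact: measurable_funD hu.1 hv.1.
apply: integrable_ext (integrable_add (integrable_add hu.2 hv.2)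
  (integrable_scale 2 (L2M hu hv))) => x _ /=; ring.
Qed.

Lemma L2Z c u : L2 u -> L2 (fun x => c * u x).
Proof.
move=> hu; split; first by apply: measurable_funM => //; exact: hu.1.
apply: integrable_ext (integrable_scale (c ^+ 2) hu.2) => x _ /=; ring.
Qed.

Lemma L2N u : L2 u -> L2 (fun x => - u x).
Proof.
by move=> /(L2Z (-1)); under eq_fun do rewrite mulN1r.
Qed.

Lemma L2B u v : L2 u -> L2 v -> L2 (fun x => u x - v x).
Proof. by move=> hu /L2N; exact: L2D. Qed.

Lemma ipC u v : ip u v = ip v u.
Proof. by rewrite /ip; under [in RHS]eq_fun do rewrite mulrC. Qed.

Lemma ip_ext u v u' v' : (forall x, 0 < x -> u x = u' x) ->
  (forall x, 0 < x -> v x = v' x) -> ip u v = ip u' v'.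
Proof.
move=> uu vv; apply: eq_Rintegral => x; rewrite inE => /half_lineP x0.
by rewrite uu// vv.
Qed.

Lemma ipDl u v w : L2 u -> L2 v -> L2 w -> ip (fun x => u x + v x) w = ip u w + ip v w.
Proof.
move=> hu hv hw; rewrite /ip /int_dmu /int_half -RintegralD; [|exact: measurable_itv|exact: L2M|exact: L2M].
by apply: eq_Rintegral => x _; ring.
Qed.

Lemma ipZl c u v : L2 u -> L2 v -> ip (fun x => c * u x) v = c * ip u v.
Proof.
move=> hu hv; rewrite /ip /int_dmu /int_half -RintegralZl; [|exact: measurable_itv|exact: L2M].
by apply: eq_Rintegral => x _; ring.
Qed.

Lemma ipNl u v : L2 u -> L2 v -> ip (fun x => - u x) v = - ip u v.
Proof. by move=> hu hv; under eq_fun do rewrite -mulN1r; rewrite ipZl// mulN1r. Qed.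

Lemma ipBl u v w : L2 u -> L2 v -> L2 w -> ip (fun x => u x - v x) w = ip u w - ip v w.
Proof. by move=> hu hv hw; rewrite ipDl ?ipNl//; exact: L2N. Qed.

Lemma ipDr u v w : L2 u -> L2 v -> L2 w -> ip w (fun x => u x + v x) = ip w u + ip w v.
Proof. by move=> *; rewrite ipC ipDl// ![ip w _]ipC. Qed.

Lemma ipZr c u v : L2 u -> L2 v -> ip v (fun x => c * u x) = c * ip v u.
Proof. by move=> *; rewrite ipC ipZl// ipC. Qed.

Lemma ipNr u v : L2 u -> L2 v -> ip v (fun x => - u x) = - ip v u.
Proof. by move=> *; rewrite ipC ipNl// ipC. Qed.

Lemma ipBr u v w : L2 u -> L2 v -> L2 w -> ip w (fun x => u x - v x) = ip w u - ip w v.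
Proof. by move=> *; rewrite ipC ipBl// ![ip w _]ipC. Qed.

Lemma ip_ge0 u : 0 <= ip u u.
Proof.
by apply: Rintegral_ge0 => x _; rewrite mulr_ge0 ?powR_ge0// -expr2 sqr_ge0.
Qed.

Lemma ip_CS u v : L2 u -> L2 v -> ip u v ^+ 2 <= ip u u * ip v v.
Proof.
move=> hu hv.
have h s t : 0 <= s ^+ 2 * ip u u - 2 * (s * t) * ip u v + t ^+ 2 * ip v v.
  have hsu := L2Z s hu; have htv := L2Z t hv.
  have := ip_ge0 (fun x => s * u x - t * v x).
  rewrite ipBl ?ipBr ?ipZl ?ipZr//; last exact: L2B.
  by rewrite (ipC v u); congr (_ <= _); ring.
have a0 := ip_ge0 u; have b0 := ip_ge0 v.
move: (ip u u) (ip v v) (ip u v) h a0 b0 => A B C h a0 b0.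
have [A0|A0] := eqVneq A 0.
  have [C0|C0] := eqVneq C 0; first by rewrite C0 A0; nra.
  (* With [A] = 0 the form is affine in [s] when [t] = 1, and this [s] would give it the value
     -1. *)
  have := h ((B + 1) / (2 * C)) 1; rewrite A0.
  have -> : ((B + 1) / (2 * C)) ^+ 2 * 0 - 2 * ((B + 1) / (2 * C) * 1) * C + 1 ^+ 2 * B = - 1 by field.
  by rewrite ler0N1.
(* At (s, t) = (C, A) the form is A (A B - C^2), that is, A times the discriminant. *)
have := h C A.
have -> : C ^+ 2 * A - 2 * (C * A) * C + A ^+ 2 * B = A * (A * B - C ^+ 2) by ring.
by rewrite pmulr_rge0 ?subr_ge0// lt_neqAle eq_sym A0.
Qed.

Lemma ip_le u v : L2 u -> L2 v -> `|ip u v| <= Num.sqrt (ip u u) * Num.sqrt (ip v v).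
Proof.
move=> hu hv; rewrite -sqrtrM ?ip_ge0// -sqrtr_sqr ler_sqrt ?ip_CS//.
by rewrite mulr_ge0 ?ip_ge0.
Qed.

Lemma ip_eq0 u v : L2 u -> L2 v -> ip u u = 0 -> ip u v = 0.
Proof.
move=> hu hv u0; apply/eqP; rewrite -sqrf_eq0 eq_le sqr_ge0 andbT.
by rewrite (le_trans (ip_CS hu hv))// u0 mul0r.
Qed.

Definition cvgL2 (u_ : nat -> R -> R) u :=
  ip (fun x => u_ n x - u x) (fun x => u_ n x - u x) @[n --> \oo] --> 0.

Lemma squeeze_seq0 (a b : nat -> R) : (forall n, `|a n| <= b n) ->
  b n @[n --> \oo] --> 0 -> a n @[n --> \oo] --> 0.
Proof.
move=> ab b0; apply/norm_cvg0P; apply: (squeeze_cvgr _ (cvg_cst 0) b0).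
by apply: nearW => n; rewrite normr_ge0 ab.
Qed.

Lemma cvg_scale0 c (a : nat -> R) : a n @[n --> \oo] --> 0 ->
  c * a n @[n --> \oo] --> 0.
Proof. by move=> a0; have := cvgM (cvg_cst c) a0; rewrite mulr0; apply. Qed.

Lemma cvgL2_ipl (u_ : nat -> R -> R) u v : (forall n, L2 (u_ n)) -> L2 u -> L2 v -> cvgL2 u_ u ->
  ip (u_ n) v @[n --> \oo] --> ip u v.
Proof.
move=> hu_ hu hv h; apply/subr_cvg0.
pose d n := ip (fun x => u_ n x - u x) (fun x => u_ n x - u x).
apply: (@squeeze_seq0 _ (fun n => Num.sqrt (ip v v) * Num.sqrt (d n))).
  move=> n; rewrite mulrC -ipBl//; apply: ip_le => //; exact: L2B.
apply: cvg_scale0; rewrite -sqrtr0; apply: continuous_cvg h.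
exact: sqrt_continuous.
Qed.

Lemma cvgL2_ip (u_ v_ : nat -> R -> R) u v : (forall n, L2 (u_ n)) -> L2 u ->
  (forall n, L2 (v_ n)) -> L2 v -> cvgL2 u_ u -> cvgL2 v_ v ->
  ip (u_ n) (v_ n) @[n --> \oo] --> ip u v.
Proof.
move=> hu_ hu hv_ hv cu cv.
have hB n : L2 (fun x => v_ n x - v x) by exact: L2B.
have h1 := cvgL2_ipl hu_ hu hv cu.
have h2 := cvgL2_ipl hv_ hv hu cv.
have h3 : ip (fun x => u_ n x - u x) (fun x => v_ n x - v x) @[n --> \oo] --> 0.
  apply: (@squeeze_seq0 _ (fun n =>
     ip (fun x => u_ n x - u x) (fun x => u_ n x - u x) +
     ip (fun x => v_ n x - v x) (fun x => v_ n x - v x))); last first.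
    by have := cvgD cu cv; rewrite addr0; apply.
  move=> n.
  have hA : L2 (fun x => u_ n x - u x) by exact: L2B.
  have := ip_CS hA (hB n).
  move: (ip_ge0 (fun x => u_ n x - u x)) (ip_ge0 (fun x => v_ n x - v x)).
  move: (ip _ _) (ip _ _) (ip _ _) => a b c a0 b0 abc.
  by rewrite ler_norml; apply/andP; split; nra.
(* Only the product of the two differences needs an estimate of its own; the other terms converge by
   continuity in one argument. *)
suff -> : (fun n => ip (u_ n) (v_ n)) = fun n =>
    ip (fun x => u_ n x - u x) (fun x => v_ n x - v x) + (ip (u_ n) v + ip (v_ n) u - ip u v).
  have := cvgD h3 (cvgB (cvgD h1 h2) (cvg_cst (ip u v))).
  by rewrite add0r (ipC v u) addrK; apply.
apply/funext => n.
have hA : L2 (fun x => u_ n x - u x) by exact: L2B.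
by rewrite ipBl// !ipBr// (ipC (v_ n) u) /=; ring.
Qed.

Lemma sqrnD_le u v : L2 u -> L2 v ->
  ip (fun x => u x + v x) (fun x => u x + v x) <= 2 * ip u u + 2 * ip v v.
Proof.
move=> hu hv; have := ip_ge0 (fun x => u x - v x).
have hB := L2B hu hv; have hD := L2D hu hv.
rewrite ipBl// !ipBr// ipDl// !ipDr//; rewrite (ipC v u); lra.
Qed.

Lemma cvgL2D (u_ v_ : nat -> R -> R) u v : (forall n, L2 (u_ n)) -> L2 u ->
  (forall n, L2 (v_ n)) -> L2 v -> cvgL2 u_ u -> cvgL2 v_ v ->
  cvgL2 (fun n x => u_ n x + v_ n x) (fun x => u x + v x).
Proof.
move=> hu_ hu hv_ hv cu cv.
apply: (@squeeze_seq0 _ (fun n =>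
   2 * ip (fun x => u_ n x - u x) (fun x => u_ n x - u x) +
   2 * ip (fun x => v_ n x - v x) (fun x => v_ n x - v x))); last first.
  by have := cvgD (cvg_scale0 2 cu) (cvg_scale0 2 cv); rewrite addr0; apply.
move=> n; rewrite ger0_norm ?ip_ge0//.
apply: le_trans (sqrnD_le _ _); try exact: L2B.
by rewrite le_eqVlt; apply/orP; left; apply/eqP; apply: ip_ext => x _; rewrite opprD addrACA.
Qed.

Lemma cvgL2Z c (u_ : nat -> R -> R) u : (forall n, L2 (u_ n)) -> L2 u -> cvgL2 u_ u ->
  cvgL2 (fun n x => c * u_ n x) (fun x => c * u x).
Proof.
move=> hu_ hu cu; rewrite /cvgL2.
suff -> : (fun n => ip (fun x => c * u_ n x - c * u x) (fun x => c * u_ n x - c * u x)) =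
    fun n => c ^+ 2 * ip (fun x => u_ n x - u x) (fun x => u_ n x - u x).
  exact: cvg_scale0.
apply/funext => n.
have hB : L2 (fun x => u_ n x - u x) by exact: L2B.
rewrite expr2 -mulrA -ipZr// -ipZl//; last exact: L2Z.
by apply: ip_ext => x _; ring.
Qed.

Lemma ip_eq0_ae u : L2 u -> ip u u = 0 ->
  {ae lam, forall x, half_line x -> u x = 0}.
Proof.
move=> hu h0.
have : (\int[lam]_(x in half_line) `|(u x * u x * x `^ (mu - 1))%:E| = 0)%E.
  transitivity (\int[lam]_(x in half_line) (u x * u x * x `^ (mu - 1))%:E)%E.
    apply: eq_integral => x _; rewrite gee0_abs// lee_fin mulr_ge0 ?powR_ge0//.
    by rewrite -expr2 sqr_ge0.
  have i := L2M hu hu.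
  move: h0; rewrite /ip /int_dmu /int_half /Rintegral => h0.
  by rewrite -[LHS]fineK ?h0//; apply: integrable_fin_num i; exact: measurable_itv.
have mw := measurable_int lam (L2M hu hu).
move/(ae_eq_integral_abs lam (measurable_itv _) mw).1; apply: filterS => x /= + xh.
move=> /(_ xh) [] /eqP; rewrite -expr2 mulf_eq0 sqrf_eq0 powR_eq0.
by have /half_lineP x0 := xh; rewrite (gt_eqF x0)/= orbF => /eqP.
Qed.

End weighted_L2.

(** * Jets of finite norm and closures in that norm *)

Section jets.
Context {R : realType}.
Local Notation lam := (@lebesgue_measure R).
Implicit Types (F G H : jet R) (mu x c : R).

(* The weights of the norm of [D_space] are absorbed into the components: with
   respect to dmu it is the sum of the squared L^2 norms of jA, jB, j1, j0. *)
Definition jA F x := x * j2 F x.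
Definition jB F x := x * j1 F x.

Record inD mu F : Prop := InD {
  inD_A : L2 mu (jA F) ; inD_B : L2 mu (jB F) ;
  inD_C : L2 mu (j1 F) ; inD_D : L2 mu (j0 F) }.

Record Dcvg mu (Fn : nat -> jet R) F : Prop := DCvg {
  Dcvg_A : cvgL2 mu (fun n => jA (Fn n)) (jA F) ;
  Dcvg_B : cvgL2 mu (fun n => jB (Fn n)) (jB F) ;
  Dcvg_C : cvgL2 mu (fun n => j1 (Fn n)) (j1 F) ;
  Dcvg_D : cvgL2 mu (fun n => j0 (Fn n)) (j0 F) }.

Lemma jA_add F G : jA (jadd F G) = fun x => jA F x + jA G x.
Proof. by apply/funext => x; rewrite /jA /= mulrDr. Qed.

Lemma jB_add F G : jB (jadd F G) = fun x => jB F x + jB G x.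
Proof. by apply/funext => x; rewrite /jB /= mulrDr. Qed.

Lemma jA_scale c F : jA (jscale c F) = fun x => c * jA F x.
Proof. by apply/funext => x; rewrite /jA /= mulrCA. Qed.

Lemma jB_scale c F : jB (jscale c F) = fun x => c * jB F x.
Proof. by apply/funext => x; rewrite /jB /= mulrCA. Qed.

Lemma jsubE F G : jsub F G = jadd F (jscale (-1) G).
Proof.
rewrite /jsub /jadd /jscale /=; congr Jet; apply/funext => x /=;
by rewrite mulN1r.
Qed.

Lemma inD_add mu F G : inD mu F -> inD mu G -> inD mu (jadd F G).
Proof.
by move=> [? ? ? ?] [? ? ? ?]; split; rewrite ?jA_add ?jB_add; exact: L2D.
Qed.

Lemma inD_scale mu c F : inD mu F -> inD mu (jscale c F).
Proof.
by move=> [? ? ? ?]; split; rewrite ?jA_scale ?jB_scale; exact: L2Z.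
Qed.

Lemma inD_sub mu F G : inD mu F -> inD mu G -> inD mu (jsub F G).
Proof. by move=> hF hG; rewrite jsubE; apply: inD_add hF (inD_scale _ hG). Qed.

Lemma Dcvg_add mu Fn F Gn G : (forall n, inD mu (Fn n)) -> inD mu F ->
  (forall n, inD mu (Gn n)) -> inD mu G -> Dcvg mu Fn F -> Dcvg mu Gn G ->
  Dcvg mu (fun n => jadd (Fn n) (Gn n)) (jadd F G).
Proof.
move=> hFn [fA fB fC fD] hGn [gA gB gC gD] [fa fb fc fd] [ga gb gc gd]; split.
- rewrite (_ : (fun n => _) = fun n x => jA (Fn n) x + jA (Gn n) x) ?jA_add.
    by apply: cvgL2D => // n; [case: (hFn n)|case: (hGn n)].
  by apply/funext => n; rewrite jA_add.
- rewrite (_ : (fun n => _) = fun n x => jB (Fn n) x + jB (Gn n) x) ?jB_add.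
    by apply: cvgL2D => // n; [case: (hFn n)|case: (hGn n)].
  by apply/funext => n; rewrite jB_add.
- by apply: cvgL2D => // n; [case: (hFn n)|case: (hGn n)].
- by apply: cvgL2D => // n; [case: (hFn n)|case: (hGn n)].
Qed.

Lemma Dcvg_scale mu c Fn F : (forall n, inD mu (Fn n)) -> inD mu F ->
  Dcvg mu Fn F -> Dcvg mu (fun n => jscale c (Fn n)) (jscale c F).
Proof.
move=> hFn [fA fB fC fD] [fa fb fc fd]; split.
- rewrite (_ : (fun n => _) = fun n x => c * jA (Fn n) x) ?jA_scale.
    by apply: cvgL2Z => // n; case: (hFn n).
  by apply/funext => n; rewrite jA_scale.
- rewrite (_ : (fun n => _) = fun n x => c * jB (Fn n) x) ?jB_scale.
    by apply: cvgL2Z => // n; case: (hFn n).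
  by apply/funext => n; rewrite jB_scale.
- by apply: cvgL2Z => // n; case: (hFn n).
- by apply: cvgL2Z => // n; case: (hFn n).
Qed.

Lemma cvgL2_perturb mu (u_ : nat -> R -> R) (u v : R -> R) (c_ : nat -> R) :
  (forall n, L2 mu (u_ n)) -> L2 mu u -> L2 mu v -> cvgL2 mu u_ u ->
  c_ n @[n --> \oo] --> 0 -> cvgL2 mu (fun n x => u_ n x + c_ n * v x) u.
Proof.
move=> hu_ hu hv cu c0.
apply: (@squeeze_seq0 _ _ (fun n =>
   2 * ip mu (fun x => u_ n x - u x) (fun x => u_ n x - u x) +
   (2 * ip mu v v) * (c_ n * c_ n))); last first.
  have cc : c_ n * c_ n @[n --> \oo] --> 0 by have := cvgM c0 c0; rewrite mulr0; apply.
  by have := cvgD (cvg_scale0 2 cu) (cvg_scale0 (2 * ip mu v v) cc); rewrite addr0; apply.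
move=> n; rewrite ger0_norm ?ip_ge0//.
have h1 : L2 mu (fun x => u_ n x - u x) by exact: L2B.
have h2 := L2Z (c_ n) hv.
have := sqrnD_le h1 h2; rewrite ipZl// ipZr//.
have -> : ip mu (fun x => u_ n x - u x + c_ n * v x) (fun x => u_ n x - u x + c_ n * v x) =
    ip mu (fun x => u_ n x + c_ n * v x - u x) (fun x => u_ n x + c_ n * v x - u x).
  by apply: ip_ext => x _; ring.
by move/le_trans; apply; rewrite le_eqVlt; apply/orP; left; apply/eqP; ring.
Qed.

Lemma Dcvg_perturb mu Fn F G (c_ : nat -> R) : (forall n, inD mu (Fn n)) -> inD mu F ->
  inD mu G -> Dcvg mu Fn F -> c_ n @[n --> \oo] --> 0 ->
  Dcvg mu (fun n => jadd (Fn n) (jscale (c_ n) G)) F.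
Proof.
move=> hFn [fA fB fC fD] [gA gB gC gD] [fa fb fc fd] c0; split.
- rewrite (_ : (fun n => _) = fun n x => jA (Fn n) x + c_ n * jA G x).
    by apply: cvgL2_perturb => // n; case: (hFn n).
  by apply/funext => n; rewrite jA_add jA_scale.
- rewrite (_ : (fun n => _) = fun n x => jB (Fn n) x + c_ n * jB G x).
    by apply: cvgL2_perturb => // n; case: (hFn n).
  by apply/funext => n; rewrite jB_add jB_scale.
- by apply: cvgL2_perturb => // n; case: (hFn n).
- by apply: cvgL2_perturb => // n; case: (hFn n).
Qed.

(** The dense class [S] is a parameter, so that linear constraints can be imposed on the
    approximating sequence itself. *)
Definition Dlim mu (S : jet R -> Prop) F := inD mu F /\
  exists Fn, [/\ forall n, S (Fn n), forall n, inD mu (Fn n) & Dcvg mu Fn F].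

Definition jlinear (S : jet R -> Prop) :=
  forall c F G, S F -> S G -> S (jadd F (jscale c G)).

Lemma Dlim_lin mu S : jlinear S -> jlinear (Dlim mu S).
Proof.
move=> Sl c F G [hF [Fn [SF hFn cF]]] [hG [Gn [SG hGn cG]]].
split; first by apply: inD_add => //; exact: inD_scale.
exists (fun n => jadd (Fn n) (jscale c (Gn n))); split.
- by move=> n; exact: Sl.
- by move=> n; apply: inD_add => //; exact: inD_scale.
- apply: Dcvg_add => //; [|exact: inD_scale|exact: Dcvg_scale].
  by move=> n; exact: inD_scale.
Qed.

(* A dense subspace of a space meets the kernel of a continuous linear
   functional in a dense subspace of that kernel. *)
Lemma Dlim_ker mu (S : jet R -> Prop) (o : jet R -> R) F : jlinear S ->
  (forall c F G, inD mu F -> inD mu G -> o (jadd F (jscale c G)) = o F + c * o G) ->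
  (forall Fn F, (forall n, inD mu (Fn n)) -> inD mu F -> Dcvg mu Fn F ->
     o (Fn n) @[n --> \oo] --> o F) ->
  Dlim mu S F -> o F = 0 -> Dlim mu (fun G => S G /\ o G = 0) F.
Proof.
move=> Sl ol oc [hF [Fn [SF hFn cF]]] oF0; split=> //.
have [[G [SG hG oG]]|oS] := pselect (exists G, [/\ S G, inD mu G & o G != 0]); last first.
  exists Fn; split=> // n; split=> //; apply/eqP/negPn/negP => oFn.
  by apply: oS; exists (Fn n).
exists (fun n => jadd (Fn n) (jscale (- (o (Fn n) / o G)) G)); split.
- by move=> n; split; [exact: Sl|rewrite ol// mulNr divfK// subrr].
- by move=> n; apply: inD_add => //; exact: inD_scale.
- apply: Dcvg_perturb => //.
  have := cvg_scale0 (- (o G)^-1) (_ : o (Fn n) @[n --> \oo] --> 0).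
  rewrite -{1}oF0 => /(_ (oc _ _ hFn hF cF)); apply: cvg_trans; apply: near_eq_cvg.
  by apply: nearW => n; rewrite mulNr mulrC.
Qed.

Lemma jlinear_ker mu (S : jet R -> Prop) (o : jet R -> R) : jlinear S ->
  (forall F, S F -> inD mu F) ->
  (forall c F G, inD mu F -> inD mu G -> o (jadd F (jscale c G)) = o F + c * o G) ->
  jlinear (fun G => S G /\ o G = 0).
Proof.
move=> Sl SD ol c F G [SF oF] [SG oG]; split; first exact: Sl.
by rewrite ol ?oF ?oG ?mulr0 ?addr0//; exact: SD.
Qed.

Lemma sqr_weight mu x : 0 < x -> x `^ (mu + 1) = x ^+ 2 * x `^ (mu - 1).
Proof.
move=> x0; rewrite (_ : mu + 1 = 2 + (mu - 1)); last by ring.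
by rewrite (@powRD _ _ 2) ?(gt_eqF x0) ?implybT// (powR_mulrn 2 (ltW x0)).
Qed.

Lemma mul_weight mu x : 0 < x -> x `^ mu = x * x `^ (mu - 1).
Proof.
move=> x0; rewrite {1}(_ : mu = 1 + (mu - 1)); last by ring.
by rewrite (@powRD _ _ 1) ?(gt_eqF x0) ?implybT// powRr1// ltW.
Qed.

Definition Dsq mu F := ip mu (jA F) (jA F) + ip mu (jB F) (jB F) +
  ip mu (j1 F) (j1 F) + ip mu (j0 F) (j0 F).

Lemma ip_EFin mu (u : R -> R) : L2 mu u ->
  (\int[lam]_(x in half_line) (u x ^+ 2 * x `^ (mu - 1))%:E = (ip mu u u)%:E)%E.
Proof.
move=> hu; rewrite /ip /int_dmu /int_half /Rintegral fineK//.
apply: integrable_fin_num (L2M hu hu); exact: measurable_itv.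
Qed.

Lemma integral_weight mu (f : R -> R) :
  (\int[lam]_(x in half_line) (f x ^+ 2 * x `^ (mu + 1))%:E =
   \int[lam]_(x in half_line) ((x * f x) ^+ 2 * x `^ (mu - 1))%:E)%E.
Proof.
apply: eq_integral => x; rewrite inE => /half_lineP x0; congr EFin.
by rewrite sqr_weight// exprMn mulrA (mulrC (f x ^+ 2)).
Qed.

Lemma D_normsqE mu F : inD mu F -> D_normsq mu F = (Dsq mu F)%:E.
Proof.
move=> [hA hB hC hD]; rewrite /Dsq.
have eA := integral_weight mu (j2 F); have eB := integral_weight mu (j1 F).
rewrite (ip_EFin hA) in eA; rewrite (ip_EFin hB) in eB.
by rewrite /D_normsq [X in (X + _ + _ + _)%E]eA [X in (_ + X + _ + _)%E]eB
  [X in (_ + X + _)%E](ip_EFin hC) [X in (_ + X)%E](ip_EFin hD).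
Qed.

Lemma inD_normsq mu F : measurable_fun half_line (j0 F) ->
  measurable_fun half_line (j1 F) -> measurable_fun half_line (j2 F) ->
  (D_normsq mu F < +oo)%E -> inD mu F.
Proof.
move=> m0 m1 m2; rewrite /D_normsq.
have ge (f : R -> R) p : (0 <= \int[lam]_(x in half_line) (f x ^+ 2 * x `^ p)%:E)%E.
  by apply: integral_ge0 => x _; rewrite lee_fin mulr_ge0 ?powR_ge0 ?sqr_ge0.
move=> h.
have [lA lB lC lD] : [/\
  (\int[lam]_(x in half_line) (j2 F x ^+ 2 * x `^ (mu + 1))%:E < +oo)%E,
  (\int[lam]_(x in half_line) (j1 F x ^+ 2 * x `^ (mu + 1))%:E < +oo)%E,
  (\int[lam]_(x in half_line) (j1 F x ^+ 2 * x `^ (mu - 1))%:E < +oo)%E &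
  (\int[lam]_(x in half_line) (j0 F x ^+ 2 * x `^ (mu - 1))%:E < +oo)%E].
  have := h; have := ge (j2 F) (mu + 1); have := ge (j1 F) (mu + 1).
  have := ge (j1 F) (mu - 1); have := ge (j0 F) (mu - 1); clear.
  move: (integral _ _ _) (integral _ _ _) (integral _ _ _) (integral _ _ _).
  by move=> [a| |] [b| |] [c| |] [d| |] //=; rewrite ?ltry.
have key (f : R -> R) p q : measurable_fun half_line f ->
    (forall x, 0 < x -> f x ^+ 2 * x `^ p = q x ^+ 2 * x `^ (mu - 1)) ->
    measurable_fun half_line q ->
    (\int[lam]_(x in half_line) (f x ^+ 2 * x `^ p)%:E < +oo)%E -> L2 mu q.
  move=> mf fq mq fi; split=> //; apply/integrableP; split.
    apply/measurable_EFinP; apply: measurable_funM; last exact: measurable_weight.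
    exact: measurable_funX.
  apply: le_lt_trans fi; rewrite le_eqVlt; apply/orP; left; apply/eqP.
  apply: eq_integral => x; rewrite inE => /half_lineP x0; rewrite fq//=.
  by rewrite ger0_norm// mulr_ge0 ?powR_ge0 ?sqr_ge0.
have mx (f : R -> R) : measurable_fun half_line f ->
    measurable_fun half_line (fun x => x * f x).
  by move=> mf; apply: measurable_funM => //; exact: measurable_funTS.
split.
- apply: key lA => //; last exact: mx.
  by move=> x x0; rewrite sqr_weight// /jA; ring.
- apply: key lB => //; last exact: mx.
  by move=> x x0; rewrite sqr_weight// /jB; ring.
- exact: key lC.
- exact: key lD.
Qed.

End jets.

(** * Jets of twice differentiable functions, bounded near 0, and vanishing boundary terms *)

Section regular_jets.
Context {R : realType}.
Local Notation lam := (@lebesgue_measure R).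
Implicit Types (f g : R -> R) (F G : jet R) (mu x c : R).

Definition locb f := forall M : R, exists C : R, forall x, 0 < x -> x <= M -> `|f x| <= C.
Definition evanish f := exists M, forall x, M < x -> f x = 0.

Lemma locb_cst c : locb (fun=> c).
Proof. by move=> M; exists `|c|. Qed.

Lemma locb_id : locb (fun x => x).
Proof. by move=> M; exists M => x x0 xM; rewrite ger0_norm// ltW. Qed.

Lemma locbD f g : locb f -> locb g -> locb (fun x => f x + g x).
Proof.
move=> bf bg M; have [C hC] := bf M; have [C' hC'] := bg M; exists (C + C').
by move=> x x0 xM; rewrite (le_trans (ler_normD _ _))// lerD ?hC ?hC'.
Qed.

Lemma locbM f g : locb f -> locb g -> locb (fun x => f x * g x).
Proof.
move=> bf bg M; have [C hC] := bf M; have [C' hC'] := bg M; exists (C * C').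
by move=> x x0 xM; rewrite normrM ler_pM ?hC ?hC'.
Qed.

Lemma locbN f : locb f -> locb (fun x => - f x).
Proof.
by move=> bf M; have [C hC] := bf M; exists C => x x0 xM; rewrite normrN hC.
Qed.

Lemma locb_ext f g : (forall x, 0 < x -> f x = g x) -> locb f -> locb g.
Proof.
by move=> fg bf M; have [C hC] := bf M; exists C => x x0 xM; rewrite -fg ?hC.
Qed.

Lemma cpos_cst c : cpos (fun _ : R => c).
Proof. by split=> x _; exact: cvg_cst. Qed.

Lemma cpos_id : cpos (fun x : R => x).
Proof. by split=> x _; exact: cvg_id. Qed.

Lemma cposD f g : cpos f -> cpos g -> cpos (fun x => f x + g x).
Proof. by move=> cf cg; split=> x x0; apply: cvgD; [exact: cf|exact: cg]. Qed.

Lemma cposM f g : cpos f -> cpos g -> cpos (fun x => f x * g x).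
Proof. by move=> cf cg; split=> x x0; apply: cvgM; [exact: cf|exact: cg]. Qed.

Lemma cposN f : cpos f -> cpos (fun x => - f x).
Proof. by move=> cf; split=> x x0; apply: cvgN; exact: cf. Qed.

Lemma cpos_near f g : (forall x, 0 < x -> f x = g x) -> cpos f -> cpos g.
Proof.
move=> fg cf; split=> x x0; rewrite /prop_for /continuous_at -(fg _ x0).
apply: cvg_trans (cf x x0); apply: near_eq_cvg; near=> y.
by apply: fg; near: y; exact: lt_nbhsr.
Unshelve. all: by end_near. Qed.

Lemma cpos_isd f (df : R -> R) : (forall x, 0 < x -> is_derive x 1 f (df x)) -> cpos f.
Proof. by move=> h; split=> x x0; exact: isd_cont (h x x0). Qed.

Lemma cpos_powR (p : R) : cpos (fun x => x `^ p).
Proof. by split=> x x0; exact: isd_cont (isd_powR p x0). Qed.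

Lemma evanishD f g : evanish f -> evanish g -> evanish (fun x => f x + g x).
Proof.
move=> [M hM] [N hN]; exists (Num.max M N) => x; rewrite gt_max => /andP[Mx Nx].
by rewrite hM// hN// addr0.
Qed.

Lemma evanishMl f g : evanish f -> evanish (fun x => f x * g x).
Proof. by move=> [M hM]; exists M => x Mx; rewrite hM// mul0r. Qed.

Lemma evanishMr f g : evanish g -> evanish (fun x => f x * g x).
Proof. by move=> [M hM]; exists M => x Mx; rewrite hM// mulr0. Qed.

Lemma evanishN f : evanish f -> evanish (fun x => - f x).
Proof. by move=> [M hM]; exists M => x Mx; rewrite hM// oppr0. Qed.

Lemma integrable_compact mu f : 0 < mu -> cpos f -> locb f -> evanish f ->
  lam.-integrable half_line (EFin \o (fun x => f x * x `^ (mu - 1))).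
Proof.
move=> mu0 cf bf [M hM]; have [C hC] := bf M.
have i1 : lam.-integrable `]0, M] (EFin \o (fun x => C * x `^ (mu - 1))).
  have i0 := integrable_powR_at0 M mu0.
  by apply: (integrableZl _ C i0); exact: measurable_itv.
have m1 : measurable_fun half_line (fun x => f x * x `^ (mu - 1)).
  by apply: cpos_measurable; apply: cposM => //; exact: cpos_powR.
have i2 : lam.-integrable `]0, M] (EFin \o (fun x => f x * x `^ (mu - 1))).
  apply: le_integrable i1; first exact: measurable_itv.
    apply/measurable_EFinP; apply: measurable_funS m1.
      exact: measurable_itv.
    by move=> x /=; rewrite in_itv/= => /andP[? _]; apply/half_lineP.
  move=> x /=; rewrite in_itv/= => /andP[x0 xM].
  rewrite lee_fin !normrM (ger0_norm (powR_ge0 _ _)) ler_wpM2r ?powR_ge0//.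
  by rewrite (le_trans (hC _ x0 xM))// ler_norm.
have sub : `]0, M] `<=` half_line.
  by move=> x /=; rewrite in_itv/= => /andP[? _]; apply/half_lineP.
have : lam.-integrable half_line ((EFin \o (fun x => f x * x `^ (mu - 1))) \_ `]0, M]).
  by apply/integrable_restrict; [exact: measurable_itv|exact: measurable_itv|rewrite setIidr].
apply: eq_integrable; first exact: measurable_itv.
move=> x; rewrite inE => /half_lineP x0; rewrite patchE; case: ifPn => // /negP xM.
rewrite /= hM ?mul0r// ltNge; apply/negP => xM'; apply: xM.
by rewrite inE/= in_itv/= x0.
Qed.

(** The integrand is the derivative of B x^mu. This product tends to 0 at 0, because [B] is bounded
    there and mu > 0, and it is 0 near +oo. Each identity of the next section is this lemma with a
    suitable [B]. *)
Lemma boundary_integral mu (B b g : R -> R) : 0 < mu ->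
  (forall x, 0 < x -> is_derive x 1 B (b x)) -> locb B -> evanish B ->
  cpos g -> locb g -> evanish g -> (forall x, 0 < x -> g x = x * b x + mu * B x) ->
  int_dmu mu g = 0.
Proof.
move=> mu0 dB lB [M hM] cg lg [N hN] gB.
apply: (@FTC_half_line _ (fun x => B x * x `^ mu) _ (Num.max M N)).
- by apply: cposM => //; exact: cpos_powR.
- by apply: integrable_compact => //; exists N.
- move=> x x0; apply: isd_eq (isdM (dB x x0) (isd_powR mu x0)) _.
  by rewrite gB// (mul_weight mu x0); ring.
- have [C hC] := lB 1; apply: (@bounded_powR_cvg0 _ mu C) => // x x0 x1.
  by rewrite normrM (ger0_norm (powR_ge0 _ _)) ler_wpM2r ?powR_ge0 ?hC.
- by move=> x; rewrite gt_max => /andP[? _]; rewrite hM ?mul0r.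
- by move=> x; rewrite gt_max => /andP[_ ?]; rewrite hN ?mul0r.
Qed.

(** Near 0 only x f'' has to be bounded, not f''. This is all that is established for the auxiliary
    solution q, which has to stay in the class because the first inequality is applied to it in
    turn. *)
Record reg F : Prop := Reg {
  reg_d0 : forall x, 0 < x -> is_derive x 1 (j0 F) (j1 F x) ;
  reg_d1 : forall x, 0 < x -> is_derive x 1 (j1 F) (j2 F x) ;
  reg_c2 : cpos (j2 F) ;
  reg_b0 : locb (j0 F) ; reg_b1 : locb (j1 F) ; reg_b2 : locb (jA F) }.

Record nice F : Prop := Nice {
  nice_reg :> reg F ;
  nice_v0 : evanish (j0 F) ; nice_v1 : evanish (j1 F) ; nice_v2 : evanish (j2 F) }.

Lemma reg_c1 F : reg F -> cpos (j1 F).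
Proof. by move=> h; apply: cpos_isd (reg_d1 h). Qed.

Lemma reg_c0 F : reg F -> cpos (j0 F).
Proof. by move=> h; apply: cpos_isd (reg_d0 h). Qed.

Lemma reg_cA F : reg F -> cpos (jA F).
Proof. by move=> h; apply: cposM (@cpos_id) (reg_c2 h). Qed.

Lemma nice_vA F : nice F -> evanish (jA F).
Proof. by move=> h; apply: evanishMr; exact: nice_v2. Qed.

Lemma reg_lin : jlinear reg.
Proof.
move=> c F G [f0 f1 f2 fb0 fb1 fb2] [g0 g1 g2 gb0 gb1 gb2]; split => /=.
- move=> x x0; apply: isdD; first exact: f0.
  by apply: isd_eq (isdM (isd_cst c x) (g0 x x0)) _; rewrite mulr0 addr0.
- move=> x x0; apply: isdD; first exact: f1.
  by apply: isd_eq (isdM (isd_cst c x) (g1 x x0)) _; rewrite mulr0 addr0.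
- by apply: cposD => //; apply: cposM => //; exact: cpos_cst.
- by apply: locbD => //; apply: locbM => //; exact: locb_cst.
- by apply: locbD => //; apply: locbM => //; exact: locb_cst.
- rewrite jA_add jA_scale.
  by apply: locbD => //; apply: locbM => //; exact: locb_cst.
Qed.

Lemma nice_lin : jlinear nice.
Proof.
move=> c F G [fr f0 f1 f2] [gr g0 g1 g2]; split; first exact: reg_lin.
- by apply: evanishD => //; exact: evanishMr.
- by apply: evanishD => //; exact: evanishMr.
- by apply: evanishD => //; exact: evanishMr.
Qed.

Lemma L2_compact mu f : 0 < mu -> cpos f -> locb f -> evanish f -> L2 mu f.
Proof.
move=> mu0 cf lf ef; split; first exact: cpos_measurable.
have := @integrable_compact mu (fun x => f x * f x) mu0 (cposM cf cf) (locbM lf lf)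
  (evanishMl _ ef).
by apply: integrable_ext => x _; rewrite expr2.
Qed.

Lemma nice_inD mu F : 0 < mu -> nice F -> inD mu F.
Proof.
move=> mu0 h; have r := nice_reg h; split; apply: L2_compact => //.
- exact: reg_cA.
- exact: reg_b2.
- exact: nice_vA.
- by apply: cposM (@cpos_id) _; exact: reg_c1.
- by apply: locbM (@locb_id) _; exact: reg_b1.
- by apply: evanishMr; exact: nice_v1.
- exact: reg_c1.
- exact: reg_b1.
- exact: nice_v1.
- exact: reg_c0.
- exact: reg_b0.
- exact: nice_v0.
Qed.

End regular_jets.

Ltac solve_isd := repeat first
  [ exact: isd_cst | exact: isd_id | apply: isdD | apply: isdM | apply: isdN
  | eassumption | by eauto ].
Ltac solve_cpos := repeat first
  [ exact: cpos_cst | exact: cpos_id | assumption | apply: cposD | apply: cposM | apply: cposN ].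
Ltac solve_locb := repeat first
  [ exact: locb_cst | exact: locb_id | assumption | apply: locbD | apply: locbM | apply: locbN ].
Ltac isd_ring := eapply isd_eq; [solve_isd | rewrite /GRing.scale /=; ring].

(** * Identities obtained by integration by parts *)

Section boundary_identities.
Context {R : realType}.
Variables (mu : R) (mu0 : 0 < mu).
Implicit Types (F G K : jet R) (a x : R).

(* Wop f' = (TopA f)' and Sop (e^x w) = e^x Wop w. *)
Definition Sop a G x := jA G x + (mu + 1 - x) * j1 G x - (mu - a) * j0 G x.
Definition Wop a G x := jA G x + (x + mu + 1) * j1 G x + (a + 1) * j0 G x.
Definition TopA a F x := jA F x + jB F x + mu * j1 F x + a * j0 F x.

Ltac reg_facts h :=
  have := reg_c0 h; have := reg_c1 h; have := reg_cA h;
  have := reg_b0 h; have := reg_b1 h; have := reg_b2 h;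
  have := reg_d0 h; have := reg_d1 h.

Lemma int_D_L F G : nice F -> reg G ->
  int_dmu mu (fun x => j0 F x * (jA G x + mu * j1 G x) + jB F x * j1 G x) = 0.
Proof.
move=> nF rG; have rF := nice_reg nF.
have [v0 v1 vA] := And3 (nice_v0 nF) (nice_v1 nF) (nice_vA nF).
reg_facts rF => dF1 dF0 bFA bF1 bF0 cFA cF1 cF0.
reg_facts rG => dG1 dG0 bGA bG1 bG0 cGA cG1 cG0.
apply: (@boundary_integral _ mu (fun x => j0 F x * j1 G x)
  (fun x => j0 F x * j2 G x + j1 G x * j1 F x)); first exact: mu0.
- move=> x x0; have := dF0 x x0; have := dG1 x x0 => ? ?.
  by apply: isd_eq; first solve_isd.
- by solve_locb.
- exact: evanishMl.
- by rewrite /jB; solve_cpos.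
- by rewrite /jB; solve_locb.
- by apply: evanishD; apply: evanishMl => //; apply: evanishMr.
- by move=> x x0; rewrite /jA /jB; ring.
Qed.

Lemma int_D_B F : nice F -> int_dmu mu (fun x => 2 * (jB F x * j0 F x) + mu * (j0 F x * j0 F x)) = 0.
Proof.
move=> nF; have rF := nice_reg nF.
have [v0 v1 vA] := And3 (nice_v0 nF) (nice_v1 nF) (nice_vA nF).
reg_facts rF => dF1 dF0 bFA bF1 bF0 cFA cF1 cF0.
apply: (@boundary_integral _ mu (fun x => j0 F x * j0 F x)
  (fun x => 2 * (j0 F x * j1 F x))); first exact: mu0.
- move=> x x0; have := dF0 x x0 => ?.
  by isd_ring.
- by solve_locb.
- exact: evanishMl.
- by rewrite /jB; solve_cpos.
- by rewrite /jB; solve_locb.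
- by apply: evanishD; apply: evanishMr => //; apply: evanishMl => //; apply: evanishMr.
- by move=> x x0; rewrite /jA /jB; ring.
Qed.

Lemma int_A_C F : nice F -> int_dmu mu (fun x => 2 * (jA F x * j1 F x) + mu * (j1 F x * j1 F x)) = 0.
Proof.
move=> nF; have rF := nice_reg nF.
have [v0 v1 vA] := And3 (nice_v0 nF) (nice_v1 nF) (nice_vA nF).
reg_facts rF => dF1 dF0 bFA bF1 bF0 cFA cF1 cF0.
apply: (@boundary_integral _ mu (fun x => j1 F x * j1 F x)
  (fun x => 2 * (j1 F x * j2 F x))); first exact: mu0.
- move=> x x0; have := dF1 x x0 => ?.
  by isd_ring.
- by solve_locb.
- exact: evanishMl.
- by solve_cpos.
- by solve_locb.
- by apply: evanishD; apply: evanishMr => //; apply: evanishMl => //; apply: evanishMr.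
- by move=> x x0; rewrite /jA /jB; ring.
Qed.

Lemma int_A_B F : nice F ->
  int_dmu mu (fun x => 2 * (jA F x * jB F x) + (mu + 1) * (jB F x * j1 F x)) = 0.
Proof.
move=> nF; have rF := nice_reg nF.
have [v0 v1 vA] := And3 (nice_v0 nF) (nice_v1 nF) (nice_vA nF).
reg_facts rF => dF1 dF0 bFA bF1 bF0 cFA cF1 cF0.
apply: (@boundary_integral _ mu (fun x => x * (j1 F x * j1 F x))
  (fun x => 2 * x * (j1 F x * j2 F x) + j1 F x * j1 F x)); first exact: mu0.
- move=> x x0; have := dF1 x x0 => ?.
  by isd_ring.
- by solve_locb.
- by apply: evanishMr; exact: evanishMl.
- by rewrite /jB; solve_cpos.
- by rewrite /jB; solve_locb.
- by apply: evanishD; apply: evanishMr => //; apply: evanishMl => //; apply: evanishMr.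
- by move=> x x0; rewrite /jA /jB; ring.
Qed.

(** As (x G' + mu G) dmu = d(x^mu G), the derivative can be moved onto [TopA F], where it gives
    [Wop F']; then [Sop] is the adjoint of [Wop] in L^2(x^mu dx). [G] need not vanish near +oo: it
    is q in the decomposition, but f0' when the extremal is tested. *)
Lemma int_T_S a F G : nice F -> reg G ->
  int_dmu mu (fun x => jB F x * Sop a G x + TopA a F x * (jB G x + mu * j0 G x)) = 0.
Proof.
move=> nF rG; have rF := nice_reg nF.
have [v0 v1 vA] := And3 (nice_v0 nF) (nice_v1 nF) (nice_vA nF).
reg_facts rF => dF1 dF0 bFA bF1 bF0 cFA cF1 cF0.
reg_facts rG => dG1 dG0 bGA bG1 bG0 cGA cG1 cG0.
apply: (@boundary_integral _ mu
  (fun x => j1 F x * (x * j1 G x + mu * j0 G x) + a * (j0 F x * j0 G x))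
  (fun x => j2 F x * (x * j1 G x + mu * j0 G x)
      + j1 F x * (j1 G x + x * j2 G x + mu * j1 G x)
      + a * (j1 F x * j0 G x + j0 F x * j1 G x))); first exact: mu0.
- move=> x x0; have := dF0 x x0; have := dF1 x x0; have := dG0 x x0; have := dG1 x x0 => ? ? ? ?.
  by isd_ring.
- by solve_locb.
- by apply: evanishD; [exact: evanishMl|apply: evanishMr; exact: evanishMl].
- by rewrite /Sop /TopA /jB; solve_cpos.
- by rewrite /Sop /TopA /jB; solve_locb.
- apply: evanishD; apply: evanishMl; first exact: evanishMr.
  apply: evanishD; last exact: evanishMr.
  by apply: evanishD; [apply: evanishD => //; exact: evanishMr|exact: evanishMr].
- by move=> x x0; rewrite /Sop /TopA /jA /jB; ring.
Qed.

(** This is the commutator of [Wop] with its adjoint. [Sop G - Wop G] is - (2 x G' + (mu + 1) G),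
    the generator of dilations up to a factor, and [Sop G + Wop G] is 2 (x G'' + (mu + 1) G') plus a
    multiple of G; the multiple of the identity contributes nothing. *)
Lemma int_S_W a G : nice G ->
  int_dmu mu (fun x => x * (Sop a G x * Sop a G x) - x * (Wop a G x * Wop a G x)
     - 2 * (jB G x * jB G x)) = 0.
Proof.
move=> nF; have rF := nice_reg nF.
have [v0 v1 vA] := And3 (nice_v0 nF) (nice_v1 nF) (nice_vA nF).
reg_facts rF => dF1 dF0 bFA bF1 bF0 cFA cF1 cF0.
apply: (@boundary_integral _ mu
  (fun x => - (2 * (x * x * (j1 G x * j1 G x)))
   - (2 * a - mu + 1) * (x * (j0 G x * j0 G x)) - 2 * (mu + 1) * (x * (j0 G x * j1 G x)))
  (fun x => - (2 * (2 * x * (j1 G x * j1 G x) + x * x * (2 * j1 G x * j2 G x)))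
   - (2 * a - mu + 1) * (j0 G x * j0 G x + 2 * x * (j0 G x * j1 G x))
   - 2 * (mu + 1) * (j0 G x * j1 G x + x * (j1 G x * j1 G x + j0 G x * j2 G x)))); first exact: mu0.
- move=> x x0; have := dF0 x x0; have := dF1 x x0 => ? ?.
  by isd_ring.
- by solve_locb.
- by apply: evanishD; [apply: evanishD|]; apply: evanishN; apply: evanishMr; apply: evanishMr; apply: evanishMl.
- by rewrite /Sop /Wop /jB; solve_cpos.
- by rewrite /Sop /Wop /jB; solve_locb.
- have vS : evanish (Sop a G).
    apply: evanishD; last by apply: evanishN; exact: evanishMr.
    by apply: evanishD => //; exact: evanishMr.
  have vW : evanish (Wop a G).
    apply: evanishD; last exact: evanishMr.
    by apply: evanishD => //; exact: evanishMr.
  apply: evanishD; first by apply: evanishD; [|apply: evanishN]; apply: evanishMr; exact: evanishMl.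
  by apply: evanishN; apply: evanishMr; apply: evanishMl; exact: evanishMr.
- by move=> x x0; rewrite /Sop /Wop /jA /jB; ring.
Qed.

(** By adjointness [Sop G] against x K' is G against [Wop (x K')]. The commutator of [Wop] with x
    d/dx is its part of degree -1, so [Wop K = 0] gives [Wop (x K') = x K'' + (mu + 1) K'], whose
    product with G integrates to - int G' K' x^(mu+1). *)
Lemma int_S_K a G K : nice G -> reg K -> (forall x, 0 < x -> Wop a K x = 0) ->
  int_dmu mu (fun x => x * (Sop a G x * jB K x) + jB G x * jB K x) = 0.
Proof.
move=> nF rG ode; have rF := nice_reg nF.
have [v0 v1 vA] := And3 (nice_v0 nF) (nice_v1 nF) (nice_vA nF).
reg_facts rF => dF1 dF0 bFA bF1 bF0 cFA cF1 cF0.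
reg_facts rG => dG1 dG0 bGA bG1 bG0 cGA cG1 cG0.
apply: (@boundary_integral _ mu
  (fun x => x * x * (j1 K x * j1 G x) + x * (((mu + 1) * j1 K x + (a + 1) * j0 K x) * j0 G x))
  (fun x => 2 * x * (j1 K x * j1 G x) + x * x * (j2 K x * j1 G x + j1 K x * j2 G x)
    + ((mu + 1) * j1 K x + (a + 1) * j0 K x) * j0 G x
    + x * (((mu + 1) * j2 K x + (a + 1) * j1 K x) * j0 G x
          + ((mu + 1) * j1 K x + (a + 1) * j0 K x) * j1 G x))); first exact: mu0.
- move=> x x0; have := dF0 x x0; have := dF1 x x0; have := dG0 x x0; have := dG1 x x0 => ? ? ? ?.
  by isd_ring.
- by solve_locb.
- by apply: evanishD; [apply: evanishMr|apply: evanishMr]; exact: evanishMr.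
- by rewrite /Sop /jB; solve_cpos.
- by rewrite /Sop /jB; solve_locb.
- have vS : evanish (Sop a G).
    apply: evanishD; last by apply: evanishN; exact: evanishMr.
    by apply: evanishD => //; exact: evanishMr.
  by apply: evanishD; [apply: evanishMr; exact: evanishMl|apply: evanishMl; exact: evanishMr].
- move=> x x0; have := ode x x0; rewrite /Sop /Wop /jA /jB => e.
  apply/eqP; rewrite -subr_eq0; apply/eqP.
  transitivity (- (x * x * j1 G x + (mu + 1) * x * j0 G x) *
    (x * j2 K x + (x + mu + 1) * j1 K x + (a + 1) * j0 K x)); last by rewrite e mulr0.
  by ring.
Qed.

End boundary_identities.

(** * Solving [Sop G = F'] with G vanishing near +oo *)

Section variation_of_parameters.
Context {R : realType}.
Local Notation lam := (@lebesgue_measure R).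
Implicit Types (f g : R -> R) (F G K : jet R) (x : R).

(** Both p^-1 C x^p + prim g and p^-1 C x^p - prim g are nondecreasing and tend to 0 at 0, hence are
    nonnegative. *)
Lemma prim_bound g (p C M : R) : 0 < p -> cpos g ->
  (forall N, lam.-integrable `]0, N] (EFin \o g)) ->
  (forall x, 0 < x -> x <= M -> `|g x| <= C * x `^ (p - 1)) ->
  forall x, 0 < x -> x <= M -> `|prim g x| <= p^-1 * C * x `^ p.
Proof.
move=> p0 cg ig gC x x0 xM.
have dP (y : R) : 0 < y -> is_derive y 1 (fun t => p^-1 * C * t `^ p) (C * y `^ (p - 1)).
  move=> y0; apply: isd_eq (isdM (isd_cst (p^-1 * C) y) (isd_powR p y0)) _.
  by field; rewrite gt_eqF.
have P0 : p^-1 * C * y `^ p @[y --> 0^'+] --> 0.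
  by have := cvgM (cvg_cst (p^-1 * C)) (powR_cvg0 p0); rewrite mulr0; apply.
have J0 := prim_cvg0 ig.
have lo : 0 <= prim g x + p^-1 * C * x `^ p.
  apply: (@nondecreasing_at0_ge0 _ (fun y => prim g y + p^-1 * C * y `^ p) M) => //.
    move=> s t s0 st tM.
    apply: (isd_mono (f := fun y => prim g y + p^-1 * C * y `^ p) (df := fun y => g y + C * y `^ (p - 1))) => // y /andP[sy yt].
      have y0 := lt_le_trans s0 sy.
      exact: isdD (prim_isd cg ig y0) (dP y y0).
    have y0 : 0 < y by exact: lt_trans sy.
    have := gC y y0 (ltW (lt_le_trans yt tM)); rewrite ler_norml => /andP[]; lra.
  by have := cvgD J0 P0; rewrite addr0; apply.
have up : 0 <= p^-1 * C * x `^ p - prim g x.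
  apply: (@nondecreasing_at0_ge0 _ (fun y => p^-1 * C * y `^ p - prim g y) M) => //.
    move=> s t s0 st tM.
    apply: (isd_mono (f := fun y => p^-1 * C * y `^ p - prim g y) (df := fun y => C * y `^ (p - 1) - g y)) => // y /andP[sy yt].
      have y0 := lt_le_trans s0 sy.
      exact: isdD (dP y y0) (isdN (prim_isd cg ig y0)).
    have y0 : 0 < y by exact: lt_trans sy.
    have := gC y y0 (ltW (lt_le_trans yt tM)); rewrite ler_norml => /andP[]; lra.
  by have := cvgB P0 J0; rewrite subr0; apply.
by rewrite ler_norml; apply/andP; split; lra.
Qed.

Lemma prim_total g (M : R) : lam.-integrable half_line (EFin \o g) ->
  (forall x, M < x -> g x = 0) ->
  forall x, M < x -> 0 < x -> prim g x = \int[lam]_(t in half_line) g t.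
Proof.
move=> ig gM x Mx x0; rewrite /prim /Rintegral; congr fine.
rewrite [RHS]integral_mkcond [LHS]integral_mkcond; apply: eq_integral => y _.
rewrite !patchE; case: (boolP (y \in half_line)) => [/set_mem/half_lineP y0|].
  case: ifPn => // /negP xy; rewrite gM// (lt_trans Mx)// ltNge; apply/negP => yx.
  by apply: xy; rewrite inE/= in_itv/= y0.
move=> /negP y0; case: ifPn => // /set_mem/=; rewrite in_itv/= => /andP[yp _].
by case: y0; apply/mem_set/half_lineP.
Qed.

Lemma integrable_locb g : cpos g -> locb g -> forall N, lam.-integrable `]0, N] (EFin \o g).
Proof.
move=> cg lg N; have [C hC] := lg N.
have i0 := integrable_powR_at0 N (@ltr01 R).
have i1 : lam.-integrable `]0, N] (EFin \o (fun x => C * x `^ (1 - 1))).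
  by apply: (integrableZl _ C i0); exact: measurable_itv.
apply: le_integrable i1; first exact: measurable_itv.
  apply/measurable_EFinP; apply: cposS => //.
  by move=> x /=; rewrite in_itv/= => /andP[? _]; apply/half_lineP.
move=> x /=; rewrite in_itv/= => /andP[x0 xN].
by rewrite lee_fin subrr powRr0 mulr1 (le_trans (hC _ x0 xN))// ler_norm.
Qed.

Variables (mu a : R) (mu0 : 0 < mu) (F K : jet R).
Hypothesis nF : nice F.
Hypothesis rK : reg K.
Hypothesis odeK : forall x, 0 < x -> Wop mu a K x = 0.
Hypothesis K_low : forall M : R, exists2 c : R, 0 < c &
  forall x, 0 < x -> x <= M -> c <= `|j0 K x|.
Hypothesis orthK : int_dmu mu (fun x => jB F x * j0 K x) = 0.

(** For G = e^x K z the equation [Sop G = F'], multiplied by K x^mu, reads (x^(mu+1) e^x K^2 z')' =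
    F' K x^mu. So [J] is the bracket on the left and [zeta] below is z'. *)
Let g x := j1 F x * j0 K x * x `^ mu.
Let J := prim g.

Let K_neq0 x : 0 < x -> j0 K x != 0.
Proof.
move=> x0; have [c c0 hc] := K_low x.
by rewrite -normr_gt0 (lt_le_trans c0)// hc.
Qed.

Let cg : cpos g.
Proof.
apply: cposM; last exact: cpos_powR.
exact: cposM (reg_c1 (nice_reg nF)) (reg_c0 rK).
Qed.

Let ig : lam.-integrable half_line (EFin \o g).
Proof.
apply: (@integrable_ext _ (fun x => jB F x * j0 K x * x `^ (mu - 1))).
  by move=> x x0; rewrite /g /jB (mul_weight mu x0); ring.
apply: integrable_compact => //.
- apply: cposM (reg_c0 rK); apply: cposM (@cpos_id _) (reg_c1 (nice_reg nF)).
- apply: locbM (reg_b0 rK); apply: locbM (@locb_id _) (reg_b1 (nice_reg nF)).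
- by apply: evanishMl; apply: evanishMr; exact: nice_v1 nF.
Qed.

Let ig' N : lam.-integrable `]0, N] (EFin \o g).
Proof.
by apply: integrableS ig => //; [exact: measurable_half_line|apply: subset_itvl].
Qed.

(** The orthogonality hypothesis acts here: past the support of F' the primitive equals the total
    integral of [g], which is the pairing in [orthK]. *)
Let J_vanish : evanish J.
Proof.
have [M hM] := nice_v1 nF; exists (Num.max 0 M) => x; rewrite gt_max => /andP[x0 Mx].
rewrite /J (@prim_total g M) => [|//|y My|//|//]; last by rewrite /g hM ?mul0r.
rewrite -[RHS]orthK /int_dmu /int_half; apply: eq_Rintegral => y.
rewrite inE => /half_lineP y0.
by rewrite /g /jB (mul_weight mu y0); ring.
Qed.

Let dJ x : 0 < x -> is_derive x 1 J (g x).
Proof. exact: prim_isd. Qed.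

Let h x := J x * x `^ (- (mu + 1)).

(** [g] is O(x^mu) near 0, so its primitive from 0 is O(x^(mu+1)). Basing [J] at 0 thus selects a
    solution that stays regular there. *)
Let lh : locb h.
Proof.
move=> M; have [C hC] := locbM (reg_b1 (nice_reg nF)) (reg_b0 rK) M.
exists ((mu + 1)^-1 * C) => x x0 xM.
rewrite normrM (ger0_norm (powR_ge0 _ _)) powRN ler_pdivrMr ?powR_gt0//.
apply: (@prim_bound g (mu + 1) C M) => //; first by rewrite addr_gt0.
move=> y y0 yM; rewrite /g normrM (ger0_norm (powR_ge0 _ _)) addrK.
by rewrite ler_wpM2r ?powR_ge0 ?hC.
Qed.

Let zeta x := h x * expR (- x) * (j0 K x)^-1 * (j0 K x)^-1.
Let zeta1 x := j1 F x * expR (- x) * x^-1 * (j0 K x)^-1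
  - zeta x * (1 + (mu + 1) * x^-1 + 2 * (j1 K x * (j0 K x)^-1)).

Let dKinv x : 0 < x -> is_derive x 1 (fun t => (j0 K t)^-1) (- (j0 K x)^-1 ^+ 2 * j1 K x).
Proof.
move=> x0; apply: isd_eq (isdV (K_neq0 x0) (reg_d0 rK x0)) _.
by rewrite exprVn.
Qed.

Let dexpN (x : R) : is_derive x 1 (fun t : R => expR (- t)) (- expR (- x)).
Proof.
by apply: isd_eq (isd_comp (isd_expR _) (isdN (isd_id x))) _; rewrite mulrN1.
Qed.

Let dzeta x : 0 < x -> is_derive x 1 zeta (zeta1 x).
Proof.
move=> x0; have k0 := K_neq0 x0.
have d1 := isdM (dJ x0) (isd_powR (- (mu + 1)) x0).
have d2 := isdM (isdM (isdM d1 (dexpN x)) (dKinv x0)) (dKinv x0).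
apply: isd_eq d2 _.
rewrite /zeta1 /zeta /h /g.
have -> : x `^ (- (mu + 1) - 1) = x `^ (- (mu + 1)) * x^-1.
  by rewrite -(powR_inv1 (ltW x0)) -powRD ?(gt_eqF x0) ?implybT.
have Q0 : x `^ (- (mu + 1)) != 0 by rewrite gt_eqF ?powR_gt0.
have -> : x `^ mu = x^-1 * (x `^ (- (mu + 1)))^-1.
  rewrite -powRN opprK powRD ?(gt_eqF x0) ?implybT// powRr1 ?ltW//.
  by field; rewrite gt_eqF.
by field; rewrite k0 Q0 gt_eqF.
Qed.

Let bound_inv : locb (fun x => (j0 K x)^-1).
Proof.
move=> M; have [c c0 hc] := K_low M; exists c^-1 => x x0 xM.
rewrite normfV lef_pV2 ?posrE ?hc//.
by rewrite normr_gt0 K_neq0.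
Qed.

Let bound_expN : locb (fun x : R => expR (- x)).
Proof.
move=> M; exists 1 => x x0 xM.
by rewrite ger0_norm ?expR_ge0// -[leRHS]expR0 ler_expR oppr_le0 ltW.
Qed.

Let lzeta : locb zeta.
Proof. by apply: locbM bound_inv; apply: locbM bound_inv; exact: locbM. Qed.

Let czeta : cpos zeta.
Proof. exact: cpos_isd dzeta. Qed.

Let izeta := integrable_locb czeta lzeta.

Let Z := prim zeta.

Let zeta_vanish : evanish zeta.
Proof. by have [M hM] := J_vanish; exists M => x Mx; rewrite /zeta /h hM// !mul0r. Qed.

Let lZ : locb Z.
Proof.
move=> M; have [C hC] := lzeta M; exists (C * M) => x x0 xM.
have C0 : 0 <= C by rewrite (le_trans _ (hC x x0 xM)).
have := @prim_bound zeta 1 C M ltr01 czeta izeta _ x x0 xM.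
rewrite invr1 mul1r powRr1 ?(ltW x0)// => /(_ _)/le_trans; apply.
  by move=> y y0 yM; rewrite subrr powRr0 mulr1 hC.
by rewrite ler_wpM2l.
Qed.

Let izeta_half : lam.-integrable half_line (EFin \o zeta).
Proof.
have := @integrable_compact _ 1 zeta ltr01 czeta lzeta zeta_vanish.
by apply: integrable_ext => x x0; rewrite subrr powRr0 mulr1.
Qed.

(** The constant of integration makes [z] vanish near +oo. Regularity at 0 is not affected, since
    [zeta] is bounded near 0 and so any of its primitives is. *)
Let z x := Z x - \int[lam]_(t in half_line) zeta t.

Let dz x : 0 < x -> is_derive x 1 z (zeta x).
Proof.
by move=> x0; rewrite -(addr0 (zeta x)) -oppr0;
  exact: isdD (prim_isd czeta izeta x0) (isdN (isd_cst _ x)).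
Qed.

Let z_vanish : evanish z.
Proof.
have [M hM] := zeta_vanish; exists (Num.max 0 M) => x; rewrite gt_max => /andP[x0 Mx].
by rewrite /z /Z (@prim_total zeta M) ?subrr.
Qed.

Let lz : locb z.
Proof. by apply: locbD lZ _; exact: locb_cst. Qed.

Let cinv : cpos (fun x : R => x^-1).
Proof.
by split=> x x0; apply: isd_cont (isdV _ (isd_id x)); rewrite gt_eqF.
Qed.

Let zeta1_vanish : evanish zeta1.
Proof.
apply: evanishD.
  by do 3 apply: evanishMl; exact: nice_v1 nF.
by apply: evanishN; apply: evanishMl; exact: zeta_vanish.
Qed.

Let czeta1 : cpos zeta1.
Proof.
have c1 := reg_c1 (nice_reg nF); have cK1 := reg_c1 rK.
have cKi : cpos (fun x => (j0 K x)^-1) by exact: cpos_isd dKinv.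
have ce : cpos (fun x : R => expR (- x)) by split=> x _; exact: isd_cont (dexpN x).
apply: cposD; first by do 3 apply: cposM => //.
apply: cposN; apply: cposM => //; apply: cposD.
  by apply: cposD; [exact: cpos_cst|apply: cposM => //; exact: cpos_cst].
by apply: cposM; [exact: cpos_cst|exact: cposM].
Qed.

Let lzeta1 : locb (fun x => x * zeta1 x).
Proof.
apply: (@locb_ext _ (fun x => j1 F x * expR (- x) * (j0 K x)^-1
    - zeta x * (x + (mu + 1) + 2 * (x * (j1 K x * (j0 K x)^-1))))).
  by move=> x x0; rewrite /zeta1; field; rewrite K_neq0// gt_eqF.
apply: locbD.
  apply: locbM bound_inv; apply: locbM bound_expN; exact: reg_b1 (nice_reg nF).
apply: locbN; apply: locbM lzeta _; apply: locbD.
  by apply: locbD; [exact: locb_id|exact: locb_cst].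
apply: locbM; first exact: locb_cst.
by apply: locbM; [exact: locb_id|apply: locbM bound_inv; exact: reg_b1 rK].
Qed.

Let le : locb (fun x : R => expR x).
Proof. by move=> M; exists (expR M) => x x0 xM; rewrite ger0_norm ?expR_ge0// ler_expR. Qed.

Let ce : cpos (fun x : R => expR x).
Proof. by split=> x _; exact: isd_cont (isd_expR x). Qed.

(* Reduction of order: e^x K solves the homogeneous equation Sop = 0. *)
Let G := Jet (fun x => expR x * j0 K x * z x)
  (fun x => expR x * (j0 K x + j1 K x) * z x + expR x * j0 K x * zeta x)
  (fun x => expR x * (j0 K x + 2 * j1 K x + j2 K x) * z x
     + 2 * (expR x * (j0 K x + j1 K x) * zeta x) + expR x * j0 K x * zeta1 x).

Let niceG : nice G.
Proof.
have cz : cpos z by exact: cpos_isd dz.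
have cK0 := reg_c0 rK; have cK1 := reg_c1 rK; have cK2 := reg_c2 rK.
have lK0 := reg_b0 rK; have lK1 := reg_b1 rK; have lK2 := reg_b2 rK.
split; first split.
- move=> x x0; have ? := isd_expR x; have ? := reg_d0 rK x0; have ? := dz x0.
  by isd_ring.
- move=> x x0; have ? := isd_expR x; have ? := reg_d0 rK x0; have ? := dz x0.
  have ? := reg_d1 rK x0; have ? := dzeta x0.
  by isd_ring.
- by rewrite /G /=; solve_cpos.
- by rewrite /G /=; solve_locb.
- by rewrite /G /=; solve_locb.
- apply: (@locb_ext _ (fun x => expR x * (x * j0 K x + 2 * (x * j1 K x) + jA K x) * z x
     + 2 * (expR x * (x * j0 K x + x * j1 K x) * zeta x) + expR x * j0 K x * (x * zeta1 x))).
    by move=> x x0; rewrite /jA /=; ring.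
  by solve_locb.
- exact: evanishMr.
- by apply: evanishD; exact: evanishMr.
- by apply: evanishD; [apply: evanishD; [|apply: evanishMr]|]; exact: evanishMr.
Qed.

Let solG x : 0 < x -> Sop mu a G x = j1 F x.
Proof.
move=> x0; have k0 := K_neq0 x0.
have := odeK x0; rewrite /Sop /Wop /jA /= => ode.
transitivity (j1 F x * (expR x * expR (- x)) + expR x * z x *
    (x * j2 K x + (x + mu + 1) * j1 K x + (a + 1) * j0 K x)).
  by rewrite /zeta1; field; rewrite k0 gt_eqF.
by rewrite ode mulr0 addr0 -expRD subrr expR0 mulr1.
Qed.

Lemma S_solvable : exists2 G, nice G & forall x, 0 < x -> Sop mu a G x = j1 F x.
Proof. by exists G; [exact: niceG|exact: solG]. Qed.

End variation_of_parameters.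

(** * The two inequalities for functions vanishing near +oo *)

Section spectral_gap.
Context {R : realType}.
Local Notation lam := (@lebesgue_measure R).
Implicit Types (F G K : jet R) (u v w t : R -> R) (mu a x c : R).

Lemma ip_sqrD mu c u v : L2 mu u -> L2 mu v ->
  ip mu (fun x => u x + c * v x) (fun x => u x + c * v x) =
  ip mu u u + 2 * c * ip mu u v + c ^+ 2 * ip mu v v.
Proof.
move=> hu hv; have hcv := L2Z c hv; have huv := L2D hu hcv.
rewrite (ipDl hu hcv huv) (ipDr hu hcv hu) (ipDr hu hcv hcv).
by rewrite !(ipZl c hv)// !(ipZr c hv)// (ipC mu v u); ring.
Qed.

Lemma int_add mu u v :
  lam.-integrable half_line (EFin \o (fun x => u x * x `^ (mu - 1))) ->
  lam.-integrable half_line (EFin \o (fun x => v x * x `^ (mu - 1))) ->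
  int_dmu mu (fun x => u x + v x) = int_dmu mu u + int_dmu mu v.
Proof.
move=> iu iv; rewrite /int_dmu /int_half -RintegralD//; last exact: measurable_itv.
by apply: eq_Rintegral => x _; rewrite mulrDl.
Qed.

Lemma int_scale mu c u :
  lam.-integrable half_line (EFin \o (fun x => u x * x `^ (mu - 1))) ->
  int_dmu mu (fun x => c * u x) = c * int_dmu mu u.
Proof.
move=> iu; rewrite /int_dmu /int_half -RintegralZl//; last exact: measurable_itv.
by apply: eq_Rintegral => x _; rewrite mulrA.
Qed.

Lemma int_ip2 mu u v w t : L2 mu u -> L2 mu v -> L2 mu w -> L2 mu t ->
  int_dmu mu (fun x => u x * v x + w x * t x) = ip mu u v + ip mu w t.
Proof.
by move=> hu hv hw ht; rewrite int_add//; exact: L2M.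
Qed.

Lemma int_ext mu u v : (forall x, 0 < x -> u x = v x) -> int_dmu mu u = int_dmu mu v.
Proof.
move=> uv; apply: eq_Rintegral => x; rewrite inE => /half_lineP x0.
by rewrite uv.
Qed.

Lemma int_shift mu u v : (forall x, 0 < x -> x * u x = v x) ->
  int_dmu (mu + 1) u = int_dmu mu v.
Proof.
move=> uv; apply: eq_Rintegral => x; rewrite inE => /half_lineP x0.
by rewrite -uv// addrK (mul_weight mu x0); ring.
Qed.

(** The lower bound is uniform on ]0, M], because 1/K must stay bounded as x tends to 0 in the
    variation of parameters. *)
Record kernel mu a K : Prop := Kernel {
  kernel_reg : reg K ;
  kernel_ode : forall x, 0 < x -> Wop mu a K x = 0 ;
  kernel_low : forall M : R, exists2 c : R, 0 < c &
    forall x, 0 < x -> x <= M -> c <= `|j0 K x| }.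

Definition P0 mu F := ip mu (jB F) (j1 F).
Definition normT mu a F := ip mu (TopA mu a F) (TopA mu a F).

Lemma L2_TopA mu a F : inD mu F -> L2 mu (TopA mu a F).
Proof.
move=> [hA hB hC hD]; apply: L2D (L2Z _ hD); apply: L2D (L2Z _ hC).
exact: L2D.
Qed.

Lemma gap_decomposition mu a F K : 0 < mu -> kernel mu a K -> nice F ->
  int_dmu mu (fun x => jB F x * j0 K x) = 0 ->
  exists G, [/\ nice G,
    forall x, 0 < x -> Sop mu a G x = j1 F x,
    P0 mu F = - ip mu (TopA mu a F) (fun x => jB G x + mu * j0 G x),
    ip mu (fun x => jB G x + mu * j0 G x) (fun x => jB G x + mu * j0 G x) =
      ip mu (jB G) (jB G) &
    P0 mu F = 2 * ip mu (jB G) (jB G) + normT (mu + 1) (a + 1) G].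
Proof.
move=> mu0 [rK odeK lowK] nF orth.
have [G nG solG] := S_solvable mu0 nF rK odeK lowK orth.
have [fA fB fC fD] := nice_inD mu0 nF; have [gA gB gC gD] := nice_inD mu0 nG.
have hT := L2_TopA a (nice_inD mu0 nF).
have hY : L2 mu (fun x => jB G x + mu * j0 G x) by apply: L2D => //; exact: L2Z.
exists G; split=> //.
- have := int_T_S mu0 a nF (nice_reg nG).
  rewrite (@int_ext _ _ (fun x => jB F x * j1 F x + TopA mu a F x * (jB G x + mu * j0 G x))).
    by rewrite int_ip2// => /eqP; rewrite addr_eq0 => /eqP.
  by move=> x x0; rewrite solG.
(* In the norm of x G' + mu G the cross term and the square of mu G cancel, because 2 x G G' + mu
   G^2 integrates to 0. *)
- have := int_D_B mu0 nG.
  rewrite (@int_ext _ _ (fun x => jB G x * (2 * j0 G x) + (mu * j0 G x) * j0 G x)); last first.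
    by move=> x x0; ring.
  rewrite int_ip2 ?ipZr ?ipZl//; try exact: L2Z.
  rewrite (ip_sqrD mu gB gD) => e.
  apply/eqP; rewrite -subr_eq0; apply/eqP.
  transitivity (mu * (2 * ip mu (jB G) (j0 G) + mu * ip mu (j0 G) (j0 G))); first by ring.
  by rewrite e mulr0.
(* With [Sop G = F'] the first term of the commutator identity is P0[F], and the second is the
   integral of [TopA] squared for the parameters shifted by 1. *)
- have := int_S_W mu0 a nG.
  have hW : L2 mu (Wop mu a G).
    have h := L2D (L2D (L2D gA gB) (L2Z (mu + 1) gC)) (L2Z (a + 1) gD).
    by apply: (eq_rect _ (L2 mu) h); apply/funext => x; rewrite /Wop /jB; ring.
  have [eA eB eC eD] := And4 (nice_vA nG) (nice_v1 nG) (nice_v0 nG) I.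
  have hxW : L2 mu (fun x => x * Wop mu a G x).
    have rG := nice_reg nG.
    have cA := reg_cA rG; have c1 := reg_c1 rG; have c0 := reg_c0 rG.
    have lA := reg_b2 rG; have l1 := reg_b1 rG; have l0 := reg_b0 rG.
    apply: L2_compact => //.
    - by rewrite /Wop; solve_cpos.
    - by rewrite /Wop; solve_locb.
    - apply: evanishMr; apply: evanishD; last exact: evanishMr.
      by apply: evanishD => //; exact: evanishMr.
  rewrite (@int_ext _ _ (fun x => jB F x * j1 F x + (-1) *
     ((x * Wop mu a G x) * Wop mu a G x + (2 * jB G x) * jB G x))); last first.
    by move=> x x0; rewrite solG// /jB; ring.
  have -> : int_dmu mu (fun x => jB F x * j1 F x + (-1) *
     ((x * Wop mu a G x) * Wop mu a G x + (2 * jB G x) * jB G x)) =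
     P0 mu F - (ip mu (fun x => x * Wop mu a G x) (Wop mu a G) + 2 * ip mu (jB G) (jB G)).
    have i1 : lam.-integrable half_line (EFin \o (fun x => (x * Wop mu a G x * Wop mu a G x
        + 2 * jB G x * jB G x) * x `^ (mu - 1))).
      apply: integrable_ext (integrable_add (L2M hxW hW) (L2M (L2Z 2 gB) gB)) => x _ /=.
      by ring.
    rewrite int_add.
    - by rewrite int_scale// int_ip2 ?ipZl ?mulN1r//; exact: L2Z.
    - exact: L2M.
    - by apply: integrable_ext (integrable_scale (-1) i1) => x _; rewrite mulrA.
  have -> : normT (mu + 1) (a + 1) G = ip mu (fun x => x * Wop mu a G x) (Wop mu a G).
    by apply: int_shift => x x0; rewrite /TopA /Wop /jB; ring.
  move=> /eqP; rewrite subr_eq0 => /eqP ->; ring.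
Qed.

Lemma normT_ge0 mu a F : 0 <= normT mu a F.
Proof. exact: ip_ge0. Qed.

Lemma first_gap mu a F K : 0 < mu -> kernel mu a K -> nice F ->
  int_dmu mu (fun x => jB F x * j0 K x) = 0 -> 2 * P0 mu F <= normT mu a F.
Proof.
move=> mu0 kK nF orth.
have [G [nG solG e1 e2 e3]] := gap_decomposition mu0 kK nF orth.
have [gA gB gC gD] := nice_inD mu0 nG.
have hT := L2_TopA a (nice_inD mu0 nF).
have hY : L2 mu (fun x => jB G x + mu * j0 G x) by apply: L2D => //; exact: L2Z.
have := ip_ge0 mu (fun x => TopA mu a F x + 2 * (jB G x + mu * j0 G x)).
rewrite (ip_sqrD 2 hT hY) e2 -/(normT mu a F).
have := normT_ge0 (mu + 1) (a + 1) G; move: e1 e3; clear; lra.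
Qed.

(** Here T, X, Y, W, P stand for |T f|^2, <T f, Y>, |Y|^2, int (W q)^2 x^mu and P0[f]. The
    hypotheses give Y <= P / 4, so P^2 <= T Y <= T P / 4, and P can be cancelled unless it is 0. *)
Lemma gap_arith (T X Y W P : R) : 0 <= Y -> 0 <= T -> P = - X ->
  P = 2 * Y + W -> 2 * Y <= W -> X ^+ 2 <= T * Y -> 4 * P <= T.
Proof.
move=> Y0 T0 e1 e3 h1 h2; have hP : 4 * Y <= P by lra.
have [P0|P0] := eqVneq P 0; first by lra.
have {}P0 : 0 < P by rewrite lt_neqAle eq_sym P0; lra.
have : P * (4 * P) <= P * T by nra.
by rewrite ler_pM2l.
Qed.

Lemma second_gap mu a F K K1 : 0 < mu -> kernel mu a K -> kernel (mu + 1) (a + 1) K1 ->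
  (forall x, 0 < x -> j0 K1 x = j1 K x) -> nice F ->
  int_dmu mu (fun x => jB F x * j0 K x) = 0 ->
  int_dmu mu (fun x => x * (j1 F x * jB K x)) = 0 -> 4 * P0 mu F <= normT mu a F.
Proof.
move=> mu0 kK kK1 K1K nF orth orth1.
have [G [nG solG e1 e2 e3]] := gap_decomposition mu0 kK nF orth.
have [gA gB gC gD] := nice_inD mu0 nG.
have hT := L2_TopA a (nice_inD mu0 nF).
have hY : L2 mu (fun x => jB G x + mu * j0 G x) by apply: L2D => //; exact: L2Z.
(* Pairing [Sop G = F'] with x K', the hypothesis [orth1] removes the left side of [int_S_K]; what
   remains is the constraint on G in the problem with weight mu + 1 and kernel K'. *)
have orthG : int_dmu (mu + 1) (fun x => jB G x * j0 K1 x) = 0.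
  have ode := kernel_ode kK; have := int_S_K mu0 nG (kernel_reg kK) ode.
  rewrite (@int_shift mu _ (fun x => jB G x * jB K x)); last first.
    by move=> x x0; rewrite K1K// /jB; ring.
  rewrite (@int_ext _ _ (fun x => x * (j1 F x * jB K x) + jB G x * jB K x)); last first.
    by move=> x x0; rewrite solG.
  have rK := kernel_reg kK; have rF := nice_reg nF; have rG := nice_reg nG.
  have bK := reg_b1 rK; have cK := reg_c1 rK.
  rewrite int_add ?orth1 ?add0r//; apply: integrable_compact => //.
  - apply: cposM (@cpos_id _) _; apply: cposM (reg_c1 rF) _.
    exact: cposM (@cpos_id _) _.
  - apply: locbM (@locb_id _) _; apply: locbM (reg_b1 rF) _.
    exact: locbM (@locb_id _) _.
  - by apply: evanishMr; apply: evanishMl; exact: nice_v1.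
  - apply: cposM; apply: cposM (@cpos_id _) _ => //; exact: reg_c1.
  - apply: locbM; apply: locbM (@locb_id _) _ => //; exact: reg_b1.
  - by apply: evanishMl; apply: evanishMr; exact: nice_v1.
have mu1 : 0 < mu + 1 by rewrite addr_gt0.
have := first_gap mu1 kK1 nG orthG.
have -> : P0 (mu + 1) G = ip mu (jB G) (jB G).
  by apply: int_shift => x x0; rewrite /jB; ring.
have := ip_CS hT hY; rewrite e2 -/(normT mu a F).
move=> h1 h2; exact: (gap_arith (ip_ge0 mu (jB G)) (normT_ge0 mu a F) e1 e3 h2 h1).
Qed.

End spectral_gap.

(** * Quadratic forms on the completion and their continuity *)

Section closed_forms.
Context {R : realType}.
Local Notation lam := (@lebesgue_measure R).
Variable mu : R.
Implicit Types (F G K H : jet R) (u v w t : R -> R) (a x c : R).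

Definition PP F G := ip mu (jB F) (j1 G).
Definition TT a F G := ip mu (TopA mu a F) (TopA mu a G).

Lemma PPC F G : PP F G = PP G F.
Proof. by apply: int_ext => x _; rewrite /jB; ring. Qed.

Lemma jB_lin c F G : jB (jadd F (jscale c G)) = fun x => jB F x + c * jB G x.
Proof. by rewrite jB_add jB_scale. Qed.

Lemma TopA_lin a c F G :
  TopA mu a (jadd F (jscale c G)) = fun x => TopA mu a F x + c * TopA mu a G x.
Proof. by apply/funext => x; rewrite /TopA jB_add jB_scale jA_add jA_scale /=; ring. Qed.

Lemma inD_lin c F G : inD mu F -> inD mu G -> inD mu (jadd F (jscale c G)).
Proof. by move=> hF hG; apply: inD_add => //; exact: inD_scale. Qed.

Lemma PP_linl c F G H : inD mu F -> inD mu G -> inD mu H ->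
  PP (jadd F (jscale c G)) H = PP F H + c * PP G H.
Proof.
move=> [_ hF _ _] [_ hG _ _] [_ _ hH _]; rewrite /PP jB_lin.
by rewrite (ipDl hF (L2Z c hG) hH) (ipZl c hG hH).
Qed.

Lemma TT_linl a c F G H : inD mu F -> inD mu G -> inD mu H ->
  TT a (jadd F (jscale c G)) H = TT a F H + c * TT a G H.
Proof.
move=> /(L2_TopA a) hF /(L2_TopA a) hG /(L2_TopA a) hH; rewrite /TT TopA_lin.
by rewrite (ipDl hF (L2Z c hG) hH) (ipZl c hG hH).
Qed.

Lemma P0_lin c F G : inD mu F -> inD mu G ->
  P0 mu (jadd F (jscale c G)) = P0 mu F + 2 * c * PP F G + c ^+ 2 * P0 mu G.
Proof.
move=> hF hG; have hH := inD_lin c hF hG.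
rewrite /P0 -!/(PP _ _) (PP_linl c hF hG hH) (PPC F) (PPC G).
rewrite (PP_linl c hF hG hF) (PP_linl c hF hG hG) (PPC G F); ring.
Qed.

Lemma normT_lin a c F G : inD mu F -> inD mu G ->
  normT mu a (jadd F (jscale c G)) = normT mu a F + 2 * c * TT a F G + c ^+ 2 * normT mu a G.
Proof.
move=> hF hG; rewrite /normT TopA_lin.
by rewrite (ip_sqrD c (L2_TopA a hF) (L2_TopA a hG)).
Qed.

Lemma P0_shift F : P0 mu F = ip (mu + 1) (j1 F) (j1 F).
Proof. by apply/esym; apply: int_shift => x _; rewrite /jB; ring. Qed.

Lemma P0_ge0 F : 0 <= P0 mu F.
Proof. by rewrite P0_shift ip_ge0. Qed.

Lemma L2_shift F : inD mu F -> L2 (mu + 1) (j1 F).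
Proof.
move=> [hA hB hC hD]; split; first exact: hC.1.
apply: integrable_ext (L2M hB hC) => x x0; rewrite addrK (mul_weight mu x0) /jB; ring.
Qed.

Section limits.
Variables (Fn : nat -> jet R) (F : jet R).
Hypotheses (hFn : forall n, inD mu (Fn n)) (hF : inD mu F) (cF : Dcvg mu Fn F).

Lemma cvgL2_TopA a : cvgL2 mu (fun n => TopA mu a (Fn n)) (TopA mu a F).
Proof.
have [fA fB fC fD] := hF; have [cA cB cC cD] := cF.
have nA n := inD_A (hFn n); have nB n := inD_B (hFn n).
have nC n := inD_C (hFn n); have nD n := inD_D (hFn n).
have nZC n := L2Z mu (nC n); have nZD n := L2Z a (nD n).
have zC := L2Z mu fC; have zD := L2Z a fD.
have nAB n := L2D (nA n) (nB n); have hAB := L2D fA fB.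
have nABC n := L2D (nAB n) (nZC n); have hABC := L2D hAB zC.
have c1 := cvgL2D nA fA nB fB cA cB.
have c2 := cvgL2D nAB hAB nZC zC c1 (cvgL2Z mu nC fC cC).
exact: (cvgL2D nABC hABC nZD zD c2 (cvgL2Z a nD fD cD)).
Qed.

Lemma cvg_normT a : normT mu a (Fn n) @[n --> \oo] --> normT mu a F.
Proof.
have c := cvgL2_TopA a; have h n := L2_TopA a (hFn n); have hT := L2_TopA a hF.
exact: (cvgL2_ip h hT h hT c c).
Qed.

Lemma cvg_TT a G : inD mu G -> TT a (Fn n) G @[n --> \oo] --> TT a F G.
Proof.
move=> hG; have c := cvgL2_TopA a; have h n := L2_TopA a (hFn n).
exact: (cvgL2_ipl h (L2_TopA a hF) (L2_TopA a hG) c).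
Qed.

Lemma cvg_PP G : inD mu G -> PP (Fn n) G @[n --> \oo] --> PP F G.
Proof.
move=> hG; have h n := inD_B (hFn n).
exact: (cvgL2_ipl h (inD_B hF) (inD_C hG) (Dcvg_B cF)).
Qed.

Lemma cvg_P0 : P0 mu (Fn n) @[n --> \oo] --> P0 mu F.
Proof.
have h n := inD_B (hFn n); have k n := inD_C (hFn n).
exact: (cvgL2_ip h (inD_B hF) k (inD_C hF) (Dcvg_B cF) (Dcvg_C cF)).
Qed.

Lemma cvg_ip_comp :
  [/\ ip mu (jA (Fn n)) (jB (Fn n)) @[n --> \oo] --> ip mu (jA F) (jB F),
   ip mu (jA (Fn n)) (j1 (Fn n)) @[n --> \oo] --> ip mu (jA F) (j1 F),
   ip mu (j1 (Fn n)) (j1 (Fn n)) @[n --> \oo] --> ip mu (j1 F) (j1 F),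
   ip mu (j0 (Fn n)) (jA (Fn n)) @[n --> \oo] --> ip mu (j0 F) (jA F) &
   ip mu (j0 (Fn n)) (j1 (Fn n)) @[n --> \oo] --> ip mu (j0 F) (j1 F)].
Proof.
have [fA fB fC fD] := hF; have [cA cB cC cD] := cF.
have nA n := inD_A (hFn n); have nB n := inD_B (hFn n).
have nC n := inD_C (hFn n); have nD n := inD_D (hFn n).
split.
- exact: (cvgL2_ip nA fA nB fB cA cB).
- exact: (cvgL2_ip nA fA nC fC cA cC).
- exact: (cvgL2_ip nC fC nC fC cC cC).
- exact: (cvgL2_ip nD fD nA fA cD cA).
- exact: (cvgL2_ip nD fD nC fC cD cC).
Qed.

Lemma cvg_ip_comp0 :
  ip mu (jB (Fn n)) (j0 (Fn n)) @[n --> \oo] --> ip mu (jB F) (j0 F) /\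
  ip mu (j0 (Fn n)) (j0 (Fn n)) @[n --> \oo] --> ip mu (j0 F) (j0 F).
Proof.
have [fA fB fC fD] := hF; have [cA cB cC cD] := cF.
have nB n := inD_B (hFn n); have nD n := inD_D (hFn n).
split; first exact: (cvgL2_ip nB fB nD fD cB cD).
exact: (cvgL2_ip nD fD nD fD cD cD).
Qed.

Lemma cvg_D_v v : L2 mu v -> ip mu (j0 (Fn n)) v @[n --> \oo] --> ip mu (j0 F) v.
Proof. by move=> hv; have h n := inD_D (hFn n); exact: (cvgL2_ipl h (inD_D hF) hv (Dcvg_D cF)). Qed.

End limits.

Hypothesis mu0 : 0 < mu.

Lemma lim2_eq0 (u v : nat -> R) (a b c d : R) : u n @[n --> \oo] --> a ->
  v n @[n --> \oo] --> b -> (forall n, c * u n + d * v n = 0) -> c * a + d * b = 0.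
Proof.
move=> ua vb uv0; have h : c * u n + d * v n @[n --> \oo] --> c * a + d * b.
  by apply: cvgD; apply: cvgM => //; exact: cvg_cst.
apply: (@cvg_unique _ (@Rhausdorff R) _ _ _ _ h).
by rewrite (_ : (fun n => _) = fun=> 0); [exact: cvg_cst|apply/funext].
Qed.

Lemma D_A_B F : Dlim mu nice F -> 2 * ip mu (jA F) (jB F) + (mu + 1) * P0 mu F = 0.
Proof.
move=> [hF [Fn [nFn hFn cF]]]; have [cAB _ _ _ _] := cvg_ip_comp hFn hF cF.
apply: (lim2_eq0 cAB (cvg_P0 hFn hF cF)) => n.
have := int_A_B mu0 (nFn n).
have [hA hB hC hD] := hFn n.
rewrite (@int_ext _ _ _ (fun x => (2 * jA (Fn n) x) * jB (Fn n) x +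
  ((mu + 1) * jB (Fn n) x) * j1 (Fn n) x)); last by move=> x _; ring.
rewrite (int_ip2 (L2Z 2 hA) hB (L2Z (mu + 1) hB) hC).
by rewrite (ipZl 2 hA hB) (ipZl (mu + 1) hB hC).
Qed.

Lemma D_A_C F : Dlim mu nice F -> 2 * ip mu (jA F) (j1 F) + mu * ip mu (j1 F) (j1 F) = 0.
Proof.
move=> [hF [Fn [nFn hFn cF]]]; have [_ cAC cCC _ _] := cvg_ip_comp hFn hF cF.
apply: (lim2_eq0 cAC cCC) => n.
have := int_A_C mu0 (nFn n).
have [hA hB hC hD] := hFn n.
rewrite (@int_ext _ _ _ (fun x => (2 * jA (Fn n) x) * j1 (Fn n) x +
  (mu * j1 (Fn n) x) * j1 (Fn n) x)); last by move=> x _; ring.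
rewrite (int_ip2 (L2Z 2 hA) hC (L2Z mu hC) hC).
by rewrite (ipZl 2 hA hC) (ipZl mu hC hC).
Qed.

Lemma D_B_D F : Dlim mu nice F -> 2 * ip mu (jB F) (j0 F) + mu * ip mu (j0 F) (j0 F) = 0.
Proof.
move=> [hF [Fn [nFn hFn cF]]]; have [cBD cDD] := cvg_ip_comp0 hFn hF cF.
apply: (lim2_eq0 cBD cDD) => n.
have := int_D_B mu0 (nFn n).
have [hA hB hC hD] := hFn n.
rewrite (@int_ext _ _ _ (fun x => (2 * jB (Fn n) x) * j0 (Fn n) x +
  (mu * j0 (Fn n) x) * j0 (Fn n) x)); last by move=> x _; ring.
rewrite (int_ip2 (L2Z 2 hB) hD (L2Z mu hD) hD).
by rewrite (ipZl 2 hB hD) (ipZl mu hD hD).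
Qed.

Lemma D_L F : Dlim mu nice F ->
  ip mu (j0 F) (jA F) + mu * ip mu (j0 F) (j1 F) + P0 mu F = 0.
Proof.
move=> [hF [Fn [nFn hFn cF]]]; have [_ _ _ cDA cDC] := cvg_ip_comp hFn hF cF.
have cL : ip mu (j0 (Fn n)) (jA (Fn n)) + mu * ip mu (j0 (Fn n)) (j1 (Fn n)) @[n --> \oo] -->
    ip mu (j0 F) (jA F) + mu * ip mu (j0 F) (j1 F).
  by apply: cvgD cDA _; apply: cvgM cDC; exact: cvg_cst.
rewrite -[X in X + _]mul1r -[X in _ + X]mul1r.
apply: (lim2_eq0 cL (cvg_P0 hFn hF cF)) => n; rewrite !mul1r.
have := int_D_L mu0 (nFn n) (nice_reg (nFn n)).
have [hA hB hC hD] := hFn n.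
rewrite (int_ip2 hD (L2D hA (L2Z mu hC)) hB hC).
by rewrite (ipDr hA (L2Z mu hC) hD) (ipZr mu hC hD).
Qed.

(** [G] need not vanish near +oo, which allows [G] to be the jet of f0; only [F] is approximated. *)
Lemma D_L_polar F G : Dlim mu nice F -> reg G -> inD mu G ->
  ip mu (j0 F) (fun x => jA G x + mu * j1 G x) + PP F G = 0.
Proof.
move=> [hF [Fn [nFn hFn cF]]] rG hG.
have hL : L2 mu (fun x => jA G x + mu * j1 G x).
  by apply: L2D (inD_A hG) (L2Z mu (inD_C hG)).
rewrite -[X in X + _]mul1r -[X in _ + X]mul1r.
apply: (lim2_eq0 (cvg_D_v hFn hF cF hL) (cvg_PP hFn hF cF hG)) => n; rewrite !mul1r.
have := int_D_L mu0 (nFn n) rG.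
by rewrite (int_ip2 (inD_D (hFn n)) hL (inD_B (hFn n)) (inD_C hG)).
Qed.

(** Four integrations by parts eliminate the products of [jA] with [jB], [j1], [j0] and of [jB] with
    [j0]. The square of [j1] and its product with [j0] then cancel, and P0, the product of [jB] with
    [j1], is the only cross term left. *)
Lemma normT_expand a F : Dlim mu nice F ->
  normT mu a F = ip mu (jA F) (jA F) + ip mu (jB F) (jB F) - a * (mu - a) * ip mu (j0 F) (j0 F)
    - (1 + (2 * a - mu)) * P0 mu F.
Proof.
move=> hF; have e1 := D_A_B hF; have e2 := D_A_C hF; have e3 := D_B_D hF; have e4 := D_L hF.
have [hA hB hC hD] := hF.1.
have hmC := L2Z mu hC; have haD := L2Z a hD; have hAB := L2D hA hB.
have hABC := L2D hAB hmC; have hT := L2D hABC haD.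
rewrite /normT /TopA (ipDl hABC haD hT) (ipDr hABC haD hABC) (ipDr hABC haD haD).
rewrite (ipDl hAB hmC hABC) (ipDl hAB hmC haD) (ipDr hAB hmC hAB) (ipDr hAB hmC hmC) (ipDr hAB hmC haD).
rewrite (ipDl hA hB hAB) (ipDr hA hB hA) (ipDr hA hB hB) (ipDl hA hB hmC) (ipDl hA hB haD).
rewrite (ipDr hA hB hmC) (ipDr hA hB haD).
rewrite !(ipZl mu hC) // !(ipZl a hD)// !(ipZr mu hC)// !(ipZr a hD)//.
rewrite (ipC mu (jB F) (jA F)) (ipC mu (j1 F) (jA F)) (ipC mu (j1 F) (jB F))
  (ipC mu (jA F) (j0 F)) (ipC mu (j1 F) (j0 F)) -/(P0 mu F).
move: e1 e2 e3 e4; rewrite (ipC mu (jB F) (j0 F)).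
move: (ip mu (jA F) (jA F)) (ip mu (jA F) (jB F)) (ip mu (jA F) (j1 F)) (ip mu (j0 F) (jA F)).
move: (ip mu (jB F) (jB F)) (P0 mu F) (ip mu (j0 F) (jB F)).
move: (ip mu (j1 F) (j1 F)) (ip mu (j0 F) (j1 F)) (ip mu (j0 F) (j0 F)).
move=> CC DC DD BB BC DB AA AB AC DA e1 e2 e3 e4.
have f1 : AB = - (mu + 1) / 2 * BC by lra.
have f2 : AC = - mu / 2 * CC by lra.
have f3 : DB = - mu / 2 * DD by lra.
have f4 : DA = - BC - mu * DC by lra.
by rewrite f1 f2 f3 f4; field.
Qed.

End closed_forms.

(** * The extremal f1, and rigidity in the completion *)

Section extremals.
Context {R : realType}.
Local Notation lam := (@lebesgue_measure R).
Implicit Types (F G H : jet R) (u v w t : R -> R) (x c : R).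

Lemma ip_gt0 mu u : L2 mu u -> (forall x, 0 < x -> u x != 0) -> 0 < ip mu u u.
Proof.
move=> hu u0; rewrite lt_neqAle ip_ge0 andbT eq_sym; apply/negP => /eqP e.
have [N [mN N0 sN]] := ip_eq0_ae hu e.
have : (lam (@half_line R) <= lam N)%E.
  apply: le_measure; rewrite ?inE//; first exact: measurable_itv.
  by move=> x xh; apply: sN => /=; apply/not_implyP; split=> //; apply/eqP/u0/half_lineP.
by rewrite N0 /half_line lebesgue_measure_itv/= ltry.
Qed.

Lemma half_eq0 (X Y m : R) : 2 * X + m * Y = 0 -> X + m / 2 * Y = 0.
Proof. lra. Qed.

Lemma ge0_le_eq0 (X : R) : 4 * X <= 2 * X -> 0 <= X -> X = 0.
Proof. lra. Qed.

Variables (mu a : R) (mu0 : 0 < mu).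

Definition null u := L2 mu u /\ ip mu u u = 0.

Lemma null_lin c u v : null u -> null v -> null (fun x => u x + c * v x).
Proof.
move=> [hu u0] [hv v0]; split; first by apply: L2D hu (L2Z c hv).
by rewrite (ip_sqrD c hu hv) u0 v0 (ip_eq0 hu hv u0); ring.
Qed.

Lemma null_ae u : L2 mu u -> {ae lam, forall x, half_line x -> u x = 0} -> null u.
Proof.
move=> hu u0; split=> //; rewrite /ip /int_dmu /int_half /Rintegral.
rewrite (ae_eq_integral (cst 0%E)) ?integral0//; first exact: measurable_itv.
- exact: measurable_int (L2M hu hu).
- have h : {ae lam, forall x, half_line x -> (u x * u x * x `^ (mu - 1))%:E = cst 0%E x}.
    move: u0; apply: filterS; first exact: (ae_filter_ringOfSetsType lam).
    by move=> x /= ux xh; rewrite ux// !mul0r.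
  exact: h.
Qed.

Lemma P0_Dsq F : inD mu F -> Dsq mu F = 0 -> P0 mu F = 0 /\ normT mu a F = 0.
Proof.
move=> hF; have [hA hB hC hD] := hF.
have := ip_ge0 mu (jA F); have := ip_ge0 mu (jB F).
have := ip_ge0 mu (j1 F); have := ip_ge0 mu (j0 F).
rewrite /Dsq => d0 c0 b0 a0 e.
have A0 : ip mu (jA F) (jA F) = 0 by move: a0 b0 c0 d0 e; clear; lra.
have B0 : ip mu (jB F) (jB F) = 0 by move: a0 b0 c0 d0 e; clear; lra.
have C0 : ip mu (j1 F) (j1 F) = 0 by move: a0 b0 c0 d0 e; clear; lra.
have D0 : ip mu (j0 F) (j0 F) = 0 by move: a0 b0 c0 d0 e; clear; lra.
split; first exact: ip_eq0 hB hC B0.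
have [_] := null_lin a (null_lin mu (null_lin 1 (conj hA A0) (conj hB B0)) (conj hC C0)) (conj hD D0).
by under eq_fun do rewrite mul1r.
Qed.

(** P0 = 0 makes f' null, and then 2 <x f', f> + mu |f|^2 = 0 makes f null. Finally x f'' is T f up
    to null terms. No argument about weak derivatives is required. *)
Lemma rigid F : Dlim mu nice F -> P0 mu F = 0 -> normT mu a F = 0 -> Dsq mu F = 0.
Proof.
move=> dF P00 T0; have hF := dF.1; have [hA hB hC hD] := hF.
have hC' := L2_shift hF; rewrite P0_shift in P00.
have ae1 := ip_eq0_ae hC' P00.
have [_ C0] := null_ae hC ae1.
have [_ B0] : null (jB F).
  apply: null_ae => //; move: ae1; apply: filterS; first exact: (ae_filter_ringOfSetsType lam).
  by move=> x h xh; rewrite /jB h// mulr0.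
have D0 : ip mu (j0 F) (j0 F) = 0.
  have := D_B_D mu0 dF; rewrite (ip_eq0 hB hD B0) mulr0 add0r => /eqP.
  by rewrite mulf_eq0 (gt_eqF mu0) => /eqP.
have hT := L2_TopA a hF.
have [_] := null_lin (- a) (null_lin (- mu) (null_lin (-1) (conj hT T0) (conj hB B0))
  (conj hC C0)) (conj hD D0).
have -> : (fun x => TopA mu a F x + -1 * jB F x + - mu * j1 F x + - a * j0 F x) = jA F.
  by apply/funext => x; rewrite /TopA; ring.
by rewrite /Dsq => ->; rewrite B0 C0 D0 !addr0.
Qed.

Variables (F0 F1 K K1 : jet R).
Hypotheses (rF0 : reg F0) (dF0 : Dlim mu nice F0) (dF1 : Dlim mu nice F1).
Hypothesis TF0 : forall x, 0 < x -> TopA mu a F0 x = 0.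
Hypotheses (kK : kernel mu a K) (kK1 : kernel (mu + 1) (a + 1) K1).
Hypotheses (K0E : forall x, 0 < x -> j0 K x = j1 F0 x)
  (KE : forall x, 0 < x -> j1 K x = j2 F0 x)
  (K1E : forall x, 0 < x -> j0 K1 x = j1 K x).
Hypothesis F1E : forall x, 0 < x -> [/\
  j0 F1 x = x * j1 F0 x + (mu - 1) / 2 * j0 F0 x,
  j1 F1 x = x * j2 F0 x + (mu + 1) / 2 * j1 F0 x &
  j2 F1 x = x * j2 K x + (mu + 3) / 2 * j2 F0 x].

Let hF0 := dF0.1.
Let hF1 := dF1.1.

(** [TopA] commutes with x d/dx up to its part of degree -1, which is x F0'' + mu F0', and it
    annihilates F0. *)
Lemma TF1 x : 0 < x -> TopA mu a F1 x = jA F0 x + mu * j1 F0 x.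
Proof.
move=> x0; have [e0 e1 e2] := F1E x0.
have := TF0 x0; have := kernel_ode kK x0.
rewrite /TopA /Wop /jA /jB e0 e1 e2 K0E// KE// => o1 o0.
apply/eqP; rewrite -subr_eq0; apply/eqP.
transitivity (x * (x * j2 K x + (x + mu + 1) * j2 F0 x + (a + 1) * j1 F0 x)
  + (mu - 1) / 2 * (x * j2 F0 x + x * j1 F0 x + mu * j1 F0 x + a * j0 F0 x)).
  by field.
by rewrite o1 o0 !mulr0 addr0.
Qed.

Lemma P0_F0_gt0 : 0 < P0 mu F0.
Proof.
rewrite P0_shift; apply: ip_gt0 (L2_shift hF0) _ => x x0; rewrite -K0E//.
have [c c0 hc] := kernel_low kK x.
by rewrite -normr_gt0 (lt_le_trans c0)// hc.
Qed.

Lemma TT_F0 F : inD mu F -> TT mu a F F0 = 0.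
Proof.
move=> hF; have hT := L2_TopA a hF.
transitivity (ip mu (TopA mu a F) (fun x => 0 * TopA mu a F x)).
  by apply: ip_ext => // x x0; rewrite TF0// mul0r.
by rewrite (ipZr 0 hT hT) mul0r.
Qed.

Lemma PP_F1 F : PP mu F F1 = int_dmu mu (fun x => jB F x * (jA F0 x + (mu + 1) / 2 * j1 F0 x)).
Proof. by apply: int_ext => x x0; have [_ -> _] := F1E x0. Qed.

(** This is what fixes the coefficient (mu - 1) / 2 of f0 in f1: one differentiation makes it (mu +
    1) / 2, the value at which [D_A_B] cancels the pairing. *)
Lemma orth_F1 : PP mu F1 F0 = 0.
Proof.
have [hA hB hC hD] := hF0.
rewrite PPC PP_F1 -/(ip mu (jB F0) (fun x => jA F0 x + (mu + 1) / 2 * j1 F0 x)).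
rewrite (ipDr hA (L2Z _ hC) hB) (ipZr _ hC hB) ipC -/(P0 mu F0).
by rewrite -(half_eq0 (D_A_B mu0 dF0)).
Qed.

(** [TopA F1] is x K' + mu K, so [int_T_S] applies with G = K. As [Wop K = 0], [Sop K] is - (2 x K'
    + (mu + 1) K) = - 2 F1'. Thus f1 is an eigenfunction for the value 2 in weak form, against every
    F and not only those orthogonal to f0. *)
Lemma TT_F1 F : Dlim mu nice F -> TT mu a F F1 = 2 * PP mu F F1.
Proof.
move=> [hF [Fn [nFn hFn cF]]].
suff e : 1 * TT mu a F F1 + (-2) * PP mu F F1 = 0.
  by apply/eqP; rewrite -subr_eq0 -[X in X - _]mul1r -mulNr e.
apply: (lim2_eq0 (cvg_TT hFn hF cF hF1) (cvg_PP hFn hF cF hF1)) => n.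
have hTn := L2_TopA a (hFn n); have hT1 := L2_TopA a hF1.
have hBn := inD_B (hFn n); have hC1 := inD_C hF1.
have := int_T_S mu0 a (nFn n) (kernel_reg kK).
rewrite (@int_ext _ _ _ (fun x => (- 2 * jB (Fn n) x) * j1 F1 x + TopA mu a (Fn n) x * TopA mu a F1 x)).
  rewrite (int_ip2 (L2Z _ hBn) hC1 hTn hT1) (ipZl _ hBn hC1) => e.
  by rewrite mul1r addrC.
move=> x x0; rewrite TF1//; have [_ -> _] := F1E x0.
have := kernel_ode kK x0; rewrite /Sop /Wop /jA /jB K0E// KE// => o1.
apply/eqP; rewrite -subr_eq0; apply/eqP.
transitivity (x * j1 (Fn n) x * (x * j2 K x + (x + mu + 1) * j2 F0 x + (a + 1) * j1 F0 x)).
  by field.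
by rewrite o1 mulr0.
Qed.

Lemma normT_F1 : normT mu a F1 = 2 * P0 mu F1.
Proof. exact: TT_F1. Qed.

(** P0[F1] is half of |T F1|^2, and [D_A_C] reduces |x F0'' + mu F0'|^2 to |x F0''|^2, where F0''
    has no zero. *)
Lemma P0_F1_gt0 : 0 < P0 mu F1.
Proof.
have [hA hB hC hD] := hF0.
suff : 0 < normT mu a F1 by rewrite normT_F1 pmulr_rgt0.
rewrite /normT (@ip_ext _ _ _ _ (fun x => jA F0 x + mu * j1 F0 x) (fun x => jA F0 x + mu * j1 F0 x));
  [|exact: TF1..].
rewrite (ip_sqrD mu hA hC).
have -> : ip mu (jA F0) (jA F0) + 2 * mu * ip mu (jA F0) (j1 F0) + mu ^+ 2 * ip mu (j1 F0) (j1 F0) =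
    ip mu (jA F0) (jA F0) + mu * (2 * ip mu (jA F0) (j1 F0) + mu * ip mu (j1 F0) (j1 F0)) by ring.
rewrite (D_A_C mu0 dF0) mulr0 addr0; apply: ip_gt0 hA _ => x x0.
apply: mulf_neq0; first by rewrite gt_eqF.
rewrite -KE// -K1E//.
have [c c0 hc] := kernel_low kK1 x.
by rewrite -normr_gt0 (lt_le_trans c0)// hc.
Qed.

Lemma orthE F : Dlim mu nice F ->
  int_dmu mu (fun x => j0 F x * Lop mu F0 x) = PP mu F F0.
Proof.
move=> dF; have [hA hB hC hD] := hF0.
have := D_L_polar mu0 dF rF0 hF0.
have -> : int_dmu mu (fun x => j0 F x * Lop mu F0 x) =
    - ip mu (j0 F) (fun x => jA F0 x + mu * j1 F0 x).
  have hL := L2D hA (L2Z mu hC).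
  rewrite -(ipNr hL (inD_D dF.1)).
  by apply: int_ext => x x0; rewrite /Lop /jA; ring.
by move=> /eqP; rewrite addr_eq0 => /eqP ->; rewrite opprK.
Qed.

Lemma intLE F : Dlim mu nice F -> int_dmu mu (fun x => j0 F x * Lop mu F x) = P0 mu F.
Proof.
move=> dF; have [hA hB hC hD] := dF.1.
have := D_L mu0 dF.
have -> : int_dmu mu (fun x => j0 F x * Lop mu F x) =
    - (ip mu (j0 F) (jA F) + mu * ip mu (j0 F) (j1 F)).
  have hL := L2D hA (L2Z mu hC).
  rewrite -(ipZr mu hC hD) -(ipDr hA (L2Z mu hC) hD) -(ipNr hL hD).
  by apply: int_ext => x x0; rewrite /Lop /jA; ring.
by move=> /eqP; rewrite addr_eq0 => /eqP ->; rewrite opprK.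
Qed.

Lemma PP_lin_continuous G : inD mu G ->
  (forall c F H, inD mu F -> inD mu H ->
     PP mu (jadd F (jscale c H)) G = PP mu F G + c * PP mu H G) /\
  (forall Fn F, (forall n, inD mu (Fn n)) -> inD mu F -> Dcvg mu Fn F ->
     PP mu (Fn n) G @[n --> \oo] --> PP mu F G).
Proof.
move=> hG; split=> [c F H hF hH|Fn F hFn hF cF]; first exact: PP_linl.
exact: cvg_PP.
Qed.

Lemma lim_le (u v : nat -> R) (l m : R) : u n @[n --> \oo] --> l -> v n @[n --> \oo] --> m ->
  (forall n, u n <= v n) -> l <= m.
Proof.
move=> ul vm uv; apply: (ler_cvg_to ul vm); exact: nearW.
Qed.

(** [first_gap] concerns only functions that satisfy the constraint exactly; [Dlim_ker] supplies
    approximants of this kind. *)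
Lemma gap_D F : Dlim mu nice F -> PP mu F F0 = 0 -> 2 * P0 mu F <= normT mu a F.
Proof.
move=> dF o0; have [ol oc] := PP_lin_continuous hF0.
have [hF [Fn [SF hFn cF]]] := Dlim_ker (@nice_lin R) ol oc dF o0.
apply: (@lim_le (fun n => 2 * P0 mu (Fn n)) (fun n => normT mu a (Fn n))).
- by apply: cvgM (cvg_P0 hFn hF cF); exact: cvg_cst.
- exact: cvg_normT.
move=> n; have [nFn oFn] := SF n; apply: (first_gap mu0 kK nFn).
by rewrite -[RHS]oFn; apply: int_ext => x x0; rewrite K0E.
Qed.

Lemma gap_D2 F : Dlim mu nice F -> PP mu F F0 = 0 -> PP mu F F1 = 0 ->
  4 * P0 mu F <= normT mu a F.
Proof.
move=> dF o0 o1; have [ol oc] := PP_lin_continuous hF0.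
have [ol1 oc1] := PP_lin_continuous hF1.
have dF' := Dlim_ker (@nice_lin R) ol oc dF o0.
have nD G : nice G -> inD mu G by exact: nice_inD.
have [hF [Fn [SF hFn cF]]] := Dlim_ker (jlinear_ker (@nice_lin R) nD ol) ol1 oc1 dF' o1.
apply: (@lim_le (fun n => 4 * P0 mu (Fn n)) (fun n => normT mu a (Fn n))).
- by apply: cvgM (cvg_P0 hFn hF cF); exact: cvg_cst.
- exact: cvg_normT.
move=> n; have [[nFn oFn] oFn1] := SF n; apply: (second_gap mu0 kK kK1 K1E nFn).
  by rewrite -[RHS]oFn; apply: int_ext => x x0; rewrite K0E.
have rK := kernel_reg kK; have rFn := nice_reg nFn.
have i1 : lam.-integrable half_line (EFin \o (fun x => x * (j1 (Fn n) x * jB K x) * x `^ (mu - 1))).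
  apply: integrable_compact => //.
  - apply: cposM (@cpos_id _) _; apply: cposM (reg_c1 rFn) _.
    exact: cposM (@cpos_id _) (reg_c1 rK).
  - apply: locbM (@locb_id _) _; apply: locbM (reg_b1 rFn) _.
    exact: locbM (@locb_id _) (reg_b1 rK).
  - by apply: evanishMr; apply: evanishMl; exact: nice_v1.
(* F1' is x K' + (mu + 1) / 2 K. The part along K drops out by the first constraint, so
   orthogonality to F1 becomes the second hypothesis of [second_gap]. *)
have i2 := integrable_scale ((mu + 1) / 2) (L2M (inD_B (hFn n)) (inD_C hF0)).
have := oFn1; rewrite PP_F1.
rewrite (@int_ext _ _ _ (fun x => x * (j1 (Fn n) x * jB K x) +
    (mu + 1) / 2 * (jB (Fn n) x * j1 F0 x))); last first.
  by move=> x x0; rewrite /jB /jA KE//; ring.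
rewrite int_add//; last by apply: integrable_ext i2 => x _; rewrite mulrA.
rewrite int_scale; last exact: L2M (inD_B (hFn n)) (inD_C hF0).
have -> : int_dmu mu (fun x => jB (Fn n) x * j1 F0 x) = 0 by exact: oFn.
by rewrite mulr0 addr0.
Qed.

Lemma extremal F : Dlim mu nice F -> PP mu F F0 = 0 -> normT mu a F = 2 * P0 mu F ->
  exists c, Dsq mu (jadd F (jscale (- c) F1)) = 0.
Proof.
move=> dF o0 e; have p1 := P0_F1_gt0; pose c := PP mu F F1 / P0 mu F1; exists c.
have hF := dF.1.
have dG := Dlim_lin (@nice_lin R) (- c) dF dF1.
have o0G : PP mu (jadd F (jscale (- c) F1)) F0 = 0.
  by rewrite PP_linl// o0 orth_F1 mulr0 addr0.
have o1G : PP mu (jadd F (jscale (- c) F1)) F1 = 0.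
  by rewrite PP_linl// -/(P0 mu F1) mulNr divfK ?subrr// gt_eqF.
have := gap_D2 dG o0G o1G.
have e2 : normT mu a (jadd F (jscale (- c) F1)) = 2 * P0 mu (jadd F (jscale (- c) F1)).
  by rewrite normT_lin// P0_lin// TT_F1// normT_F1 e; ring.
rewrite e2 => h; have P00 : P0 mu (jadd F (jscale (- c) F1)) = 0.
  exact: ge0_le_eq0 h (P0_ge0 _ _).
by apply: rigid => //; rewrite e2 P00 mulr0.
Qed.

End extremals.

(** * Smoothness, and the flat functions built from e^(-1/t) *)

Section smooth_functions.
Context {R : realType}.
Implicit Types (f g : R -> R) (x t : R) (n : nat) (p : {poly R}).

(** [Cn n f] provides n + 1 derivatives. The recursion passes to f' first, whereas an iterated
    derivative exposes its last differentiation; products and compositions can then be treated by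
    induction on n. *)
Fixpoint Cn n f : Prop :=
  (forall x, derivable f x 1) /\ (if n is m.+1 then Cn m f^`()%classic else True).

Definition smooth f := forall n x, derivable (f^`(n))%classic x 1.

Lemma smooth_Cn f : smooth f <-> forall n, Cn n f.
Proof.
split.
- move=> sf n; elim: n f sf => [|n ih] f sf; first by split=> // x; exact: sf 0%N x.
  split; first by move=> x; exact: sf 0%N x.
  by apply: ih => m x; have := sf m.+1 x; rewrite derive1Sn.
- move=> h n; elim: n f h => [|n ih] f h x; first by have [] := h 0%N.
  by rewrite derive1Sn; apply: ih => m; have [] := h m.+1.
Qed.

Lemma isd_derive1 f x : derivable f x 1 -> is_derive x 1 f (f^`()%classic x).
Proof. by move=> df; split=> //; rewrite derive1E. Qed.

Lemma derive1_fun f (df : R -> R) : (forall x, is_derive x 1 f (df x)) -> f^`()%classic = df.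
Proof. by move=> h; apply/funext => x; exact: isd_val (h x). Qed.

Lemma Cn_isd n f (df : R -> R) : (forall x, is_derive x 1 f (df x)) -> Cn n df -> Cn n.+1 f.
Proof.
move=> h hd; split; first by move=> x; case: (h x).
by rewrite (derive1_fun h).
Qed.

Lemma CnW n f : Cn n.+1 f -> Cn n f.
Proof.
elim: n f => [|n ih] f [df cf]; first by split.
by split=> //; exact: ih.
Qed.

Lemma CnD n f g : Cn n f -> Cn n g -> Cn n (fun x => f x + g x).
Proof.
elim: n f g => [|n ih] f g [df cf] [dg cg].
  by split; [move=> x; case: (isdD (isd_derive1 (df x)) (isd_derive1 (dg x)))|].
apply: (@Cn_isd _ _ (fun x => f^`()%classic x + g^`()%classic x)).
  by move=> x; exact: isdD (isd_derive1 (df x)) (isd_derive1 (dg x)).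
exact: ih.
Qed.

Lemma CnM n f g : Cn n f -> Cn n g -> Cn n (fun x => f x * g x).
Proof.
elim: n f g => [|n ih] f g hf hg; have [df cf] := hf; have [dg cg] := hg.
  by split; [move=> x; case: (isdM (isd_derive1 (df x)) (isd_derive1 (dg x)))|].
apply: (@Cn_isd _ _ (fun x => f x * g^`()%classic x + g x * f^`()%classic x)).
  by move=> x; exact: isdM (isd_derive1 (df x)) (isd_derive1 (dg x)).
by apply: CnD; apply: ih => //; exact: CnW.
Qed.

Lemma Cn_cst n (c : R) : Cn n (fun=> c).
Proof.
elim: n c => [|n ih] c; first by split=> // x; case: (isd_cst c x).
by apply: (@Cn_isd _ _ (fun=> 0)) => // x; exact: isd_cst.
Qed.

Lemma Cn_affine n f (c d : R) : Cn n f -> Cn n (fun x => f (c * x + d)).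
Proof.
have aff x : is_derive x 1 (fun t : R => c * t + d) c.
  apply: isd_eq (isdD (isdM (isd_cst c x) (isd_id x)) (isd_cst d x)) _.
  by rewrite mulr1 mulr0 !addr0.
elim: n f => [|n ih] f [df cf].
  by split; [move=> x; case: (isd_comp (g := fun t => c * t + d)
    (isd_derive1 (df (c * x + d))) (aff x))|].
apply: (@Cn_isd _ _ (fun x => f^`()%classic (c * x + d) * c)).
  by move=> x; exact: (isd_comp (g := fun t => c * t + d) (isd_derive1 (df (c * x + d))) (aff x)).
by apply: CnM; [exact: ih|exact: Cn_cst].
Qed.

Definition flat p t := if 0 < t then p.[t^-1] * expR (- t^-1) else 0.

Lemma flat_gt0 p t : 0 < t -> flat p t = p.[t^-1] * expR (- t^-1).
Proof. by rewrite /flat => ->. Qed.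

Lemma flat_le0 p t : t <= 0 -> flat p t = 0.
Proof. by rewrite /flat ltNge => ->. Qed.

Lemma horner_bound p : exists A : R, exists k, 0 <= A /\ forall s : R, 1 <= s -> `|p.[s]| <= A * s ^+ k.
Proof.
elim/poly_ind: p => [|p c [A [k [A0 hA]]]].
  by exists 0, 0%N; split=> // s _; rewrite horner0 normr0 mul0r.
exists (A + `|c|), k.+1; split; first by rewrite addr_ge0.
move=> s s1; rewrite hornerMXaddC (le_trans (ler_normD _ _))// mulrDl lerD//.
  rewrite normrM (ger0_norm (le_trans ler01 s1)) exprSr mulrA.
  by rewrite ler_wpM2r ?hA// (le_trans ler01 s1).
by rewrite ler_peMr// exprn_ege1.
Qed.

(** The square of t yields the derivative 0 at 0. If p(s) = O(s^k), then with s = 1/t the bound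
    follows from s^(k+2) / (k+2)! <= e^s. *)
Lemma flat_bound p : exists C : R, forall t, t <= 1 -> `|flat p t| <= C * t ^+ 2.
Proof.
have [A [k [A0 hA]]] := horner_bound p.
exists (A * (k.+2)`!%:R) => t t1; have [t0|t0] := leP t 0.
  by rewrite flat_le0// normr0 mulr_ge0 ?sqr_ge0// mulr_ge0.
rewrite flat_gt0//; have s1 : 1 <= t^-1 by rewrite invf_ge1.
have s0 : 0 < t^-1 by rewrite invr_gt0.
rewrite normrM (ger0_norm (expR_ge0 _)).
apply: (@le_trans _ _ (A * t^-1 ^+ k * expR (- t^-1))).
  by rewrite ler_wpM2r ?expR_ge0// hA.
have h : t^-1 ^+ k.+2 * expR (- t^-1) <= (k.+2)`!%:R.
  have f0 : 0 < (k.+2)`!%:R :> R by rewrite ltr0n fact_gt0.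
  have := expR_ge1Dxn k.+1 (ltW s0); rewrite expRN ler_pdivrMr ?expR_gt0// => h.
  have : t^-1 ^+ k.+2 / (k.+2)`!%:R <= expR t^-1 by lra.
  by rewrite ler_pdivrMr// mulrC.
have -> : A * t^-1 ^+ k * expR (- t^-1) = A * (t^-1 ^+ k.+2 * expR (- t^-1)) * t ^+ 2.
  by rewrite !exprS; field; rewrite gt_eqF.
by rewrite ler_wpM2r ?sqr_ge0// ler_wpM2l.
Qed.

Lemma isd_at0 f (C : R) : f 0 = 0 -> (forall t, `|t| <= 1 -> `|f t| <= C * t ^+ 2) ->
  is_derive (0 : R) 1 f 0.
Proof.
move=> f0 fC.
have h : h^-1 *: (f (h *: 1 + 0) - f 0) @[h --> (0 : R)^'] --> (0 : R).
  apply/norm_cvg0P; rewrite f0.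
  have hC : C * `|h| @[h --> (0 : R)^'] --> (0 : R).
    rewrite -[X in _ --> X](mulr0 C) -{2}(normr0 R); apply: cvgM; first exact: cvg_cst.
    by apply: cvg_norm; apply: cvg_within_filter; exact: cvg_id.
  apply: (squeeze_cvgr _ (cvg_cst 0) hC); near=> t.
  have t0 : t != 0 by near: t; exact: nbhs_dnbhs_neq.
  rewrite normr_ge0/= /GRing.scale/= mulr1 addr0 subr0 normrM normfV.
  rewrite ler_pdivrMl ?normr_gt0//.
  rewrite (_ : `|t| * (C * `|t|) = C * t ^+ 2); last first.
    by rewrite -(real_normK (num_real t)); ring.
  apply: fC; near: t; apply: dnbhs0_le; exact: ltr01.
split; first by apply/cvg_ex; exists 0.
by apply/cvg_lim.
Unshelve. all: by end_near. Qed.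

(* The functions p(1/t) e^(-1/t) are closed under differentiation. *)
Definition flatd p : {poly R} := 'X^2 * (p - p^`()).

Lemma flat_isd p t : is_derive t 1 (flat p) (flat (flatd p) t).
Proof.
have [t0|t0|->] := ltgtP t 0.
- rewrite (flat_le0 _ (ltW t0)); apply: isd_near (isd_cst 0 t).
  near=> s; rewrite flat_le0// ltW//; near: s; exact: lt_nbhsl.
- rewrite flat_gt0//; apply: (@isd_pos _ (fun s => p.[s^-1] * expR (- s^-1))) => //.
    by move=> s s0; rewrite flat_gt0.
  have tn0 : t != 0 by rewrite gt_eqF.
  have dinv := isdV tn0 (isd_id t).
  have dp := isd_comp (is_derive_poly p t^-1) dinv.
  have de := isd_comp (isd_expR _) (isdN dinv).
  apply: isd_eq (isdM dp de) _.
  rewrite /flatd hornerM hornerD hornerN hornerXn -exprVn; ring.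
- have [C hC] := flat_bound p; rewrite flat_le0//; apply: (@isd_at0 _ C).
    by rewrite flat_le0.
  by move=> s s1; apply: hC; rewrite (le_trans (ler_norm _)).
Unshelve. all: by end_near. Qed.

Lemma flat_Cn n p : Cn n (flat p).
Proof.
elim: n p => [|n ih] p; first by split=> // x; case: (flat_isd p x).
exact: Cn_isd (flat_isd p) (ih _).
Qed.

End smooth_functions.

(** * From approximation by test functions to the closures used above *)

Section completion.
Context {R : realType}.
Local Notation lam := (@lebesgue_measure R).
Implicit Types (f g : R -> R) (x t : R) (F G : jet R).

Lemma continuous_locb f : (forall x, {for x, continuous f}) -> locb f.
Proof.
move=> cf M; have [M0|M0] := leP M 0.
  by exists 0 => x x0 xM; move: (lt_le_trans x0 xM); rewrite ltNge M0.
have [|c cM hc] := @EVT_max R (fun x => `|f x|) 0 M (ltW M0).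
  by apply: continuous_subspaceT => x; apply: cvg_norm; exact: cf.
by exists `|f c| => x x0 xM; apply: hc; rewrite in_itv/= (ltW x0).
Qed.

Lemma smooth_cont f : smooth f -> forall n x, {for x, continuous (f^`(n))%classic}.
Proof. by move=> sf n x; exact: isd_cont (isd_derive1 (sf n x)). Qed.

Lemma smooth_reg f : smooth f -> reg (jet_of f).
Proof.
move=> sf; split.
- by move=> x _; exact: isd_derive1 (sf 0%N x).
- by move=> x _; exact: isd_derive1 (sf 1%N x).
- by split=> x _; exact: smooth_cont sf 2%N x.
- by apply: continuous_locb; exact: smooth_cont sf 0%N.
- by apply: continuous_locb; exact: smooth_cont sf 1%N.
- apply: locbM; first exact: locb_id.
  by apply: continuous_locb; exact: smooth_cont sf 2%N.
Qed.

Lemma derive1_vanish f M : (forall x, M < x -> f x = 0) ->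
  forall x, M < x -> f^`()%classic x = 0.
Proof.
move=> fM x Mx; apply: isd_val; apply: isd_near (isd_cst 0 x).
by near=> y; rewrite fM//; near: y; exact: lt_nbhsr.
Unshelve. all: by end_near. Qed.

Lemma test_nice f : test_fun f -> nice (jet_of f).
Proof.
move=> [sf [M fM]]; have f1 := derive1_vanish fM; have f2 := derive1_vanish f1.
by split; [exact: smooth_reg|exists M..].
Qed.

Lemma cvgL2_le mu (u_ : nat -> R -> R) (u : R -> R) (d : nat -> R) :
  (forall n, ip mu (fun x => u x - u_ n x) (fun x => u x - u_ n x) <= d n) ->
  d n @[n --> \oo] --> 0 -> cvgL2 mu u_ u.
Proof.
move=> ud d0; apply: squeeze_seq0 d0 => n; rewrite ger0_norm ?ip_ge0//.
by rewrite (le_trans _ (ud n))// le_eqVlt; apply/orP; left; apply/eqP; apply: int_ext => x _; ring.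
Qed.

Lemma sum4_le (p q r s e : R) : 0 <= p -> 0 <= q -> 0 <= r -> 0 <= s ->
  p + q + r + s <= e -> [/\ p <= e, q <= e, r <= e & s <= e].
Proof. by move=> *; split; lra. Qed.

Lemma D_space_Dlim mu F : 0 < mu -> D_space mu F -> Dlim mu nice F.
Proof.
move=> mu0 [m0 m1 m2 hF].
have inD_test f : test_fun f -> inD mu (jet_of f) by move=> /test_nice; exact: nice_inD.
have hsub f : test_fun f -> (D_normsq mu (jsub F (jet_of f)) < +oo)%E -> inD mu (jsub F (jet_of f)).
  move=> /inD_test [hA hB hC hD]; apply: inD_normsq => /=.
  - exact: measurable_funB m0 hD.1.
  - exact: measurable_funB m1 hC.1.
  - apply: measurable_funB m2 _.
    apply: (@eq_measurable_fun _ _ _ _ _ (fun x => x^-1 * jA (jet_of f) x)).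
      by move=> x; rewrite inE => /half_lineP x0; rewrite /jA mulrA mulVf ?mul1r// gt_eqF.
    apply: measurable_funM; last exact: hA.1.
    apply: cpos_measurable; split=> x x0.
    by apply: isd_cont (isdV _ (isd_id x)); rewrite gt_eqF.
have subK (G H : jet R) : H = jadd (jsub H G) G.
  by case: H => a b c; rewrite /jadd /jsub /=; congr Jet; apply/funext => x /=; rewrite subrK.
have hF' : inD mu F.
  (* A single approximation at finite distance already shows that F has finite norm. *)
  have [phi tphi h] := hF 1 ltr01.
  rewrite (subK (jet_of phi) F); apply: inD_add; last exact: inD_test.
  by apply: hsub => //; apply: lt_trans h _; exact: ltry.
split=> //.
have /choice[phi hphi] : forall n : nat, exists phi, test_fun phi /\
    (D_normsq mu (jsub F (jet_of phi)) < (n.+1%:R^-1)%:E)%E.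
  by move=> n; have [|phi t h] := hF n.+1%:R^-1; [rewrite invr_gt0|exists phi].
have nphi n := test_nice (hphi n).1.
have dphi n := inD_test _ (hphi n).1.
exists (fun n => jet_of (phi n)); split=> //.
have hd n : Dsq mu (jsub F (jet_of (phi n))) <= n.+1%:R^-1.
  have := (hphi n).2; rewrite D_normsqE; last exact: inD_sub.
  by rewrite lte_fin => /ltW.
have dA n := ip_ge0 mu (jA (jsub F (jet_of (phi n)))).
have dB n := ip_ge0 mu (jB (jsub F (jet_of (phi n)))).
have dC n := ip_ge0 mu (j1 (jsub F (jet_of (phi n)))).
have dD n := ip_ge0 mu (j0 (jsub F (jet_of (phi n)))).
have h0 : (n.+1%:R^-1 : R) @[n --> \oo] --> 0 by exact: cvg_harmonic.
have hall n := sum4_le (dA n) (dB n) (dC n) (dD n) (hd n).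
split; apply: cvgL2_le h0 => n; have [lA lB lC lD] := hall n => //.
- have -> : (fun x => jA F x - jA (jet_of (phi n)) x) = jA (jsub F (jet_of (phi n))).
    by apply/funext => x; rewrite /jA /= mulrBr.
  exact: lA.
- have -> : (fun x => jB F x - jB (jet_of (phi n)) x) = jB (jsub F (jet_of (phi n))).
    by apply/funext => x; rewrite /jB /= mulrBr.
  exact: lB.
Qed.

(** Dominated convergence, with C^2 u^2 x^(mu-1) as the dominating function. *)
Lemma mult_cvg0 mu (m : nat -> R -> R) (C : R) (u : R -> R) :
  (forall n, cpos (m n)) -> (forall n x, 0 < x -> `|m n x| <= C) ->
  (forall x, 0 < x -> m n x @[n --> \oo] --> 0) -> L2 mu u ->
  (forall n, L2 mu (fun x => m n x * u x)) /\ cvgL2 mu (fun n x => m n x * u x) (fun=> 0).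
Proof.
move=> cm mC m0 hu.
have bd n x : 0 < x -> (m n x * u x) ^+ 2 * x `^ (mu - 1) <= C ^+ 2 * (u x ^+ 2 * x `^ (mu - 1)).
  move=> x0; rewrite exprMn -mulrA; apply: ler_wpM2r.
    by rewrite mulr_ge0 ?sqr_ge0 ?powR_ge0.
  rewrite -real_normK ?num_real//; have h := mC n x x0.
  by apply: lerXn2r => //; rewrite nnegrE ?normr_ge0// (le_trans _ h).
have ms n : measurable_fun half_line (fun x => m n x * u x).
  by apply: measurable_funM; [exact: cpos_measurable|exact: hu.1].
have ms2 n : measurable_fun half_line (fun x => (m n x * u x) ^+ 2 * x `^ (mu - 1)).
  by apply: measurable_funM; [exact: measurable_funX|exact: measurable_weight].
have iu := integrable_scale (C ^+ 2) hu.2.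
have hL n : L2 mu (fun x => m n x * u x).
  split=> //; apply: integrable_le iu => // x x0.
  by rewrite ger0_norm ?bd// mulr_ge0 ?sqr_ge0 ?powR_ge0.
split=> //; rewrite /cvgL2.
pose fn n x := ((m n x * u x) ^+ 2 * x `^ (mu - 1))%:E.
have h1 : {ae lam, forall x, half_line x -> fn ^~ x @ \oo --> cst 0%E x}.
  apply: aeW => x /half_lineP x0; apply: cvg_EFin; first exact: nearW.
  rewrite (_ : _ \o _ = fun n => u x ^+ 2 * x `^ (mu - 1) * (m n x * m n x)).
    apply: cvg_scale0; have := cvgM (m0 x x0) (m0 x x0).
    by rewrite mulr0; apply.
  by apply/funext => n /=; ring.
have h2 : {ae lam, forall x n, half_line x -> (`|fn n x| <=
    (EFin \o (fun x => C ^+ 2 * (u x ^+ 2 * x `^ (mu - 1)))%R) x)%E}.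
  apply: aeW => x n /half_lineP x0; rewrite lee_fin ger0_norm ?bd//.
  by rewrite mulr_ge0 ?sqr_ge0 ?powR_ge0.
have mfn n : measurable_fun half_line (fn n) by exact/measurable_EFinP.
have [||||||_ _] := @dominated_convergence _ _ R lam half_line _ fn (cst 0%E)
  (EFin \o (fun x => C ^+ 2 * (u x ^+ 2 * x `^ (mu - 1)))).
- exact: measurable_itv.
- exact: mfn.
- exact: measurable_cst.
- exact: h1.
- exact: iu.
- exact: h2.
rewrite integral0 => h.
suff -> : (fun n => ip mu (fun x => m n x * u x - 0) (fun x => m n x * u x - 0)) =
    fine \o (fun n => \int[lam]_(x in half_line) fn n x)%E by apply: fine_cvg; exact: h.
apply/funext => n /=; rewrite /fn ip_EFin//=; apply: int_ext => x _.
by rewrite subr0.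
Qed.

End completion.

(** * Smooth functions of finite norm belong to the completion *)

Section cutoff.
Context {R : realType}.
Local Notation lam := (@lebesgue_measure R).
Implicit Types (f g : R -> R) (x t : R) (F G : jet R) (n : nat).

Definition L2null mu (u_ : nat -> R -> R) := (forall n, L2 mu (u_ n)) /\
  ip mu (u_ n) (u_ n) @[n --> \oo] --> 0.

Lemma L2nullD mu (u_ v_ : nat -> R -> R) : L2null mu u_ -> L2null mu v_ ->
  L2null mu (fun n x => u_ n x + v_ n x).
Proof.
move=> [hu cu] [hv cv]; split=> [n|]; first exact: L2D.
apply: (@squeeze_seq0 _ _ (fun n => 2 * ip mu (u_ n) (u_ n) + 2 * ip mu (v_ n) (v_ n))).
  by move=> n; rewrite ger0_norm ?ip_ge0//; exact: sqrnD_le.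
by have := cvgD (cvg_scale0 2 cu) (cvg_scale0 2 cv); rewrite addr0; apply.
Qed.

Lemma L2null_mult mu (m : nat -> R -> R) (C : R) (u : R -> R) :
  (forall n, cpos (m n)) -> (forall n x, 0 < x -> `|m n x| <= C) ->
  (forall x, 0 < x -> m n x @[n --> \oo] --> 0) -> L2 mu u ->
  L2null mu (fun n x => m n x * u x).
Proof.
move=> cm mC m0 hu; have [hL] := mult_cvg0 cm mC m0 hu; split=> //.
suff -> : (fun n => ip mu (fun x => m n x * u x) (fun x => m n x * u x)) =
  (fun n => ip mu (fun x => m n x * u x - 0) (fun x => m n x * u x - 0)) by [].
by apply/funext => n; apply: ip_ext => x _; rewrite subr0.
Qed.

Lemma flat_bound1 (p : {poly R}) : exists2 C, 0 <= C & forall t, t <= 1 -> `|flat p t| <= C.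
Proof.
have [C hC] := flat_bound p; exists `|C| => // t t1.
have [t0|t0] := leP t 0; first by rewrite flat_le0// normr0.
rewrite (le_trans (hC t t1))// (le_trans (ler_norm _))// normrM ler_piMr//.
by rewrite ger0_norm ?sqr_ge0// exprn_ile1// ltW.
Qed.

Let c_ n : R := - n.+1%:R^-1.

Let c_cvg : c_ n @[n --> \oo] --> 0.
Proof. by rewrite -oppr0; apply: cvgN; exact: cvg_harmonic. Qed.

(* exp (1 - 1 / (1 - x / (n + 1))) on ]-oo, n + 1[, continued by 0. *)
Definition chi n x : R := expR 1 * flat 1 (c_ n * x + 1).
Let chi1 n x : R := expR 1 * (flat (flatd 1) (c_ n * x + 1) * c_ n).
Let chi2 n x : R := expR 1 * (flat (flatd (flatd 1)) (c_ n * x + 1) * c_ n * c_ n).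

Let aff n x : is_derive x 1 (fun t : R => c_ n * t + 1) (c_ n).
Proof.
apply: isd_eq (isdD (isdM (isd_cst (c_ n) x) (isd_id x)) (isd_cst 1 x)) _.
by rewrite mulr1 mulr0 !addr0.
Qed.

Let chi_isd n x : is_derive x 1 (chi n) (chi1 n x).
Proof.
have d := isd_comp (g := fun t => c_ n * t + 1) (flat_isd 1 _) (aff n x).
by apply: isd_eq (isdM (isd_cst (expR 1) x) d) _; rewrite mulr0 addr0.
Qed.

Let chi1_isd n x : is_derive x 1 (chi1 n) (chi2 n x).
Proof.
have d := isd_comp (g := fun t => c_ n * t + 1) (flat_isd (flatd 1) _) (aff n x).
apply: isd_eq (isdM (isd_cst (expR 1) x) (isdM d (isd_cst (c_ n) x))) _.
by rewrite /chi2 /=; ring.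
Qed.

Let chi2_cpos n : cpos (chi2 n).
Proof.
have c2 : cpos (fun x => flat (flatd (flatd 1)) (c_ n * x + 1)).
  split=> x _.
  exact: isd_cont (isd_comp (g := fun t => c_ n * t + 1) (flat_isd _ _) (aff n x)).
by rewrite /chi2; apply: cposM (@cpos_cst _ _) _; apply: cposM (@cpos_cst _ _);
  apply: cposM (@cpos_cst _ _).
Qed.

Lemma chi_smooth n : smooth (chi n).
Proof.
apply/smooth_Cn => k; apply: CnM; first exact: Cn_cst.
by apply: (@Cn_affine _ k (flat 1) (c_ n) 1); exact: flat_Cn.
Qed.

Lemma chi_vanish n x : n.+1%:R < x -> chi n x = 0.
Proof.
move=> nx; rewrite /chi flat_le0 ?mulr0// /c_ mulNr addrC subr_le0.
by rewrite ler_pdivlMl// mulr1 ltW.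
Qed.

Let aff_le1 n x : 0 < x -> c_ n * x + 1 <= 1.
Proof. by move=> x0; rewrite gerDr /c_ mulNr oppr_le0 mulr_ge0 ?invr_ge0// ltW. Qed.

(** Where [chi n] and its derivatives are nonzero, x < n + 1, while each differentiation brings a
    factor 1 / (n + 1). A factor x is thus compensated by one derivative. *)
Let chi_bound : exists C, forall n x, 0 < x ->
  [/\ `|1 - chi n x| <= C, `|chi1 n x| <= C, `|x * chi1 n x| <= C & `|x * chi2 n x| <= C].
Proof.
have [C0 C00 h0] := flat_bound1 1; have [C1 C10 h1] := flat_bound1 (flatd 1).
have [C2 C20 h2] := flat_bound1 (flatd (flatd 1)).
have e0 : 0 <= expR 1 :> R by exact: expR_ge0.
exists (1 + expR 1 * (C0 + C1 + C2)) => n x x0; have t1 := aff_le1 n x0.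
have s0 : 0 <= expR 1 * C0 by rewrite mulr_ge0.
have s1 : 0 <= expR 1 * C1 by rewrite mulr_ge0.
have s2 : 0 <= expR 1 * C2 by rewrite mulr_ge0.
have cn : `|c_ n| <= 1.
  by rewrite normrN ger0_norm ?invr_ge0// invf_le1// ler1n.
have xc p C : (forall t, t <= 1 -> `|flat p t| <= C) -> 0 <= C ->
    `|x * (flat p (c_ n * x + 1) * c_ n)| <= C.
  move=> hp C_0; have [tn|tp] := leP (c_ n * x + 1) 0.
    by rewrite flat_le0// mul0r mulr0 normr0.
  rewrite mulrCA normrM; apply: (@le_trans _ _ (C * 1)); last by rewrite mulr1.
  apply: ler_pM => //; first exact: hp.
  rewrite mulrC ler0_norm; last by rewrite /c_ mulNr oppr_le0 mulr_ge0 ?invr_ge0// ltW.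
  by rewrite -subr_ge0 opprK addrC ltW.
split.
- rewrite (le_trans (ler_normB _ _))// normr1 lerD2l normrM (ger0_norm e0).
  rewrite ler_wpM2l// (le_trans (h0 _ t1))//; lra.
- rewrite normrM (ger0_norm e0) (@le_trans _ _ (expR 1 * C1))//; last first.
    by rewrite !mulrDr; lra.
  rewrite ler_wpM2l// normrM -[leRHS]mulr1 ler_pM ?h1//.
- rewrite mulrCA normrM (ger0_norm e0) (@le_trans _ _ (expR 1 * C1))//; last first.
    by rewrite !mulrDr; lra.
  by rewrite ler_wpM2l// xc.
- rewrite /chi2 mulrCA normrM (ger0_norm e0) (@le_trans _ _ (expR 1 * C2))//; last first.
    by rewrite !mulrDr; lra.
  by rewrite ler_wpM2l// mulrA normrM -[leRHS]mulr1 ler_pM ?xc.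
Qed.

Let chi_cvg x : 0 < x -> 1 - chi n x @[n --> \oo] --> 0.
Proof.
move=> x0; have cx : c_ n * x + 1 @[n --> \oo] --> (1 : R).
  rewrite -[X in _ --> X]add0r -(mul0r x); apply: cvgD; last exact: cvg_cst.
  by apply: cvgM c_cvg _; exact: cvg_cst.
have cf : {for 1, continuous (flat (1 : {poly R}))} by exact: isd_cont (flat_isd 1 1).
have h : chi n x @[n --> \oo] --> expR 1 * flat 1 1.
  by apply: cvgM; [exact: cvg_cst|exact: continuous_cvg cx].
have e1 : expR 1 * flat 1 1 = 1 :> R.
  have h1 : (1 : {poly R}).[1] = 1 by rewrite -polyC1 hornerC.
  by rewrite flat_gt0// invr1 h1 mul1r -expRD subrr expR0.
by have := cvgB (cvg_cst (1 : R)) h; rewrite e1 subrr; apply.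
Qed.

(** [y] is kept apart from [x] so that y = 1 and y = x give the limits of chi' and of x chi' at
    once. *)
Let xchi1_cvg (y x : R) : 0 < x -> y * chi1 n x @[n --> \oo] --> 0.
Proof.
move=> x0; have [C1 C10 h1] := flat_bound1 (flatd 1).
apply: (@squeeze_seq0 _ _ (fun n => `|y| * (expR 1 * C1) * `|c_ n|)).
  move=> n; rewrite /chi1 !normrM (ger0_norm (expR_ge0 1)) -!mulrA.
  rewrite ler_wpM2l// ler_wpM2l ?expR_ge0// ler_wpM2r// h1//; exact: aff_le1.
by apply: cvg_scale0; rewrite -(normr0 R); apply: cvg_norm; exact: c_cvg.
Qed.

Let xchi2_cvg (y x : R) : 0 < x -> y * chi2 n x @[n --> \oo] --> 0.
Proof.
move=> x0; have [C2 C20 h2] := flat_bound1 (flatd (flatd 1)).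
apply: (@squeeze_seq0 _ _ (fun n => `|y| * (expR 1 * C2) * (`|c_ n| * `|c_ n|))).
  move=> n; rewrite /chi2 !normrM (ger0_norm (expR_ge0 1)) -!mulrA.
  rewrite ler_wpM2l// ler_wpM2l ?expR_ge0// ler_wpM2r// h2//; exact: aff_le1.
have nc : `|c_ n| @[n --> \oo] --> 0 by rewrite -(normr0 R); apply: cvg_norm; exact: c_cvg.
by apply: cvg_scale0; have := cvgM nc nc; rewrite mulr0; apply.
Qed.

Let chif_isd f n x : smooth f ->
  is_derive x 1 (fun t => chi n t * f t) (chi n x * f^`()%classic x + f x * chi1 n x).
Proof. by move=> sf; exact: isdM (chi_isd n x) (isd_derive1 (sf 0%N x)). Qed.

Let chif_isd2 f n x : smooth f ->
  is_derive x 1 (fun t => chi n t * f^`()%classic t + f t * chi1 n t)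
    (chi n x * f^`(2)%classic x + 2 * (chi1 n x * f^`()%classic x) + f x * chi2 n x).
Proof.
move=> sf; have d1 := isdM (chi_isd n x) (isd_derive1 (sf 1%N x)).
have d2 := isdM (isd_derive1 (sf 0%N x)) (chi1_isd n x).
by apply: isd_eq (isdD d1 d2) _; rewrite /=; ring.
Qed.

Let jet_chif f n : smooth f -> jet_of (fun x => chi n x * f x) =
  Jet (fun x => chi n x * f x) (fun x => chi n x * f^`()%classic x + f x * chi1 n x)
   (fun x => chi n x * f^`(2)%classic x + 2 * (chi1 n x * f^`()%classic x) + f x * chi2 n x).
Proof.
move=> sf; have e1 := derive1_fun (fun x => chif_isd n x sf).
rewrite /jet_of; congr Jet => //.
by rewrite [LHS]/= e1; apply: derive1_fun => x; exact: chif_isd2.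
Qed.

Let test_chif f n : smooth f -> test_fun (fun x => chi n x * f x).
Proof.
move=> sf; split; last by exists n.+1%:R => x nx; rewrite chi_vanish// mul0r.
apply/smooth_Cn => k; apply: (@CnM _ k (chi n) f).
  by move: k; apply/smooth_Cn; exact: chi_smooth.
by move: k; apply/smooth_Cn.
Qed.

Lemma D_space_smooth mu f : 0 < mu -> smooth f -> inD mu (jet_of f) -> D_space mu (jet_of f).
Proof.
move=> mu0 sf hf; have [hA hB hC hD] := hf; have rf := smooth_reg sf.
split; [exact: cpos_measurable (reg_c0 rf)|exact: cpos_measurable (reg_c1 rf)|
  exact: cpos_measurable (reg_c2 rf)|].
pose G n := jsub (jet_of f) (jet_of (fun x => chi n x * f x)).
have hG n : inD mu (G n).
  exact: inD_sub hf (nice_inD mu0 (test_nice (test_chif n sf))).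
have [C hC_] := chi_bound.
have cchi n : cpos (chi n) by apply: (@cpos_isd _ _ (chi1 n)) => x _; exact: chi_isd.
have cchi1 n : cpos (chi1 n) by apply: (@cpos_isd _ _ (chi2 n)) => x _; exact: chi1_isd.
have cm n : cpos (fun x => 1 - chi n x) by apply: cposD; [exact: cpos_cst|exact: cposN].
have bm n x : 0 < x -> `|1 - chi n x| <= C by move=> x0; have [] := hC_ n x x0.
have n1 u : L2 mu u -> L2null mu (fun n x => (1 - chi n x) * u x).
  exact: L2null_mult cm bm chi_cvg.
have n2 u : L2 mu u -> L2null mu (fun n x => (- chi1 n x) * u x).
  apply: (@L2null_mult _ _ C); first by move=> n; exact: cposN.
    by move=> n x x0; rewrite normrN; have [] := hC_ n x x0.
  move=> x x0; rewrite -oppr0; apply: cvgN; have := xchi1_cvg 1 x0.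
  by under eq_fun do rewrite mul1r.
have n3 u : L2 mu u -> L2null mu (fun n x => (- (x * chi1 n x)) * u x).
  apply: (@L2null_mult _ _ C); first by move=> n; apply: cposN; exact: cposM (@cpos_id _) _.
    by move=> n x x0; rewrite normrN; have [] := hC_ n x x0.
  by move=> x x0; rewrite -oppr0; apply: cvgN; exact: xchi1_cvg.
have n4 u : L2 mu u -> L2null mu (fun n x => (- (x * chi2 n x)) * u x).
  apply: (@L2null_mult _ _ C); first by move=> n; apply: cposN; exact: cposM (@cpos_id _) _.
    by move=> n x x0; rewrite normrN; have [] := hC_ n x x0.
  by move=> x x0; rewrite -oppr0; apply: cvgN; exact: xchi2_cvg.
(* In x (f - chi f)'' the factor x goes to the cut-off: x chi' multiplies f' and x chi'' multiplies
   f, both of which are in L^2(dmu) by the terms of the norm with weight x^(mu-1). *)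
have zA : ip mu (jA (G n)) (jA (G n)) @[n --> \oo] --> 0.
  have [_] := L2nullD (L2nullD (n1 _ hA) (n3 _ (L2Z 2 hC))) (n4 _ hD).
  rewrite (_ : (fun n => _) = fun n => ip mu (jA (G n)) (jA (G n)))//.
  apply/funext => n; apply: ip_ext => x x0; rewrite /G jet_chif// /jA /=; ring.
have zB : ip mu (jB (G n)) (jB (G n)) @[n --> \oo] --> 0.
  have [_] := L2nullD (n1 _ hB) (n3 _ hD).
  rewrite (_ : (fun n => _) = fun n => ip mu (jB (G n)) (jB (G n)))//.
  apply/funext => n; apply: ip_ext => x x0; rewrite /G jet_chif// /jB /=; ring.
have zC : ip mu (j1 (G n)) (j1 (G n)) @[n --> \oo] --> 0.
  have [_] := L2nullD (n1 _ hC) (n2 _ hD).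
  rewrite (_ : (fun n => _) = fun n => ip mu (j1 (G n)) (j1 (G n)))//.
  apply/funext => n; apply: ip_ext => x x0; rewrite /G jet_chif//=; ring.
have zD : ip mu (j0 (G n)) (j0 (G n)) @[n --> \oo] --> 0.
  have [_] := n1 _ hD.
  rewrite (_ : (fun n => _) = fun n => ip mu (j0 (G n)) (j0 (G n)))//.
  apply/funext => n; apply: ip_ext => x x0; rewrite /G jet_chif//=; ring.
have zG : Dsq mu (G n) @[n --> \oo] --> 0.
  by have := cvgD (cvgD (cvgD zA zB) zC) zD; rewrite !addr0; apply.
move=> e e0; have /cvgrPdist_lt/(_ e e0) := zG => -[N _ hN].
exists (fun x => chi N x * f x); first exact: test_chif.
rewrite D_normsqE; last exact: hG.
rewrite lte_fin; have := hN N (leqnn N); rewrite sub0r normrN.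
by apply: le_lt_trans; exact: ler_norm.
Qed.

End cutoff.

(** * The Kummer series: convergence, derivative, equation and contiguity *)

Section kummer_series.
Context {R : realType}.
Implicit Types (f g : nat -> R) (a c x : R) (n : nat).

Definition entire f := forall x, cvgn (pseries f x).
Definition psum f x := limn (pseries f x).

Lemma entire_le f g : (forall n, `|f n| <= g n) -> entire g -> entire f.
Proof.
move=> fg eg x; apply: normed_cvg; rewrite /normed_series_of/=.
apply: (@series_le_cvg R _ (fun n => g n * `|x| ^+ n)).
- by move=> n; exact: normr_ge0.
- by move=> n; rewrite mulr_ge0 ?exprn_ge0// (le_trans _ (fg n)).
- by move=> n /=; rewrite normrM normrX ler_wpM2r ?exprn_ge0.
- exact: eg.
Qed.

Lemma entireZ c f : entire f -> entire (fun n => c * f n).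
Proof.
move=> ef x; have := @is_cvg_seriesZ _ _ c (ef x).
by rewrite (_ : _ *: _ = fun n => (c * f n) * x ^+ n)//; apply/funext => n /=; rewrite -mulrA.
Qed.

Lemma psumD f g x : entire f -> entire g -> psum (fun n => f n + g n) x = psum f x + psum g x.
Proof.
move=> ef eg; rewrite /psum -(lim_seriesD (ef x) (eg x)); congr (limn (series _)).
by apply/funext => n /=; rewrite mulrDl.
Qed.

Lemma psumZ c f x : entire f -> psum (fun n => c * f n) x = c * psum f x.
Proof.
move=> ef; rewrite /psum -[RHS](@lim_seriesZ _ _ c (ef x)); congr (limn (series _)).
by apply/funext => n /=; rewrite -mulrA.
Qed.

Lemma psum_shift f x : cvgn (pseries (fun n => f n.+1) x) ->
  cvgn (pseries f x) /\ psum f x = f 0%N + x * psum (fun n => f n.+1) x.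
Proof.
move=> h; have h' : pseries f x @ \oo --> f 0%N + x * psum (fun n => f n.+1) x.
  rewrite -cvg_shiftS /=.
  rewrite (_ : (fun n => _) = fun n => f 0%N + x * pseries (fun n => f n.+1) x n).
    by apply: cvgD; [exact: cvg_cst|apply: cvgM; [exact: cvg_cst|exact: h]].
  apply/funext => n; rewrite /pseries /series /= big_nat_recl// expr0 mulr1; congr (_ + _).
  by rewrite big_distrr /=; apply: eq_bigr => i _; rewrite exprS mulrCA.
by split; [apply/cvg_ex; exists (f 0%N + x * psum (fun n => f n.+1) x)|apply/cvg_lim].
Qed.

Lemma psum_theta f x : entire (pseries_diffs f) ->
  cvgn (pseries (fun n => n%:R * f n) x) /\
  x * psum (pseries_diffs f) x = psum (fun n => n%:R * f n) x.
Proof.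
move=> h; have [h1 h2] := @psum_shift (fun n => n%:R * f n) x (h x).
by split=> //; rewrite h2 mul0r add0r.
Qed.

Lemma psum_isd f x : entire f -> entire (pseries_diffs f) ->
  entire (pseries_diffs (pseries_diffs f)) ->
  is_derive x 1 (psum f) (psum (pseries_diffs f) x).
Proof.
move=> e0 e1 e2; apply: (@pseries_snd_diffs _ _ (`|x| + 1)) => //.
by rewrite [ltRHS]ger0_norm ?addr_ge0// ltrDl.
Qed.

Definition kcoef a c n := rising a n / (rising c n * n`!%:R).

Lemma kummerE a c x : kummer a c x = psum (kcoef a c) x.
Proof. by []. Qed.

Lemma risingS a n : rising a n.+1 = rising a n * (a + n%:R).
Proof. by rewrite /rising big_ord_recr. Qed.

Lemma risingS_l a n : rising a n.+1 = a * rising (a + 1) n.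
Proof.
rewrite /rising big_ord_recl /= addr0; congr (_ * _).
by apply: eq_bigr => i _; rewrite /bump /= -addrA -natr1 (addrC 1).
Qed.

Lemma rising_gt0 c n : 0 < c -> 0 < rising c n.
Proof. by move=> c0; apply: prodr_gt0 => i _; rewrite ltr_wpDr. Qed.

Lemma kcoefS a c n : 0 < c ->
  (c + n%:R) * (n.+1%:R * kcoef a c n.+1) = (a + n%:R) * kcoef a c n.
Proof.
move=> c0; rewrite /kcoef !risingS factS natrM; field.
by rewrite !gt_eqF ?rising_gt0 ?ltr0n ?fact_gt0//= ?ltr_wpDr.
Qed.

Lemma kcoef_diffs a c : 0 < c ->
  pseries_diffs (kcoef a c) = fun n => a / c * kcoef (a + 1) (c + 1) n.
Proof.
move=> c0; apply/funext => n; rewrite /pseries_diffs /kcoef !risingS_l factS natrM.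
have c1 : 0 < c + 1 by rewrite addr_gt0.
by field; rewrite !gt_eqF ?rising_gt0 ?ltr0n ?fact_gt0.
Qed.

Lemma kcoef_entire a c : 0 < c -> entire (kcoef a c).
Proof.
(* [rho] bounds |a + n| / (c + n) for every n, so the coefficients are dominated by those of exp
   (rho x). *)
move=> c0; pose rho := `|a| / c + 1.
have rho0 : 0 <= rho by rewrite addr_ge0// divr_ge0// ltW.
apply: (@entire_le _ (fun n => rho ^+ n / n`!%:R)); last first.
  move=> x; have := is_cvg_series_exp_coeff (rho * x).
  rewrite (_ : exp_coeff _ = fun n => rho ^+ n / n`!%:R * x ^+ n)//.
  by apply/funext => n; rewrite /exp_coeff /= exprMn mulrAC.
move=> n; rewrite /kcoef invfM mulrA normrM [X in _ * X]ger0_norm ?invr_ge0//.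
rewrite ler_wpM2r ?invr_ge0//; elim: n => [|n ih].
  by rewrite /rising !big_ord0 divr1 normr1 expr0.
have cn : 0 < c + n%:R by rewrite ltr_wpDr.
have -> : rising a n.+1 / rising c n.+1 = rising a n / rising c n * ((a + n%:R) / (c + n%:R)).
  by rewrite !risingS; field; rewrite !gt_eqF ?rising_gt0.
rewrite normrM exprSr ler_pM// normrM normfV (gtr0_norm cn) ler_pdivrMr//.
rewrite (le_trans (ler_normD _ _))// (ger0_norm (ler0n _ _)) /rho mulrDl mul1r mulrDr.
rewrite divfK ?gt_eqF//.
have : 0 <= `|a| / c * n%:R by rewrite mulr_ge0// divr_ge0// ltW.
by move: cn c0; clear; lra.
Qed.

Lemma kummer_isd a c x : 0 < c ->
  is_derive x 1 (kummer a c) (a / c * kummer (a + 1) (c + 1) x).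
Proof.
move=> c0; have c1 : 0 < c + 1 by rewrite addr_gt0.
have c2 : 0 < c + 1 + 1 by rewrite addr_gt0.
have e1 : entire (pseries_diffs (kcoef a c)).
  by rewrite kcoef_diffs//; apply: entireZ; exact: kcoef_entire.
have e2 : entire (pseries_diffs (pseries_diffs (kcoef a c))).
  rewrite kcoef_diffs// (_ : pseries_diffs _ = fun n => a / c * pseries_diffs (kcoef (a + 1) (c + 1)) n).
    by rewrite kcoef_diffs//; do 2 apply: entireZ; exact: kcoef_entire.
  by apply/funext => n; rewrite /pseries_diffs mulrCA.
have d := psum_isd x (@kcoef_entire a _ c0) e1 e2.
rewrite (_ : kummer a c = psum (kcoef a c))//; apply: isd_eq d _.
by rewrite kcoef_diffs// psumZ//; exact: kcoef_entire.
Qed.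

(** The derivatives are written as shifted Kummer functions. With the powers of x absorbed by x
    d/dx, the coefficients of x^n match by the recurrence [kcoefS]. *)
Lemma kummer_ode a c x : 0 < c ->
  x * (a / c * ((a + 1) / (c + 1) * kummer (a + 1 + 1) (c + 1 + 1) x))
  + (c - x) * (a / c * kummer (a + 1) (c + 1) x) - a * kummer a c x = 0.
Proof.
move=> c0; have c1 : 0 < c + 1 by rewrite addr_gt0.
have c2 : 0 < c + 1 + 1 by rewrite addr_gt0.
have ek := @kcoef_entire a _ c0; have ek1 := @kcoef_entire (a + 1) _ c1.
have ek2 := @kcoef_entire (a + 1 + 1) _ c2.
have e1 : entire (pseries_diffs (kcoef a c)) by rewrite kcoef_diffs//; exact: entireZ.
pose d := pseries_diffs (kcoef a c).
have e2 : entire (pseries_diffs d).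
  rewrite /d kcoef_diffs// (_ : pseries_diffs _ = fun n => a / c * pseries_diffs (kcoef (a + 1) (c + 1)) n).
    by rewrite kcoef_diffs//; do 2 apply: entireZ.
  by apply/funext => n; rewrite /pseries_diffs mulrCA.
have w1 : a / c * kummer (a + 1) (c + 1) x = psum d x.
  by rewrite /d kcoef_diffs// psumZ.
have w2 : a / c * ((a + 1) / (c + 1) * kummer (a + 1 + 1) (c + 1 + 1) x) = psum (pseries_diffs d) x.
  rewrite /d kcoef_diffs// (_ : pseries_diffs _ = fun n => a / c * ((a + 1) / (c + 1) * kcoef (a + 1 + 1) (c + 1 + 1) n)).
    by rewrite !psumZ//; exact: entireZ.
  apply/funext => n.
  have := congr1 (fun f => f n) (kcoef_diffs (a + 1) c1); rewrite /pseries_diffs /= => <-.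
  by rewrite mulrCA.
have t1 : entire (fun n => n%:R * d n) by move=> y; exact: (psum_theta y e2).1.
have t0 : entire (fun n => n%:R * kcoef a c n) by move=> y; exact: (psum_theta y e1).1.
rewrite w1 w2 mulrBl (psum_theta x e2).2 (psum_theta x e1).2 kummerE -!psumZ//.
have : psum (fun n => n%:R * d n + c * d n) x = psum (fun n => n%:R * kcoef a c n + a * kcoef a c n) x.
  congr (psum _ x); apply/funext => n; rewrite -!mulrDl addrC (addrC _ a).
  exact: kcoefS.
rewrite !psumD//; try exact: entireZ.
by move=> /eqP; rewrite -subr_eq0 => /eqP <-; ring.
Qed.

(** The operator a + x d/dx multiplies the coefficient of x^n by a + n, and (a)_n (a + n) = a (a +
    1)_n. *)
Lemma kummer_contiguous a c x : 0 < c ->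
  a * kummer (a + 1) c x = a * kummer a c x + x * (a / c * kummer (a + 1) (c + 1) x).
Proof.
move=> c0; have c1 : 0 < c + 1 by rewrite addr_gt0.
have ek := @kcoef_entire a _ c0; have ek1 := @kcoef_entire (a + 1) _ c1.
have eka := @kcoef_entire (a + 1) _ c0.
have e1 : entire (pseries_diffs (kcoef a c)) by rewrite kcoef_diffs//; exact: entireZ.
have w1 : a / c * kummer (a + 1) (c + 1) x = psum (pseries_diffs (kcoef a c)) x.
  by rewrite kcoef_diffs// psumZ.
have t0 : entire (fun n => n%:R * kcoef a c n) by move=> y; exact: (psum_theta y e1).1.
rewrite w1 (psum_theta x e1).2 !kummerE -!psumZ// -psumD//; last exact: entireZ.
congr (psum _ x); apply/funext => n; rewrite -mulrDl /kcoef !mulrA; congr (_ / _).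
by rewrite -risingS_l risingS mulrC.
Qed.

Lemma kummer_ge1 a c x : 0 <= a -> 0 < c -> 0 <= x -> 1 <= kummer a c x.
Proof.
move=> a0 c0 x0; have ek := @kcoef_entire a _ c0.
have -> : 1 = kcoef a c 0 * x ^+ 0.
  by rewrite /kcoef /rising !big_ord0 fact0 expr0 !mulr1 divr1.
have nn n : 0 <= kcoef a c n * x ^+ n.
  have ra : 0 <= rising a n by rewrite /rising; apply: prodr_ge0 => i _; rewrite addr_ge0.
  have rc := ltW (rising_gt0 n c0).
  by rewrite mulr_ge0 ?exprn_ge0// divr_ge0// mulr_ge0.
apply: (limr_ge (ek x)).
near=> n; rewrite /pseries /series /= (big_cat_nat _ (n := 1%N))//=; last by near: n; exists 1%N.
by rewrite big_nat1 lerDl sumr_ge0.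
Unshelve. all: by end_near. Qed.

Lemma kummer0 a c : kummer a c 0 = 1.
Proof.
apply: lim_near_cst => //; near=> m; rewrite -[m]prednK; last by near: m; exists 1%N.
rewrite /pseries /series /= big_nat_recl// big1 ?addr0; last first.
  by move=> i _; rewrite expr0n mulr0.
by rewrite /rising !big_ord0 fact0 expr0 !mulr1 divr1.
Unshelve. all: by end_near. Qed.

Lemma kummer_Cn k a c : 0 < c -> Cn k (kummer a c).
Proof.
elim: k a c => [|k ih] a c c0.
  by split=> // x; case: (kummer_isd a x c0).
apply: Cn_isd; first by move=> x; exact: kummer_isd.
by apply: CnM; [exact: Cn_cst|apply: ih; rewrite addr_gt0].
Qed.

Lemma expN_Cn k : Cn k (fun x : R => expR (- x)).
Proof.
have d (x : R) : is_derive x 1 (fun t : R => expR (- t)) (-1 * expR (- x)).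
  apply: isd_eq (isd_comp (isd_expR (- x)) (isdN (isd_id x))) _; ring.
elim: k => [|k ih]; first by split=> // x; case: (d x).
by apply: Cn_isd d _; apply: CnM => //; exact: Cn_cst.
Qed.

End kummer_series.

(** * Sign, uniqueness and integrability of smooth solutions of T y = 0 *)

Section kummer_solutions.
Context {R : realType}.
Local Notation lam := (@lebesgue_measure R).
Implicit Types (f g y w : R -> R) (x t mu a : R).

(** The equation is imposed on the whole line: at x = 0 it gives mu y'(0) = - a y(0), and it can be
    differentiated at every point. *)
Definition solution mu a y := smooth y /\
  forall x, x * y^`(2)%classic x + (x + mu) * y^`()%classic x + a * y x = 0.

Lemma smooth_derive1 y : smooth y -> smooth y^`()%classic.
Proof. by move=> sy n x; have := sy n.+1 x; rewrite derive1Sn. Qed.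

Lemma solution_TopA mu a y : solution mu a y -> forall x, TopA mu a (jet_of y) x = 0.
Proof. by move=> [_ ode] x; rewrite -[RHS](ode x) /TopA /jA /jB /=; ring. Qed.

Lemma solution_derive1 mu a y : solution mu a y -> solution (mu + 1) (a + 1) y^`()%classic.
Proof.
move=> [sy ode]; split; first exact: smooth_derive1.
move=> x.
have d0 : is_derive x 1 y (y^`()%classic x) := isd_derive1 (sy 0%N x).
have d1 : is_derive x 1 y^`()%classic (y^`(2)%classic x) := isd_derive1 (sy 1%N x).
have d2 : is_derive x 1 y^`(2)%classic (y^`()%classic^`(2)%classic x) := isd_derive1 (sy 2%N x).
have h := isdD (isdD (isdM (isd_id x) d2) (isdM (isdD (isd_id x) (isd_cst mu x)) d1))
  (isdM (isd_cst a x) d0).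
have e : (fun t => t * y^`(2)%classic t + (t + mu) * y^`()%classic t + a * y t) = fun=> 0.
  by apply/funext => t; exact: ode.
have e2 : y^`()%classic^`()%classic x = y^`(2)%classic x by [].
rewrite e in h; have := isd_val h; rewrite (isd_val (isd_cst 0 x)) e2.
move: (y^`()%classic^`(2)%classic x) (y^`(2)%classic x) (y^`()%classic x) (y x).
by clear => k3 k2 k1 k0 ->; ring.
Qed.

Lemma solution_scale mu a c y : solution mu a y -> solution mu a (fun x => c * y x).
Proof.
move=> [sy ode].
have e1 : (fun x => c * y x)^`()%classic = fun x => c * y^`()%classic x.
  by apply: derive1_fun => x; apply: isd_eq (isdM (isd_cst c x) (isd_derive1 (sy 0%N x))) _;
    rewrite mulr0 addr0.
have e2 : (fun x => c * y x)^`(2)%classic = fun x => c * y^`(2)%classic x.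
  rewrite [LHS]/= e1; apply: derive1_fun => x.
  by apply: isd_eq (isdM (isd_cst c x) (isd_derive1 (sy 1%N x))) _; rewrite mulr0 addr0.
split; last by move=> x; rewrite e1 e2 -[RHS](mulr0 c) -(ode x); ring.
apply/smooth_Cn => n; apply: CnM; first exact: Cn_cst.
by move: n; apply/smooth_Cn.
Qed.

Lemma locb_smooth y : smooth y -> forall n, locb (y^`(n))%classic.
Proof. by move=> sy n; apply: continuous_locb; exact: smooth_cont sy n. Qed.

(* The equation reads (e^x x^mu y')' = - a e^x x^(mu - 1) y. *)
Lemma solution_derive_lt0 mu a y : 0 < mu -> 0 < a -> solution mu a y ->
  (forall x, 0 <= x -> 0 < y x) -> forall x, 0 <= x -> y^`()%classic x < 0.
Proof.
move=> mu0 a0 [sy ode] yp x; rewrite le_eqVlt => /predU1P[<-|x0].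
  have := ode 0; rewrite mul0r !add0r => /eqP; rewrite addr_eq0 => /eqP e.
  have : mu * y^`()%classic 0 < 0 by rewrite e oppr_lt0 mulr_gt0 ?yp.
  by rewrite pmulr_rlt0.
pose h t := - (y^`()%classic t * expR t * t `^ mu).
pose dh t := a * y t * expR t * t `^ (mu - 1).
have hd t : 0 < t -> is_derive t 1 h (dh t).
  move=> t0; have d1 := isd_derive1 (sy 1%N t).
  apply: isd_eq (isdN (isdM (isdM d1 (isd_expR t)) (isd_powR mu t0))) _.
  have -> : dh t = - ((- (a * y t)) * expR t * t `^ (mu - 1)) by rewrite /dh; ring.
  have -> : - (a * y t) = t * y^`(2)%classic t + (t + mu) * y^`()%classic t.
    by apply/eqP; rewrite eq_sym -addr_eq0 ode.
  by rewrite (mul_weight mu t0) /=; ring.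
have dh0 t : 0 < t -> 0 < dh t.
  by move=> t0; rewrite /dh !mulr_gt0 ?expR_gt0 ?powR_gt0 ?yp// ltW.
have hc : h t @[t --> 0^'+] --> 0.
  have le : locb (fun t : R => expR t) by apply: continuous_locb => t; exact: isd_cont (isd_expR t).
  have [C hC] := locbM (locb_smooth sy 1) le 1.
  apply: (@bounded_powR_cvg0 _ mu C h) => // t t0 t1.
  by rewrite /h normrN normrM (ger0_norm (powR_ge0 _ _)) ler_wpM2r ?powR_ge0 ?hC.
have hx2 : 0 <= h (x / 2).
  apply: (@nondecreasing_at0_ge0 _ h x) => //; last 2 first.
  - by rewrite divr_gt0.
  - by rewrite ler_pdivrMr// mulr_natr mulr2n lerDl ltW.
  move=> s t s0 st _; apply: (isd_mono (f := h) (df := dh)) => // z /andP[sz _].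
    exact/hd/(lt_le_trans s0).
  by apply/ltW/dh0; exact: lt_trans sz.
have : h (x / 2) < h x.
  have xx : x / 2 < x by rewrite ltr_pdivrMr// mulr_natr mulr2n ltrDl.
  apply: (isd_mono_lt (f := h) (df := dh)) => // z /andP[xz _].
    by apply/hd; apply: lt_le_trans xz; rewrite divr_gt0.
  by apply/dh0; apply: lt_trans xz; rewrite divr_gt0.
move/(le_lt_trans hx2); rewrite /h oppr_gt0 -mulrA pmulr_llt0//.
by rewrite mulr_gt0 ?expR_gt0 ?powR_gt0.
Qed.

Lemma solution_kernel mu a y : solution (mu + 1) (a + 1) y ->
  (forall x, 0 <= x -> y x != 0) -> kernel mu a (jet_of y).
Proof.
move=> [sy ode] y0; split; first exact: smooth_reg.
- by move=> x _; rewrite -[RHS](ode x) /Wop /jA /=; ring.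
move=> M; have [M0|M0] := leP M 0.
  by exists 1 => // x x0 xM; move: (lt_le_trans x0 xM); rewrite ltNge M0.
have [|c cM hc] := @EVT_max R (fun x => - `|y x|) 0 M (ltW M0).
  by apply: continuous_subspaceT => x; apply: cvgN; apply: cvg_norm; exact: smooth_cont sy 0%N x.
exists `|y c|; first by rewrite normr_gt0 y0//; move: cM; rewrite in_itv/= => /andP[].
by move=> x x0 xM; rewrite -lerN2; apply: hc; rewrite in_itv/= (ltW x0).
Qed.

(* The Wronskian times e^x x^mu is constant, and tends to 0 at 0. *)
Lemma solution_unique mu a y w : 0 < mu -> solution mu a y -> solution mu a w ->
  (forall x, 0 <= x -> 0 < y x) -> y 0 = w 0 -> forall x, 0 < x -> w x = y x.
Proof.
move=> mu0 [sy oy] [sw ow] yp y0 x x0.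
pose W t := (y t * w^`()%classic t - w t * y^`()%classic t) * expR t * t `^ mu.
have W0 t : 0 < t -> W t = 0.
  move=> t0; apply: (@isd0_cst _ W (t + 1)) => //; last by rewrite ltrDl.
    move=> z z0 _.
    have dy0 : is_derive z 1 y (y^`()%classic z) := isd_derive1 (sy 0%N z).
    have dw0 : is_derive z 1 w (w^`()%classic z) := isd_derive1 (sw 0%N z).
    have dy1 : is_derive z 1 y^`()%classic (y^`(2)%classic z) := isd_derive1 (sy 1%N z).
    have dw1 : is_derive z 1 w^`()%classic (w^`(2)%classic z) := isd_derive1 (sw 1%N z).
    apply: isd_eq (isdM (isdM (isdD (isdM dy0 dw1) (isdN (isdM dw0 dy1))) (isd_expR z)) (isd_powR mu z0)) _.
    rewrite (mul_weight mu z0).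
    transitivity (expR z * z `^ (mu - 1) * (y z * (z * w^`(2)%classic z + (z + mu) * w^`()%classic z + a * w z)
      - w z * (z * y^`(2)%classic z + (z + mu) * y^`()%classic z + a * y z))).
      move: (y^`(2)%classic z) (w^`(2)%classic z) (y^`()%classic z) (w^`()%classic z) (y z) (w z)
        (expR z) (z `^ (mu - 1)).
      by clear => p1 p2 p3 p4 p5 p6 p7 p8; ring.
    by rewrite oy ow !mulr0 subrr mulr0.
  have le : locb (fun t : R => expR t) by apply: continuous_locb => z; exact: isd_cont (isd_expR z).
  have [C hC] := locbM (locbD (locbM (locb_smooth sy 0) (locb_smooth sw 1))
     (locbN (locbM (locb_smooth sw 0) (locb_smooth sy 1)))) le 1.
  apply: (@bounded_powR_cvg0 _ mu C W) => // z z0 z1.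
  by rewrite /W normrM (ger0_norm (powR_ge0 _ _)) ler_wpM2r ?powR_ge0 ?hC.
have cq : {for 0, continuous (fun t => w t * (y t)^-1)}.
  apply: cvgM; first exact: smooth_cont sw 0%N 0.
  by apply: cvgV; [rewrite gt_eqF// yp|exact: smooth_cont sy 0%N 0].
have := @isd0_cst _ (fun t => w t * (y t)^-1) (x + 1) 1 _ _ x x0.
rewrite ltrDl => /(_ _ _ ltr01) h.
suff : w x * (y x)^-1 = 1 by move/(canRL (divfK _)) => ->; rewrite ?mul1r// gt_eqF// yp// ltW.
apply: h.
- move=> z z0 _; have yz : y z != 0 by rewrite gt_eqF// yp// ltW.
  apply: isd_eq (isdM (isd_derive1 (sw 0%N z)) (isdV yz (isd_derive1 (sy 0%N z)))) _.
  have := W0 z z0; rewrite /W => /eqP; rewrite -mulrA mulf_eq0.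
  rewrite [X in _ || X]gt_eqF ?mulr_gt0 ?expR_gt0 ?powR_gt0// orbF => /eqP e.
  transitivity ((y z)^-1 ^+ 2 * (y z * w^`()%classic z - w z * y^`()%classic z)).
    by rewrite /=; field.
  by rewrite e mulr0.
- have := cq; rewrite /prop_for /continuous_at -y0 divff ?gt_eqF ?yp//.
  exact: cvg_at_right_filter.
Qed.

Lemma integrable_glue f (X : R) : 0 < X -> cpos f ->
  lam.-integrable `]0, X] (EFin \o f) -> lam.-integrable `[X, +oo[ (EFin \o f) ->
  lam.-integrable half_line (EFin \o f).
Proof.
move=> X0 cf i1 i2.
have sub1 : `]0, X] `<=` half_line.
  by move=> x /=; rewrite in_itv/= => /andP[? _]; apply/half_lineP.
have sub2 : `[X, +oo[ `<=` half_line.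
  by move=> x /=; rewrite in_itv/= => /andP[? _]; apply/half_lineP; exact: lt_le_trans X0 _.
have mh : measurable (@half_line R) by exact: measurable_itv.
have mi : measurable `]0, X] by exact: measurable_itv.
have mj : measurable `[X, +oo[ by exact: measurable_itv.
pose h1 := (EFin \o f) \_ `]0, X]; pose h2 := (EFin \o f) \_ `[X, +oo[.
have j1 : lam.-integrable half_line h1.
  apply/(@integrable_restrict _ (measurableTypeR R) R lam _ mi _ mh (EFin \o f)).
  by rewrite (setIidr sub1).
have j2 : lam.-integrable half_line h2.
  apply/(@integrable_restrict _ (measurableTypeR R) R lam _ mj _ mh (EFin \o f)).
  by rewrite (setIidr sub2).
have j : lam.-integrable half_line (fun x => `|h1 x| + `|h2 x|)%E.
  by apply: integrableD (integrable_abse j1) (integrable_abse j2); exact: measurable_itv.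
apply: le_integrable j; first exact: measurable_itv.
  by apply/measurable_EFinP; exact: cpos_measurable.
move=> x /half_lineP x0; rewrite [leRHS]gee0_abs ?adde_ge0//.
have [xX|Xx] := leP x X.
  have -> : h1 x = (f x)%:E by rewrite /h1 patchE mem_set//= in_itv/= x0.
  by rewrite leeDl.
have -> : h2 x = (f x)%:E by rewrite /h2 patchE mem_set//= in_itv/= (ltW Xx).
by rewrite leeDr.
Qed.

Lemma L2_glue mu u (X : R) : 0 < mu -> 0 < X -> cpos u -> locb u ->
  lam.-integrable `[X, +oo[ (EFin \o (fun x => u x ^+ 2 * x `^ (mu - 1))) -> L2 mu u.
Proof.
move=> mu0 X0 cu lu i2; split; first exact: cpos_measurable.
have cw : cpos (fun x => u x ^+ 2 * x `^ (mu - 1)).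
  by apply: cposM; [apply: cposM|exact: cpos_powR].
apply: integrable_glue i2 => //.
have [C hC] := locbM lu lu X.
have i0 := integrable_powR_at0 X mu0.
have i1 : lam.-integrable `]0, X] (EFin \o (fun x => C * x `^ (mu - 1))).
  by apply: (integrableZl _ C i0); exact: measurable_itv.
apply: le_integrable i1; first exact: measurable_itv.
  apply/measurable_EFinP; apply: cposS => //.
  by move=> x /=; rewrite in_itv/= => /andP[? _]; apply/half_lineP.
move=> x /=; rewrite in_itv/= => /andP[x0 xM].
rewrite lee_fin !normrM (ger0_norm (powR_ge0 _ _)) ler_wpM2r ?powR_ge0//.
by rewrite -normrM (le_trans (hC _ x0 xM))// ler_norm.
Qed.

Lemma energy_arith (x p q a lambda m : R) : 1 <= x -> 2 * (lambda - (m - 1) / 2) <= x ->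
  (x * p) ^+ 2 / 2 + q ^+ 2 <= (x * p) ^+ 2 + q ^+ 2 - (lambda - (m - 1) / 2) * x * p ^+ 2.
Proof.
move=> x1 h; have p2 : 0 <= p ^+ 2 by exact: sqr_ge0.
have : (lambda - (m - 1) / 2) * (x * p ^+ 2) <= x / 2 * (x * p ^+ 2).
  by apply: ler_wpM2r; [rewrite mulr_ge0//; lra|lra].
have -> : x / 2 * (x * p ^+ 2) = (x * p) ^+ 2 / 2 by field.
by rewrite mulrA; move: ((x * p) ^+ 2) => P; lra.
Qed.

(** Solutions decay in general like x^(-a), so square integrability for x^(mu-1) dx asks for 2 a >
    mu. The energy [E] replaces asymptotics: x y'^2 + a y^2 comes from multiplying the equation by
    y', and the part with [la] from multiplying it by y. The latter brings y^2 into E' with the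
    factor - la (a - mu / 2), negative for the same reason. *)
Lemma solution_inD mu a y : 0 < mu -> mu / 2 < a -> solution mu a y -> inD mu (jet_of y).
Proof.
move=> mu0 amu sol; have [sy ode] := sol.
have ry := smooth_reg sy; have a0 : 0 < a by rewrite (lt_trans _ amu)// divr_gt0.
have s0 : 2 * a - mu != 0 by rewrite gt_eqF// subr_gt0 mulrC -ltr_pdivrMr.
have sp : 0 < 2 * a - mu by rewrite subr_gt0 mulrC -ltr_pdivrMr.
(* [la] makes the coefficient of y^2 in E' = - g equal to -1. Since g and E are
   nonnegative near +oo, g is integrable there. *)
pose la := (a * mu + 2) / (2 * a - mu).
have la0 : 0 < la by rewrite divr_gt0// addr_gt0// mulr_gt0.
pose y1 := y^`()%classic; pose y2 := y^`(2)%classic.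
pose E x := (x * (y1 x * y1 x) / 2 + a / 2 * (y x * y x)
  + la * (y x * y x / 2 + y x * y1 x)) * x `^ mu.
pose g x := ((x * y1 x) ^+ 2 + y x ^+ 2 - (la - (mu - 1) / 2) * x * y1 x ^+ 2) * x `^ (mu - 1).
have dE x : 0 < x -> is_derive x 1 E (- g x).
  move=> x0.
  have d0 : is_derive x 1 y (y1 x) := isd_derive1 (sy 0%N x).
  have d1 : is_derive x 1 y1 (y2 x) := isd_derive1 (sy 1%N x).
  have dq : is_derive x 1 (fun x => x * (y1 x * y1 x) / 2 + a / 2 * (y x * y x)
     + la * (y x * y x / 2 + y x * y1 x)) (y1 x * y1 x / 2 + y1 x * (x * y2 x)
      + a * (y x * y1 x) + la * (y x * y1 x + y1 x * y1 x + y x * y2 x)).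
    by eapply isd_eq; [solve_isd|rewrite /GRing.scale /=; field].
  apply: isd_eq (isdM dq (isd_powR mu x0)) _.
  rewrite /g (mul_weight mu x0); have e : x * y2 x = - ((x + mu) * y1 x + a * y x).
    by apply/eqP; rewrite -addr_eq0 addrA ode.
  transitivity (x `^ (mu - 1) * ((x * (y1 x * y1 x) / 2 + a / 2 * (y x * y x)
     + la * (y x * y x / 2 + y x * y1 x)) * mu + (x * y1 x * y1 x / 2 + x * y1 x * (x * y2 x)
      + a * (x * y x * y1 x) + la * (x * y x * y1 x + x * y1 x * y1 x + y x * (x * y2 x))))).
    by ring.
  by rewrite e /la; field.
(* Past [X] three things hold: |y'| <= |x y'|; [E] is a sum of nonnegative squares because x >= la;
   and half of (x y')^2 absorbs the remaining term of [g]. *)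
pose X := Num.max 1 (Num.max la (2 * (la - (mu - 1) / 2))).
have X1 : 1 <= X by rewrite le_max lexx.
have X0 : 0 < X by rewrite (lt_le_trans ltr01).
have Xg x : X <= x -> ((x * y1 x) ^+ 2 / 2 + y x ^+ 2) * x `^ (mu - 1) <= g x.
  move=> Xx; rewrite ler_wpM2r ?powR_ge0//; apply: energy_arith => //.
    exact: le_trans Xx.
  by apply: le_trans Xx; rewrite !le_max lexx !orbT.
have cy0 := reg_c0 ry; have cy1 := reg_c1 ry; have cyA := reg_cA ry.
have cg : cpos g.
  apply: cposM; last exact: cpos_powR.
  apply: (@cpos_near _ (fun x => x * y1 x * (x * y1 x) + y x * y x + - ((la - (mu - 1) / 2) * x * (y1 x * y1 x)))).
    by move=> x _; rewrite !expr2.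
  by solve_cpos.
have h0 x : 0 <= (x * y1 x) ^+ 2 by exact: sqr_ge0.
have h1 x : 0 <= y x ^+ 2 by exact: sqr_ge0.
have h2 x : 0 <= (x * y1 x) ^+ 2 / 2 by rewrite mulr_ge0.
have g0 x : X <= x -> 0 <= g x.
  by move=> Xx; apply: le_trans (Xg x Xx); rewrite mulr_ge0 ?powR_ge0// addr_ge0.
have E0 x : X <= x -> 0 <= E x.
  move=> Xx; rewrite mulr_ge0 ?powR_ge0//.
  have lx : la <= x by apply: le_trans Xx; rewrite !le_max lexx !orbT.
  have -> : x * (y1 x * y1 x) / 2 + a / 2 * (y x * y x) + la * (y x * y x / 2 + y x * y1 x) =
     (x - la) / 2 * y1 x ^+ 2 + a / 2 * y x ^+ 2 + la / 2 * (y x + y1 x) ^+ 2 by field.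
  by rewrite !addr_ge0// mulr_ge0 ?sqr_ge0// divr_ge0// ?subr_ge0// ltW.
have ig := integrable_tail X0 cg dE g0 E0.
have mono f C : cpos f -> (forall x, X <= x -> f x ^+ 2 * x `^ (mu - 1) <= C * g x) ->
    lam.-integrable `[X, +oo[ (EFin \o (fun x => f x ^+ 2 * x `^ (mu - 1))).
  move=> cf fg.
  have iCg : lam.-integrable `[X, +oo[ (EFin \o (fun x => C * g x)).
    by apply: (integrableZl _ C ig); exact: measurable_itv.
  apply: le_integrable iCg; first exact: measurable_itv.
    apply/measurable_EFinP; apply: cposS => //.
      by apply: cposM; [exact: cposM|exact: cpos_powR].
    by move=> x /=; rewrite in_itv/= => /andP[? _]; apply/half_lineP; exact: lt_le_trans X0 _.
  move=> x /=; rewrite in_itv/= => /andP[Xx _].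
  rewrite lee_fin ger0_norm; last by rewrite mulr_ge0 ?sqr_ge0 ?powR_ge0.
  by rewrite (le_trans (fg x Xx))// ler_norm.
have wB x : X <= x -> (x * y1 x) ^+ 2 * x `^ (mu - 1) <= 2 * g x.
  move=> Xx; rewrite -ler_pdivrMl// (le_trans _ (Xg x Xx))// mulrA.
  by rewrite ler_wpM2r ?powR_ge0// mulrC lerDl.
have hB : L2 mu (jB (jet_of y)).
  apply: (@L2_glue _ _ X) => //.
  - exact: cposM (@cpos_id _) _.
  - exact: locbM (@locb_id _) (reg_b1 ry).
  - by apply: (mono _ 2) => //; exact: cposM (@cpos_id _) _.
have hC : L2 mu (j1 (jet_of y)).
  apply: (@L2_glue _ _ X) => //; first exact: reg_b1 ry.
  apply: (mono _ 2) => // x Xx; apply: le_trans (wB x Xx).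
  rewrite ler_wpM2r ?powR_ge0// exprMn ler_peMl ?sqr_ge0//.
  by rewrite exprn_ege1// (le_trans X1).
have hD : L2 mu (j0 (jet_of y)).
  apply: (@L2_glue _ _ X) => //; first exact: reg_b0 ry.
  apply: (mono _ 1) => // x Xx; rewrite mul1r (le_trans _ (Xg x Xx))//.
  by rewrite ler_wpM2r ?powR_ge0// lerDr.
split=> //.
have h := L2N (L2D (L2D hB (L2Z mu hC)) (L2Z a hD)).
apply: (eq_rect _ (L2 mu) h); apply/funext => x; apply/eqP; rewrite eq_sym -addr_eq0; apply/eqP.
by rewrite -[RHS](solution_TopA sol x) /TopA; ring.
Qed.

End kummer_solutions.

(** * The functions f0 and f1 *)

Section kummer_extremals.
Context {R : realType}.
Implicit Types (f g y w : R -> R) (x t mu a b c eps : R).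

Lemma solution_expN_kummer mu b : 0 < mu ->
  solution mu (mu - b) (fun x => expR (- x) * kummer b mu x).
Proof.
move=> mu0; have mu1 : 0 < mu + 1 by rewrite addr_gt0.
pose w := kummer b mu; pose w1 x := b / mu * kummer (b + 1) (mu + 1) x.
pose w2 x := b / mu * ((b + 1) / (mu + 1) * kummer (b + 1 + 1) (mu + 1 + 1) x).
have dw x : is_derive x 1 w (w1 x) by exact: kummer_isd.
have dw1 x : is_derive x 1 w1 (w2 x).
  apply: isd_eq (isdM (isd_cst (b / mu) x) (kummer_isd (b + 1) x mu1)) _.
  by rewrite mulr0 addr0.
have de x : is_derive x 1 (fun t => expR (- t)) (- expR (- x)).
  apply: isd_eq (isd_comp (isd_expR (- x)) (isdN (isd_id x))) _.
  by rewrite mulrN1.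
have d1 : (fun x => expR (- x) * w x)^`()%classic = fun x => expR (- x) * (w1 x + - w x).
  by apply: derive1_fun => x; apply: isd_eq (isdM (de x) (dw x)) _; rewrite /w /w1; ring.
have d2 : (fun x => expR (- x) * w x)^`(2)%classic =
    fun x => expR (- x) * (w2 x - w1 x) - expR (- x) * (w1 x - w x).
  rewrite [LHS]/= d1; apply: derive1_fun => x.
  apply: isd_eq (isdM (de x) (isdD (dw1 x) (isdN (dw x)))) _.
  by rewrite /w /w1 /w2; ring.
split.
  by apply/smooth_Cn => n; apply: CnM; [exact: expN_Cn|exact: kummer_Cn].
move=> x; rewrite d2 d1.
transitivity (expR (- x) * (x * w2 x + (mu - x) * w1 x - b * w x)); first by rewrite /w; ring.
by rewrite [X in _ * X]kummer_ode// mulr0.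
Qed.

Lemma isd_opp g x (d : R) : is_derive (- x) 1 g d -> is_derive x 1 (fun t => g (- t)) (- d).
Proof.
by move=> h; apply: isd_eq (isd_comp h (isdN (isd_id x))) _; rewrite mulrN1.
Qed.

Lemma solution_kummerN mu a : 0 < mu -> solution mu a (fun x => kummer a mu (- x)).
Proof.
move=> mu0; have mu1 : 0 < mu + 1 by rewrite addr_gt0.
pose w := kummer a mu; pose w1 x := a / mu * kummer (a + 1) (mu + 1) x.
pose w2 x := a / mu * ((a + 1) / (mu + 1) * kummer (a + 1 + 1) (mu + 1 + 1) x).
have d1 : (fun x => w (- x))^`()%classic = fun x => - w1 (- x).
  by apply: derive1_fun => x; apply: isd_opp; exact: kummer_isd.
have d2 : (fun x => w (- x))^`(2)%classic = fun x => w2 (- x).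
  rewrite [LHS]/= d1; apply: derive1_fun => x; rewrite -[w2 _]opprK.
  apply: isdN; apply: isd_opp.
  apply: isd_eq (isdM (isd_cst (a / mu) _) (kummer_isd (a + 1) _ mu1)) _.
  by rewrite mulr0 addr0.
split.
  apply/smooth_Cn => n.
  rewrite (_ : (fun x => _) = fun x => kummer a mu (-1 * x + 0)).
    by apply: (@Cn_affine _ n (kummer a mu)); exact: kummer_Cn.
  by apply/funext => x; rewrite mulN1r addr0.
move=> x; rewrite d2 d1.
transitivity (- (- x * w2 (- x) + (mu - - x) * w1 (- x) - a * w (- x))); first by rewrite /w; ring.
by rewrite [X in - X]kummer_ode// oppr0.
Qed.

Lemma smooth_lin c d f g : smooth f -> smooth g -> smooth (fun x => c * f x + d * g x).
Proof.
move=> /smooth_Cn sf /smooth_Cn sg; apply/smooth_Cn => n.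
by apply: CnD; apply: CnM => //; exact: Cn_cst.
Qed.

Lemma jet_of_lin c d f g : smooth f -> smooth g ->
  jet_of (fun x => c * f x + d * g x) = jadd (jscale c (jet_of f)) (jscale d (jet_of g)).
Proof.
move=> sf sg.
have key u v : (forall x, derivable u x 1) -> (forall x, derivable v x 1) ->
    (fun x => c * u x + d * v x)^`()%classic = fun x => c * u^`()%classic x + d * v^`()%classic x.
  move=> du dv; apply: derive1_fun => x.
  apply: isd_eq (isdD (isdM (isd_cst c x) (isd_derive1 (du x)))
    (isdM (isd_cst d x) (isd_derive1 (dv x)))) _.
  by rewrite !mulr0 !addr0.
rewrite /jet_of /jadd /jscale /=; congr Jet; first exact: key (sf 0%N) (sg 0%N).
by rewrite (key f g (sf 0%N) (sg 0%N)) (key _ _ (sf 1%N) (sg 1%N)).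
Qed.

Lemma f0_solution mu eps : 0 < mu -> solution mu (mu - bpar mu eps) (f0 mu eps).
Proof. exact: solution_expN_kummer. Qed.

Lemma f0_gt0 mu eps x : 0 < mu -> 0 <= bpar mu eps -> 0 <= x -> 0 < f0 mu eps x.
Proof.
by move=> mu0 b0 x0; rewrite mulr_gt0 ?expR_gt0// (lt_le_trans ltr01)// kummer_ge1.
Qed.

Lemma f0_0 mu eps : f0 mu eps 0 = 1.
Proof. by rewrite /f0 oppr0 expR0 mul1r kummer0. Qed.

(** Kummer's transformation: both sides solve the same equation and equal 1 at 0, so uniqueness of
    the regular solution applies. *)
Lemma f0_kummerN mu eps x : 0 < mu -> 0 <= bpar mu eps -> 0 <= x ->
  kummer (mu - bpar mu eps) mu (- x) = f0 mu eps x.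
Proof.
move=> mu0 b0; rewrite le_eqVlt => /predU1P[<-|x0]; first by rewrite oppr0 f0_0 kummer0.
apply: (solution_unique mu0 (f0_solution eps mu0) (solution_kummerN (mu - bpar mu eps) mu0)) => //.
  by move=> t t0; exact: f0_gt0.
by rewrite f0_0 oppr0 kummer0.
Qed.

(** By contiguity the first Kummer function in f1, with its factor, is (a + x d/dx) f0 for a = mu -
    b, and a - (mu - 2 b + 1) / 2 = (mu - 1) / 2. *)
Lemma f1E mu eps x : 0 < mu -> 0 <= bpar mu eps -> 0 <= x ->
  f1 mu eps x = x * (f0 mu eps)^`()%classic x + (mu - 1) / 2 * f0 mu eps x.
Proof.
move=> mu0 b0 x0; pose a := mu - bpar mu eps.
rewrite /f1 -/a kummer_contiguous// f0_kummerN//.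
have -> : - x * (a / mu * kummer (a + 1) (mu + 1) (- x)) = x * (f0 mu eps)^`()%classic x.
  move: x0; rewrite le_eqVlt => /predU1P[<-|x0]; first by rewrite oppr0 !mul0r.
  have d := isd_opp (@kummer_isd _ a mu (- x) mu0).
  rewrite (isd_val (isd_pos x0 _ d)); first by ring.
  by move=> t t0; rewrite f0_kummerN// ltW.
by rewrite /a; field.
Qed.

Lemma f1_lin mu eps : f1 mu eps = fun x =>
  (mu - bpar mu eps) * kummer (mu - bpar mu eps + 1) mu (- x)
  + - ((mu - 2 * bpar mu eps + 1) / 2) * kummer (mu - bpar mu eps) mu (- x).
Proof. by apply/funext => x; rewrite mulNr. Qed.

Lemma f1_smooth mu eps : 0 < mu -> smooth (f1 mu eps).
Proof.
move=> mu0; rewrite f1_lin.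
by apply: smooth_lin; [exact: (solution_kummerN _ mu0).1|exact: (solution_kummerN _ mu0).1].
Qed.

Lemma f1_inD mu eps : 0 < mu -> mu / 2 < mu - bpar mu eps -> inD mu (jet_of (f1 mu eps)).
Proof.
move=> mu0 a0; have s1 := solution_kummerN (mu - bpar mu eps) mu0.
have s2 := solution_kummerN (mu - bpar mu eps + 1) mu0.
rewrite f1_lin (jet_of_lin _ _ s2.1 s1.1); apply: inD_add; apply: inD_scale.
  by apply: solution_inD s2 => //; rewrite (lt_trans a0)// ltrDl.
exact: solution_inD s1.
Qed.

Lemma f1_derive mu eps x : 0 < mu -> 0 <= bpar mu eps -> 0 < x ->
  (f1 mu eps)^`()%classic x =
    x * (f0 mu eps)^`(2)%classic x + (mu + 1) / 2 * (f0 mu eps)^`()%classic x.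
Proof.
move=> mu0 b0 x0; have [s0 _] := f0_solution eps mu0; have [d0 d1] := (s0 0%N x, s0 1%N x).
have d := isdD (isdM (isd_id x) (isd_derive1 d1)) (isdM (isd_cst ((mu - 1) / 2) x) (isd_derive1 d0)).
rewrite (isd_val (isd_pos x0 _ d)); last by move=> t t0; rewrite f1E// ltW.
by rewrite /=; field.
Qed.

Lemma f1_derive2 mu eps x : 0 < mu -> 0 <= bpar mu eps -> 0 < x ->
  (f1 mu eps)^`(2)%classic x =
    x * (f0 mu eps)^`()%classic^`(2)%classic x + (mu + 3) / 2 * (f0 mu eps)^`(2)%classic x.
Proof.
move=> mu0 b0 x0; have [s0 _] := f0_solution eps mu0.
have d1 : is_derive x 1 (f0 mu eps)^`()%classic ((f0 mu eps)^`(2)%classic x) := isd_derive1 (s0 1%N x).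
have d2 : is_derive x 1 (f0 mu eps)^`(2)%classic ((f0 mu eps)^`()%classic^`(2)%classic x) :=
  isd_derive1 (s0 2%N x).
have d := isdD (isdM (isd_id x) d2) (isdM (isd_cst ((mu + 1) / 2) x) d1).
rewrite [LHS]/= (isd_val (isd_pos x0 _ d)); last by move=> t t0; rewrite f1_derive.
move: ((f0 mu eps)^`()%classic^`(2)%classic x) ((f0 mu eps)^`(2)%classic x) ((f0 mu eps)^`()%classic x).
by clear => p q r; field.
Qed.

End kummer_extremals.

(** * From the constrained inequality to the unconstrained one *)

Section extremal_consequences.
Context {R : realType}.
Implicit Types (F G H : jet R) (x c : R).

(** Reduces scaling to sums F + c G, the only combination for which the forms have been expanded. *)
Lemma jscaleE c F : jscale c F = jadd F (jscale (c - 1) F).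
Proof.
by rewrite /jadd /jscale /=; congr Jet; apply/funext => x /=; ring.
Qed.

Lemma jadd_sub F G : F = jadd G (jscale 1 (jsub F G)).
Proof.
case: F => f0 f1 f2; rewrite /jadd /jscale /jsub /=.
by congr Jet; apply/funext => x /=; ring.
Qed.

Variables (mu a : R).

Lemma D_eqE F G : inD mu F -> inD mu G -> D_eq mu F G <-> Dsq mu (jsub F G) = 0.
Proof.
move=> hF hG; rewrite /D_eq (D_normsqE (inD_sub hF hG)).
by split=> [[]|->].
Qed.

Lemma Dsq_sub_eq0 F G : inD mu F -> inD mu G -> Dsq mu (jsub F G) = 0 ->
  [/\ normT mu a F = normT mu a G, P0 mu F = P0 mu G &
      forall H, inD mu H -> PP mu F H = PP mu G H].
Proof.
move=> hF hG e; have hN := inD_sub hF hG.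
have [pN tN] := P0_Dsq a hN e.
have PN H : inD mu H -> PP mu (jsub F G) H = 0.
  move=> hH; apply: ip_eq0 (inD_B hN) (inD_C hH) _.
  move: e; rewrite /Dsq; have := ip_ge0 mu (jA (jsub F G)); have := ip_ge0 mu (jB (jsub F G)).
  have := ip_ge0 mu (j1 (jsub F G)); have := ip_ge0 mu (j0 (jsub F G)).
  by clear; lra.
rewrite (jadd_sub F G); split.
- rewrite normT_lin// tN /TT ipC (ip_eq0 (L2_TopA a hN) (L2_TopA a hG) tN).
  by rewrite !mulr0 !addr0.
- by rewrite P0_lin// pN PPC PN// !mulr0 !addr0.
- by move=> H hH; rewrite PP_linl// PN// mulr0 addr0.
Qed.

Variables F0 F1 : jet R.
Hypotheses (dF0 : Dlim mu nice F0) (dF1 : Dlim mu nice F1).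
Hypotheses (T0 : forall F, inD mu F -> TT mu a F F0 = 0)
  (gap : forall F, Dlim mu nice F -> PP mu F F0 = 0 -> 2 * P0 mu F <= normT mu a F)
  (o1 : PP mu F1 F0 = 0) (n1 : normT mu a F1 = 2 * P0 mu F1)
  (p0 : 0 < P0 mu F0)
  (ext : forall F, Dlim mu nice F -> PP mu F F0 = 0 -> normT mu a F = 2 * P0 mu F ->
    exists c, Dsq mu (jadd F (jscale (- c) F1)) = 0).

Let hF0 := dF0.1.
Let hF1 := dF1.1.

Lemma normT_F0 : normT mu a F0 = 0.
Proof. exact: T0. Qed.

Lemma P0_scale c F : inD mu F -> P0 mu (jscale c F) = c ^+ 2 * P0 mu F.
Proof. by move=> hF; rewrite jscaleE P0_lin// -[PP mu F F]/(P0 mu F); ring. Qed.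

Lemma PP_scale c F G : inD mu F -> inD mu G -> PP mu (jscale c F) G = c * PP mu F G.
Proof. by move=> hF hG; rewrite jscaleE PP_linl//; ring. Qed.

Lemma normT_scale c F : inD mu F -> normT mu a (jscale c F) = c ^+ 2 * normT mu a F.
Proof. by move=> hF; rewrite jscaleE normT_lin// -[TT mu a F F]/(normT mu a F); ring. Qed.

Lemma extremal_iff F : Dlim mu nice F -> PP mu F F0 = 0 ->
  normT mu a F = 2 * P0 mu F <-> exists c, D_eq mu F (jscale c F1).
Proof.
move=> dF oF; have hF := dF.1; split=> [e|[c]].
  have [c ec] := ext dF oF e; exists c; apply/D_eqE => //; first exact: inD_scale.
  rewrite -ec jsubE; congr (Dsq mu _); rewrite /jadd /jscale /=.
  by congr Jet; apply/funext => x /=; ring.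
have hc := inD_scale c hF1.
move=> /(D_eqE hF hc) /(Dsq_sub_eq0 hF hc)[-> -> _].
by rewrite normT_scale// P0_scale// n1; ring.
Qed.

Lemma P0_shift_F0 c F : inD mu F ->
  P0 mu (jadd F (jscale (- c) F0)) = P0 mu F - 2 * c * PP mu F F0 + c ^+ 2 * P0 mu F0.
Proof. by move=> hF; rewrite P0_lin//; ring. Qed.

Definition bracket F := P0 mu F - PP mu F F0 ^+ 2 / P0 mu F0.

Lemma inf_bracket F : inD mu F ->
  inf [set P0 mu (jadd F (jscale (- C) F0)) | C in [set: R]] = bracket F.
Proof.
move=> hF; set S := [set _ | _ in _].
have ne : S !=set0 by exists (P0 mu (jadd F (jscale (- 0) F0))); exists 0.
have lb : lbound S (bracket F).
  move=> _ [C _ <-]; rewrite P0_shift_F0// -subr_ge0.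
  have -> : P0 mu F - 2 * C * PP mu F F0 + C ^+ 2 * P0 mu F0 - bracket F =
    P0 mu F0 * (C - PP mu F F0 / P0 mu F0) ^+ 2 by rewrite /bracket; field; rewrite gt_eqF.
  by rewrite mulr_ge0 ?sqr_ge0// ltW.
apply/eqP; rewrite eq_le; apply/andP; split; last exact: lb_le_inf.
apply: ge_inf; first by exists (bracket F).
exists (PP mu F F0 / P0 mu F0) => //; rewrite P0_shift_F0// /bracket.
by field; rewrite gt_eqF.
Qed.

(** As T F0 = 0, removing the component along F0 leaves |T F|^2 unchanged, while it lowers P0 to its
    minimum over the multiples of F0. This makes the constrained and unconstrained inequalities
    equivalent. *)
Lemma project_F0 F : Dlim mu nice F -> exists c, let G := jadd F (jscale (- c) F0) in
  [/\ Dlim mu nice G, PP mu G F0 = 0, normT mu a G = normT mu a F & P0 mu G = bracket F].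
Proof.
move=> dF; have hF := dF.1; exists (PP mu F F0 / P0 mu F0) => G; split.
- exact: Dlim_lin (@nice_lin R) _ _ _ dF dF0.
- by rewrite PP_linl// -[PP mu F0 F0]/(P0 mu F0); field; rewrite gt_eqF.
- by rewrite normT_lin// T0// normT_F0 !mulr0 !addr0.
- by rewrite P0_shift_F0// /bracket; field; rewrite gt_eqF.
Qed.

Lemma bracket_le F : Dlim mu nice F -> 2 * bracket F <= normT mu a F.
Proof. by move=> /project_F0[c [dG oG <- <-]]; exact: gap. Qed.

Lemma bracket_iff F : Dlim mu nice F -> normT mu a F = 2 * bracket F <->
  exists c0 c1, D_eq mu F (jadd (jscale c0 F0) (jscale c1 F1)).
Proof.
move=> dF; have hF := dF.1; split=> [|[c0 [c1]]].
  have [c [dG oG <- <-]] := project_F0 dF => e.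
  have [c1 ec] := ext dG oG e; exists c, c1; apply/D_eqE => //.
    by apply: inD_add; exact: inD_scale.
  rewrite -ec; congr (Dsq mu _); rewrite /jsub /jadd /jscale /=.
  by congr Jet; apply/funext => x /=; ring.
have h0 := inD_scale c0 hF0; have hc := inD_lin c1 h0 hF1.
move=> /(D_eqE hF hc) /(Dsq_sub_eq0 hF hc)[eT eP ePP].
rewrite /bracket eT eP ePP// normT_lin// P0_lin// PP_linl// normT_scale// P0_scale//.
rewrite !PP_scale// (PPC mu F0 F1) o1 normT_F0 n1.
have -> : TT mu a (jscale c0 F0) F1 = 0.
  by rewrite jscaleE TT_linl// [TT _ _ F0 F1]ipC -[ip _ _ _]/(TT mu a F1 F0) T0// mulr0 addr0.
by rewrite -[PP mu F0 F0]/(P0 mu F0); field; rewrite gt_eqF.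
Qed.

End extremal_consequences.

(** * The parameters b and a = mu - b, and the hypotheses for f0 and f1 *)

Section parameters.
Context {R : realType}.
Variables (mu eps : R) (hmu : 0 < mu) (heps0 : 0 < eps) (heps1 : eps < mu ^+ 2 / 4).
Implicit Types (F G : jet R) (x c : R).

Local Notation a := (mu - bpar mu eps).
Local Notation F0 := (jet_of (f0 mu eps)).
Local Notation F1 := (jet_of (f1 mu eps)).
Local Notation K := (jet_of (f0 mu eps)^`()%classic).
Local Notation K1 := (jet_of (f0 mu eps)^`(2)%classic).

Lemma discr_gt0 : 0 < mu ^+ 2 - 4 * eps.
Proof. by rewrite subr_gt0 mulrC -ltr_pdivlMr. Qed.

Lemma bpar_gt0 : 0 < bpar mu eps.
Proof.
rewrite divr_gt0// subr_gt0 -(ltr_pXn2r (n := 2)) ?nnegrE ?sqrtr_ge0 ?ltW//.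
by rewrite sqr_sqrtr ?ltrBlDr ?ltrDl ?mulr_gt0// ltW// discr_gt0.
Qed.

Lemma a_gap : 2 * a - mu = Num.sqrt (mu ^+ 2 - 4 * eps).
Proof. by rewrite /bpar; field. Qed.

(** [a] is the larger root of t^2 - mu t + eps. Lying strictly above mu / 2, as eps < mu^2 / 4
    ensures, it gives f0 finite norm. *)
Lemma a_gt : mu / 2 < a.
Proof. by have := sqrtr_gt0 (mu ^+ 2 - 4 * eps); rewrite discr_gt0 -a_gap; lra. Qed.

Lemma a_gt0 : 0 < a.
Proof. by rewrite (lt_trans _ a_gt)// divr_gt0. Qed.

Lemma a_prod : a * (mu - a) = eps.
Proof.
have e : Num.sqrt (mu ^+ 2 - 4 * eps) ^+ 2 = mu ^+ 2 - 4 * eps by rewrite sqr_sqrtr// ltW// discr_gt0.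
transitivity ((mu ^+ 2 - Num.sqrt (mu ^+ 2 - 4 * eps) ^+ 2) / 4); first by rewrite /bpar; field.
by rewrite e; field.
Qed.

Let b0 := ltW bpar_gt0.
Let sol0 := f0_solution eps hmu.
Let s0 := sol0.1.
Let mu1 : 0 < mu + 1 := addr_gt0 hmu ltr01.
Let a1 : 0 < a + 1 := addr_gt0 a_gt0 ltr01.

Lemma D_space_F0 : D_space mu F0.
Proof. by apply: D_space_smooth => //; exact: solution_inD a_gt sol0. Qed.

Lemma D_space_F1 : D_space mu F1.
Proof. by apply: D_space_smooth; [|exact: f1_smooth|exact: f1_inD a_gt]. Qed.

Lemma f0_derive_lt0 x : 0 <= x -> (f0 mu eps)^`()%classic x < 0.
Proof.
by apply: (solution_derive_lt0 hmu a_gt0 sol0) => t t0; exact: f0_gt0.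
Qed.

Lemma kernel_K : kernel mu a K.
Proof.
apply: solution_kernel (solution_derive1 sol0) _ => x x0.
by rewrite lt_eqF// f0_derive_lt0.
Qed.

(** The sign argument is applied a second time, to the positive solution - f0' of the shifted
    equation; it gives f0'' > 0. *)
Lemma kernel_K1 : kernel (mu + 1) (a + 1) K1.
Proof.
have sol1 := solution_derive1 sol0.
apply: solution_kernel (solution_derive1 sol1) _ => x x0.
have : (fun x => -1 * (f0 mu eps)^`()%classic x)^`()%classic x < 0.
  apply: (solution_derive_lt0 mu1 a1 (solution_scale (-1) sol1)) => // t t0.
  by rewrite mulN1r oppr_gt0 f0_derive_lt0.
have d : is_derive x 1 (f0 mu eps)^`()%classic ((f0 mu eps)^`(2)%classic x) := isd_derive1 (sol0.1 1%N x).
rewrite (isd_val (isdM (isd_cst (-1) x) d)) mulr0 addr0 mulN1r oppr_lt0.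
by move=> h; rewrite gt_eqF.
Qed.

Lemma F1_jet x : 0 < x -> [/\
  j0 F1 x = x * j1 F0 x + (mu - 1) / 2 * j0 F0 x,
  j1 F1 x = x * j2 F0 x + (mu + 1) / 2 * j1 F0 x &
  j2 F1 x = x * j2 K x + (mu + 3) / 2 * j2 F0 x].
Proof.
by move=> x0; split; [exact/f1E/ltW|exact: f1_derive|exact: f1_derive2].
Qed.

Lemma int_TopE F : int_dmu mu (fun x => Top mu eps F x ^+ 2) = normT mu a F.
Proof. by apply: int_ext => x _; rewrite /Top /TopA /jA /jB; ring. Qed.

Lemma int_sqr_derive F : int_dmu mu (fun x => j1 F x ^+ 2 * x) = P0 mu F.
Proof. by apply: int_ext => x _; rewrite /jB; ring. Qed.

Lemma QfE F : Qf mu F = ip mu (jA F) (jA F).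
Proof.
apply: eq_Rintegral => x; rewrite inE => /half_lineP x0.
by rewrite sqr_weight// /jA; ring.
Qed.

Lemma P0fE F : P0f mu F = P0 mu F.
Proof.
apply: eq_Rintegral => x; rewrite inE => /half_lineP x0.
by rewrite mul_weight// /jB; ring.
Qed.

Lemma P1fE F : inD mu F ->
  P1f mu eps F = ip mu (jB F) (jB F) - eps * ip mu (j0 F) (j0 F).
Proof.
move=> [_ hB _ hD]; rewrite -mulNr -(ipZl _ hD hD) -(int_ip2 hB hB (L2Z (- eps) hD) hD).
by apply: int_ext => x _; rewrite /jB; ring.
Qed.

Lemma energy_identity F : Dlim mu nice F ->
  Qf mu F + P1f mu eps F - (1 + Num.sqrt (mu ^+ 2 - 4 * eps)) * P0f mu F = normT mu a F.
Proof.
move=> dF; rewrite (normT_expand hmu a dF) QfE P0fE (P1fE dF.1) a_prod a_gap.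
by rewrite addrA.
Qed.

End parameters.

(** * Translation of the statement into the forms [P0], [PP] and [normT] *)

Theorem theorem2p4 (R : realType) (mu eps : R)
  (hmu : 0 < mu) (heps0 : 0 < eps) (heps1 : eps < mu ^+ 2 / 4) :
  let F0 := jet_of (f0 mu eps) in
  let F1 := jet_of (f1 mu eps) in
  let orth := fun F : jet R => int_dmu mu (fun x => j0 F x * Lop mu F0 x) = 0 in
  let intT := fun F : jet R => int_dmu mu (fun x => Top mu eps F x ^+ 2) in
  let intL := fun F : jet R => int_dmu mu (fun x => j0 F x * Lop mu F x) in
  let infC := fun F : jet R =>
    inf [set int_dmu mu (fun x => (j1 F x - C * j1 F0 x) ^+ 2 * x)
        | C in [set: R]] in
  let bracket := fun F : jet R =>
    int_dmu mu (fun x => j1 F x ^+ 2 * x)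
    - int_dmu mu (fun x => j1 F x * j1 F0 x * x) ^+ 2
      / int_dmu mu (fun x => j1 F0 x ^+ 2 * x) in
  [/\ D_space mu F0,
      (* the inequality on the constrained space *)
      (forall F : jet R, D_space mu F -> orth F -> 2 * intL F <= intT F),
      (* optimality of 2 *)
      (forall K : R,
         (forall F : jet R, D_space mu F -> orth F -> K * intL F <= intT F) ->
         K <= 2),
      (* attainment at f_1, only at its multiples; second formula for f_1 *)
      [/\ D_space mu F1, orth F1, 0 < intL F1, intT F1 = 2 * intL F1 &
          (forall F : jet R, D_space mu F -> orth F ->
             (intT F = 2 * intL F <-> exists c : R, D_eq mu F (jscale c F1)))
          /\
          (forall x : R, 0 <= x ->
             f1 mu eps x =
             - (1 / 2) * ((1 - mu) * f0 mu eps x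
                          - 2 * x * (f0 mu eps)^`()%classic x))] &
      (* the unconstrained form *)
      forall F : jet R, D_space mu F ->
        [/\ Qf mu F + P1f mu eps F
              - (1 + Num.sqrt (mu ^+ 2 - 4 * eps)) * P0f mu F = intT F,
            2 * infC F <= intT F,
            2 * infC F = 2 * bracket F &
            intT F = 2 * infC F <->
              exists c0 c1 : R, D_eq mu F (jadd (jscale c0 F0) (jscale c1 F1))]].
Proof.
move=> F0 F1 orth intT intL infC br.
have dlim F (h : D_space mu F) := D_space_Dlim hmu h.
have D0 := D_space_F0 hmu heps1; have D1 := D_space_F1 hmu heps1.
have d0 := dlim _ D0; have d1 := dlim _ D1.
have sol0 := f0_solution eps hmu; have s0 := sol0.1.
have kK := kernel_K hmu heps0 heps1; have kK1 := kernel_K1 hmu heps0 heps1.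
have F1E := F1_jet hmu heps0 heps1.
have TF0 x (_ : 0 < x) := solution_TopA sol0 x.
pose K := jet_of (f0 mu eps)^`()%classic.
pose K1 := jet_of (f0 mu eps)^`(2)%classic.
have K0E x (_ : 0 < x) : j0 K x = j1 F0 x by [].
have KE x (_ : 0 < x) : j1 K x = j2 F0 x by [].
have K1E x (_ : 0 < x) : j0 K1 x = j1 K x by [].
have T0 := TT_F0 TF0; have gap := gap_D hmu d0 kK K0E.
have o1 := orth_F1 hmu d0 F1E.
have n1 := normT_F1 hmu d1 TF0 kK K0E KE F1E.
have p0 := P0_F0_gt0 d0 kK K0E.
have p1 := P0_F1_gt0 hmu d0 d1 TF0 kK kK1 K0E KE K1E F1E.
have ext := extremal hmu d0 d1 TF0 kK kK1 K0E KE K1E F1E.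
have orthE F : D_space mu F -> int_dmu mu (fun x => j0 F x * Lop mu F0 x) = PP mu F F0.
  by move=> hF; exact: (orthE hmu (smooth_reg s0) d0 (dlim _ hF)).
have intLE F : D_space mu F -> intL F = P0 mu F by move=> hF; exact: (intLE hmu (dlim _ hF)).
have intTE F : intT F = normT mu (mu - bpar mu eps) F by exact: int_TopE.
have oF1 : orth F1 by rewrite /orth orthE.
have brE F : br F = bracket mu F0 F.
  rewrite /br /bracket !int_sqr_derive; congr (_ - _ ^+ 2 / _).
  by apply: int_ext => x _; rewrite /jB; ring.
have infE F : D_space mu F -> infC F = bracket mu F0 F.
  move=> /dlim[hF _]; rewrite -(inf_bracket d0 p0 hF); congr inf.
  have e C : int_dmu mu (fun x => (j1 F x - C * j1 F0 x) ^+ 2 * x) =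
      P0 mu (jadd F (jscale (- C) F0)).
    by apply: int_ext => x _; rewrite /jB /=; ring.
  by apply/seteqP; split=> _ [C _ <-]; exists C.
split.
- exact: D0.
- by move=> F hF; rewrite /orth (orthE F hF) (intLE F hF) intTE => oF; exact: (gap _ (dlim _ hF) oF).
(* [F1] is itself admissible, and P0[F1] > 0 can be cancelled from k P0[F1] <= 2 P0[F1]. *)
- by move=> k /(_ F1 D1 oF1); rewrite (intLE F1 D1) intTE n1 ler_pM2r.
- split; [exact: D1|exact: oF1|by rewrite (intLE F1 D1)|by rewrite (intLE F1 D1) intTE|].
  split=> [F hF|x x0]; last first.
    by rewrite (f1E hmu (ltW (bpar_gt0 hmu heps0 heps1)) x0); field.
  rewrite /orth (orthE F hF) => oF; rewrite (intLE F hF) intTE.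
  exact: (extremal_iff d1 n1 ext (dlim _ hF) oF).
move=> F hF; have dF := dlim _ hF; rewrite (infE F hF) brE intTE; split.
- exact: (energy_identity hmu heps1 dF).
- exact: (bracket_le d0 T0 gap p0 dF).
- by [].
- exact: (bracket_iff d0 d1 T0 o1 n1 p0 ext dF).
Qed.
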